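(* There exist an excellent map $g : \mathbf{R}^3 \to \mathbf{R}^2$ and a regular value $y \in \mathbf{R}^2$ of $g$ such that $g^{-1}(y)$ is a (non-empty) link in $\mathbf{R}^3$ and no component of $g^{-1}(y)$ is linked by any component of $S(g)$; more precisely, $S(g)$ is an unknotted circle contained in a $3$-ball in $\mathbf{R}^3$ disjoint from $g^{-1}(y)$.
   Context: All maps are $C^\infty$. A smooth map $g: \mathbf{R}^3 \to \mathbf{R}^2$ is excellent if every singular point (point where $dg$ has rank $<2$) is a fold singularity, i.e. $g$ is given in suitable smooth local coordinates of source and target by $(x,y,z) \mapsto (x, y^2 \pm z^2)$ at the origin, or a cusp singularity, i.e. $g$ is given by $(x,y,z) \mapsto (x, y^3 + xy - z^2)$ at the origin. $S(g)$ denotes the set of singular points of $g$. A link is a disjoint union of finitely many smoothly embedded circles. *)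

(* Defs.v *)
From HB Require Import structures.
From mathcomp Require Import all_boot all_order all_algebra.
From mathcomp Require Import all_classical all_reals all_analysis.

Set Implicit Arguments.
Unset Strict Implicit.
Unset Printing Implicit Defensive.
Import Order.TTheory GRing.Theory Num.Theory numFieldNormedType.Exports.
Local Open Scope classical_set_scope.
Local Open Scope ring_scope.

(* Used only for finite-dimensional V and open U: f is C^k on U when its
   iterated directional derivatives of order < k are differentiable and those
   of order <= k are continuous. *)
Fixpoint Ck_on (R : realType) (V W : normedModType R) (k : nat)
    (U : set V) (f : V -> W) : Prop :=
  match k with
  | 0%N => forall x, U x -> {for x, continuous f}
  | k'.+1 => (forall x, U x -> differentiable f x) /\
             (forall v, Ck_on k' U (fun x => 'D_v f x))
  end.

Definition smooth_on (R : realType) (V W : normedModType R)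
    (U : set V) (f : V -> W) : Prop := forall k, Ck_on k U f.

Definition diffeo_on (R : realType) (V W : normedModType R)
    (U : set V) (U' : set W) (f : V -> W) : Prop :=
  [/\ open U, open U', smooth_on U f & exists h : W -> V,
    [/\ smooth_on U' h, forall x, U x -> U' (f x), forall y, U' y -> U (h y),
        forall x, U x -> h (f x) = x & forall y, U' y -> f (h y) = y]].

Definition row2 (R : realType) (a b : R) : 'rV[R]_2 :=
  \row_(j < 2) (if j == 0 then a else b).

Definition singular_set (R : realType) (g : 'rV[R]_3 -> 'rV[R]_2) :
  set 'rV[R]_3 := [set p | (\rank ('J g p) < 2)%N].

Definition regular_value (R : realType) (g : 'rV[R]_3 -> 'rV[R]_2)
    (y : 'rV[R]_2) : Prop :=
  forall p, g p = y -> ~ singular_set g p.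

(* Near p, g is the germ at the origin of m, up to smooth coordinate changes
   phi of the source (0 |-> p) and psi of the target (g p |-> 0). *)
Definition locally_given_by (R : realType) (m g : 'rV[R]_3 -> 'rV[R]_2)
    (p : 'rV[R]_3) : Prop :=
  exists (U U' : set 'rV[R]_3) (V V' : set 'rV[R]_2)
         (phi : 'rV[R]_3 -> 'rV[R]_3) (psi : 'rV[R]_2 -> 'rV[R]_2),
    [/\ diffeo_on U U' phi, diffeo_on V V' psi,
        U 0 /\ phi 0 = p, V (g p) /\ psi (g p) = 0 &
        forall u, U u -> V (g (phi u)) /\ psi (g (phi u)) = m u].

Definition fold_model (R : realType) (s : bool) (u : 'rV[R]_3) : 'rV[R]_2 :=
  row2 (u 0 0) (u 0 1 ^+ 2 + (-1) ^+ s * u 0 2%R ^+ 2).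

Definition cusp_model (R : realType) (u : 'rV[R]_3) : 'rV[R]_2 :=
  row2 (u 0 0) (u 0 1 ^+ 3 + u 0 0 * u 0 1 - u 0 2%R ^+ 2).

Definition fold_point (R : realType) (g : 'rV[R]_3 -> 'rV[R]_2)
    (p : 'rV[R]_3) : Prop :=
  exists s : bool, locally_given_by (fold_model s) g p.

Definition cusp_point (R : realType) (g : 'rV[R]_3 -> 'rV[R]_2)
    (p : 'rV[R]_3) : Prop :=
  locally_given_by (@cusp_model R) g p.

Definition excellent (R : realType) (g : 'rV[R]_3 -> 'rV[R]_2) : Prop :=
  smooth_on setT g /\
  forall p, singular_set g p -> fold_point g p \/ cusp_point g p.

(* c is a smooth embedding of R / Z, given as a 1-periodic immersion of R that
   is injective on a period. *)
Definition embedded_circle (R : realType) (K : set 'rV[R]_3) : Prop :=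
  exists c : R^o -> 'rV[R]_3,
    [/\ smooth_on setT c,
        forall t, c (t + 1) = c t,
        forall s t, 0 <= s < 1 -> 0 <= t < 1 -> c s = c t -> s = t,
        forall t, 'D_1 c t != 0 &
        K = range c].

Definition link (R : realType) (L : set 'rV[R]_3) : Prop :=
  exists (n : nat) (K : 'I_n -> set 'rV[R]_3),
    [/\ forall i, embedded_circle (K i),
        forall i j, i != j -> K i `&` K j = set0 &
        L = \bigcup_i K i].

Definition round_circle (R : realType) : set 'rV[R]_3 :=
  [set x | x 0 0 ^+ 2 + x 0 1 ^+ 2 = 1 /\ x 0 2%R = 0].

(* A smooth ambient isotopy, parametrized by [0, 1] and extended smoothly to
   all parameter values. *)
Definition ambient_isotopic (R : realType) (A B : set 'rV[R]_3) : Prop :=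
  exists H : R^o * 'rV[R]_3 -> 'rV[R]_3,
    [/\ smooth_on setT H,
        forall t, 0 <= t <= 1 -> diffeo_on setT setT (fun x => H (t, x)),
        forall x, H (0, x) = x &
        (fun x => H (1, x)) @` A = B].

Definition unknotted_circle (R : realType) (C : set 'rV[R]_3) : Prop :=
  embedded_circle C /\ ambient_isotopic (@round_circle R) C.

(* The norm of 'rV[R]_3 is the sup norm, hence the explicit Euclidean ball. *)
Definition closed_unit_ball (R : realType) : set 'rV[R]_3 :=
  [set x | \sum_i x 0 i ^+ 2 <= 1].

Definition ball3 (R : realType) (B : set 'rV[R]_3) : Prop :=
  exists (U U' : set 'rV[R]_3) (f : 'rV[R]_3 -> 'rV[R]_3),
    [/\ diffeo_on U U' f, @closed_unit_ball R `<=` U &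
        B = f @` @closed_unit_ball R].

Definition component_of (R : realType) (A C : set 'rV[R]_3) : Prop :=
  exists2 x, A x & C = connected_component A x.

(* K is linked by C when no 3-ball separates C from K. *)
Definition linked_by (R : realType) (K C : set 'rV[R]_3) : Prop :=
  ~ exists B, [/\ ball3 B, C `<=` B & B `&` K = set0].

(* Main.v *)
Require Import Defs.
From HB Require Import structures.
From mathcomp Require Import all_boot all_order all_algebra.
From mathcomp Require Import all_classical all_reals all_analysis.
From mathcomp Require Import ring lra.

Set Implicit Arguments.
Unset Strict Implicit.
Unset Printing Implicit Defensive.
Import Order.TTheory GRing.Theory Num.Theory numFieldNormedType.Exports.
Local Open Scope classical_set_scope.
Local Open Scope ring_scope.

(** Let (U, V) be the point of the unit sphere of C^2 corresponding to a point of R^3 by inverse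
    stereographic projection, and let g = (U^2 - V^2) Q with Q real and positive. The fibre of g
    over 0 is U = V or U = - V, the Hopf link, and g is regular there. For Q = 1 the singular set
    is the Clifford torus Re (U conj V) = 0, on which |g| is maximal in the normal direction and
    constant on the circles along which U^2 - V^2 does not move. The perturbation Q = 100 + m
    makes |g| nonconstant on these circles; m is chosen so that its critical points on them form
    one closed curve, contractible in the torus, which folds except at two cusps. This curve is
    explicit enough to be carried to the round circle by a composition of shears, and so is a
    disc that it bounds in the complement of the Hopf link. *)

(** * Calculus of smooth maps *)

Section SmoothCalculus.
Context {R : realType}.
Implicit Types (V W : normedModType R) (k n : nat).

(** The summand of [weight] containing [clif] vanishes on the torus and cancels the first derivative
    of [d] across it. The torus thus stays critical in the normal direction, and the singular set
    stays on the torus. There U = (C + iS) K and V = i (C + iS) s with K^2 + s^2 = 1; the circles of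
    constant U^2 - V^2 are those with C + iS fixed, and on them m = s (7 C + 3 K) is critical when 6
    K^2 + 7 C K - 3 = 0. As (C, S, K, s) and its negative give the same point, only the positive
    root K counts. It is at most 1 exactly for C >= -3/7, so the two branches of s = +- sqrt (1 -
    K^2) over this arc join at its ends, where s = 0, into one curve; the ends are the cusps. This
    requires 7 > 3. Moreover 7^2 + 8 * 3^2 = 11^2, which makes the bound v^2 <= 8 on the parameter v
    = s / K rational and the later formulas explicit. The constant 100 dominates every perturbation
    term in the positivity estimates. *)

Lemma differentiable_is_linear_approx V W (f : V -> W) (x : V) (L : {linear V -> W}) :
  continuous L ->
  (forall e, 0 < e -> \forall h \near (0 : V), `|f (h + x) - f x - L h| <= e * `|h|) ->
  differentiable f x /\ 'd f x = L :> (V -> W).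
Proof.
move=> cL H.
have E : f \o shift x = cst (f x) + L +o_ 0 id.
  apply/eqaddoP => e e0; near=> h.
  rewrite -[X in `|X|]/(f (h + x) - (f x + L h)) opprD addrA.
  by near: h; exact: H.
have dL := diff_unique cL E.
by split=> //; apply/diff_locallyP; rewrite dL.
Unshelve. all: by end_near. Qed.

Lemma differentiable_approx V W (f : V -> W) (x : V) : differentiable f x ->
  forall e, 0 < e -> \forall h \near (0 : V), `|f (h + x) - f x - 'd f x h| <= e * `|h|.
Proof.
move=> /diff_locally /eqaddoP H e e0; near=> h.
have : `|(f \o shift x - (cst (f x) + 'd f x)) h| <= e * `|h|.
  by near: h; exact: H.
by rewrite -[X in `|X| <= _]/(f (h + x) - (f x + 'd f x h)) opprD addrA.
Unshelve. all: by end_near. Qed.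

Lemma near_eq_differentiable V W (f g : V -> W) (x : V) :
  {near x, f =1 g} -> differentiable f x -> differentiable g x.
Proof.
move=> fg df.
have [] // := @differentiable_is_linear_approx _ _ g x ('d f x); first exact: diff_continuous.
move=> e e0; near=> h.
have -> : g (h + x) = f (h + x).
  near: h; have /nbhs0P := fg; apply: filterS => h /=; by rewrite addrC.
rewrite -(nbhs_singleton fg).
near: h; exact: differentiable_approx.
Unshelve. all: by end_near. Qed.

Lemma Ck_onS V W k (U : set V) (f : V -> W) : Ck_on k.+1 U f -> Ck_on k U f.
Proof.
elim: k f => [|k IH] f [df Df].
  by move=> x /df; exact: differentiable_continuous.
by split=> // v; apply: IH; exact: Df.
Qed.

Lemma Ck_on_continuous V W k (U : set V) (f : V -> W) : Ck_on k U f ->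
  forall x, U x -> {for x, continuous f}.
Proof. by elim: k => // k IH /Ck_onS. Qed.

Lemma sub_Ck_on V W k (U U' : set V) (f : V -> W) :
  U' `<=` U -> Ck_on k U f -> Ck_on k U' f.
Proof.
move=> sU; elim: k f => [|k IH] f /=; first by move=> H x /sU; exact: H.
by move=> [df Df]; split=> [x /sU/df//|v]; exact/IH.
Qed.

Lemma eq_Ck_on V W k (U : set V) (f g : V -> W) : open U ->
  (forall x, U x -> f x = g x) -> Ck_on k U f -> Ck_on k U g.
Proof.
move=> oU; have nE (f1 g1 : V -> W) : (forall x, U x -> f1 x = g1 x) ->
    forall x, U x -> \forall y \near x, f1 y = g1 y.
  move=> fg x Ux.
  by apply: filterS (open_nbhs_nbhs (conj oU Ux)) => y; exact: fg.
elim: k f g => [|k IH] f g fg.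
  move=> cf x Ux.
  have := cf x Ux; rewrite /prop_for /continuous_at (fg _ Ux).
  by apply: cvg_trans; apply: near_eq_cvg; apply: nE Ux => y /fg.
move=> [df Df]; split=> [x Ux|v].
  by apply: near_eq_differentiable (df x Ux); exact: nE.
by apply: IH (Df v) => x Ux; apply: near_eq_derive; exact: nE.
Qed.

Lemma Ck_on_cst V W k (U : set V) (w : W) : Ck_on k U (fun=> w).
Proof.
elim: k w => [|k IH] w; first by move=> x _; exact: cst_continuous.
split=> [x _|v]; first exact: differentiable_cst.
have -> : (fun x : V => 'D_v (fun=> w) x) = (fun=> 0 : W); last exact: IH.
by apply/funext => x; exact: derive_cst.
Qed.

Lemma Ck_on_linear V W k (U : set V) (L : {linear V -> W}) : continuous L -> Ck_on k U L.
Proof.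
move=> cL; case: k => [|k]; first by move=> x _; exact: cL.
split=> [x _|v]; first exact: linear_differentiable.
have -> : (fun x : V => 'D_v L x) = (fun=> L v); last exact: Ck_on_cst.
apply/funext => x; rewrite deriveE; last exact: linear_differentiable.
by rewrite diff_lin.
Qed.

Lemma Ck_onD V W k (U : set V) (f g : V -> W) : open U ->
  Ck_on k U f -> Ck_on k U g -> Ck_on k U (fun x => f x + g x).
Proof.
move=> oU; elim: k f g => [|k IH] f g.
  by move=> cf cg x Ux; apply: continuousD; [exact: cf|exact: cg].
move=> [df Df] [dg Dg]; split=> [x Ux|v].
  by apply: differentiableD; [exact: df|exact: dg].
apply: eq_Ck_on (IH _ _ (Df v) (Dg v)) => // x Ux.
by rewrite -deriveD //; apply: diff_derivable; [exact: df|exact: dg].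
Qed.

Lemma Ck_on_sum V W k (U : set V) (I : Type) (r : seq I) (F : I -> V -> W) :
  open U -> (forall i, Ck_on k U (F i)) -> Ck_on k U (fun x => \sum_(i <- r) F i x).
Proof.
move=> oU HF; elim: r => [|i r IH].
  by apply: eq_Ck_on (Ck_on_cst k U (0 : W)) => // x _; rewrite big_nil.
by apply: eq_Ck_on (Ck_onD oU (HF i) IH) => // x _; rewrite big_cons.
Qed.

Lemma Ck_onM V k (U : set V) (f g : V -> R^o) : open U ->
  Ck_on k U f -> Ck_on k U g -> Ck_on k U (fun x => f x * g x : R^o).
Proof.
move=> oU; elim: k f g => [|k IH] f g.
  by move=> cf cg x Ux; apply: continuousM; [exact: cf|exact: cg].
move=> Hf Hg; have [df Df] := Hf; have [dg Dg] := Hg; split=> [x Ux|v].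
  by apply: differentiableM; [exact: df|exact: dg].
have := Ck_onD oU (IH _ _ (Ck_onS Hf) (Dg v)) (IH _ _ (Ck_onS Hg) (Df v)).
apply: eq_Ck_on => // x Ux.
rewrite (_ : (fun x => _) = f * g)//.
by rewrite deriveM //; apply: diff_derivable; [exact: df|exact: dg].
Qed.

Lemma Ck_onN V k (U : set V) (f : V -> R^o) : open U ->
  Ck_on k U f -> Ck_on k U (fun x => - f x : R^o).
Proof.
move=> oU Hf; apply: eq_Ck_on (Ck_onM oU (Ck_on_cst k U (-1 : R^o)) Hf) => // x _.
by rewrite mulN1r.
Qed.

Lemma Ck_onV V k (U : set V) (f : V -> R^o) : open U ->
  (forall x, U x -> f x != 0) -> Ck_on k U f -> Ck_on k U (fun x => (f x)^-1 : R^o).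
Proof.
move=> oU f0; elim: k f f0 => [|k IH] f f0 Hf.
  by move=> x Ux; apply: cvgV; [exact: f0|exact: Hf].
have [df Df] := Hf; have /IH Hi := Ck_onS Hf; split=> [x Ux|v].
  by apply: differentiableV; [exact: df|exact: f0].
have := Ck_onN oU (Ck_onM oU (Ck_onM oU (Hi f0) (Hi f0)) (Df v)).
apply: eq_Ck_on => // x Ux.
rewrite deriveV ?f0 //; last by apply: diff_derivable; exact: df.
by rewrite scaleNr /GRing.scale /= expr2 invfM.
Qed.

Lemma Ck_onZl V W k (U : set V) (f : V -> R) (w : W) : open U ->
  Ck_on k U f -> Ck_on k U (fun x => f x *: w).
Proof.
move=> oU; elim: k f => [|k IH] f.
  by move=> cf x Ux; apply: cvgZr_tmp; exact: cf.
move=> [df Df]; split=> [x Ux|v].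
  by apply: differentiableZl; exact: df.
apply: eq_Ck_on (IH _ (Df v)) => // x Ux.
rewrite !deriveE ?diffZl //; do ?[exact: df].
by apply: differentiableZl; exact: df.
Qed.

Lemma Ck_on_coord V n k (U : set V) (f : V -> 'rV[R]_n) (j : 'I_n) : open U ->
  Ck_on k U f -> Ck_on k U (fun x => f x 0 j).
Proof.
move=> oU; elim: k f => [|k IH] f.
  move=> cf x Ux; apply: (@continuous_comp _ _ _ f (fun M : 'rV[R]_n => M 0 j)).
    exact: cf.
  exact: coord_continuous.
move=> [df Df]; split=> [x Ux|v].
  apply: (@differentiable_comp _ _ _ _ f (fun M : 'rV[R]_n => M 0 j : R)).
    exact: df.
  exact: differentiable_coord.
apply: eq_Ck_on (IH _ (Df v)) => // x Ux.
by rewrite derive_mx ?mxE //; apply: diff_derivable; exact: df.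
Qed.

Lemma Ck_on_row V n k (U : set V) (f : V -> 'rV[R]_n) : open U ->
  (forall j, Ck_on k U (fun x => f x 0 j)) -> Ck_on k U f.
Proof.
move=> oU H.
apply: eq_Ck_on (Ck_on_sum (index_enum _) oU (fun j => Ck_onZl ('e_j : 'rV[R]_n) oU (H j))) => //.
by move=> x _; rewrite -row_sum_delta.
Qed.

Lemma derive_comp_row V n (f : 'rV[R]_n -> R) (g : V -> 'rV[R]_n) (x v : V) :
  differentiable g x -> differentiable f (g x) ->
  'D_v (f \o g) x = \sum_j 'D_v (fun y => g y 0 j) x * 'D_('e_j) f (g x).
Proof.
move=> dg df; rewrite deriveE; last exact: differentiable_comp.
rewrite diff_comp //= [X in 'd f _ X]row_sum_delta linear_sum /=.
apply: eq_bigr => j _; rewrite linearZ /= -[X in _ *: X]deriveE //.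
congr (_ * _); rewrite -deriveE //.
by rewrite derive_mx ?mxE //; exact: diff_derivable.
Qed.

(** The chain rule writes a directional derivative of the composite through partial derivatives of
    [f] composed with [g]. These are composites of the same shape, so the induction on k runs over
    all [f] at once. *)
Lemma Ck_on_comp_row V n k (U : set V) (U' : set 'rV[R]_n)
    (f : 'rV[R]_n -> R) (g : V -> 'rV[R]_n) :
  open U -> open U' -> (forall x, U x -> U' (g x)) ->
  Ck_on k U g -> Ck_on k U' f -> Ck_on k U (fun x => f (g x)).
Proof.
move=> oU oU' gU; elim: k f => [|k IH] f.
  by move=> cg cf x Ux; apply: continuous_comp; [exact: cg|exact/cf/gU].
move=> Hg Hf; have [dg Dg] := Hg; have [df Df] := Hf; split=> [x Ux|v].
  by apply: differentiable_comp; [exact: dg|exact/df/gU].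
have H j := Ck_onM oU (Ck_on_coord j oU (Dg v)) (IH _ (Ck_onS Hg) (Df 'e_j)).
apply: eq_Ck_on (Ck_on_sum (index_enum _) oU H) => // x Ux.
rewrite [RHS]derive_comp_row; [|exact: dg|exact/df/gU].
apply: eq_bigr => j _; congr (_ * _).
by rewrite derive_mx ?mxE //; apply: diff_derivable; exact: dg.
Qed.

Lemma is_derive_comp1 V (p : R -> R) (f : V -> R) (x v : V) (a : R) :
  is_derive (f x) 1 p a -> differentiable f x ->
  differentiable (fun y => p (f y)) x /\ 'D_v (fun y => p (f y)) x = 'D_v f x * a.
Proof.
move=> [dp pa] df; have dp' : differentiable p (f x) by exact/derivable1_diffP.
have dpf : differentiable (fun y => p (f y)) x by exact: differentiable_comp.
split=> //; rewrite !deriveE // diff_comp //= diff1E //.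
by rewrite derive1E pa.
Qed.

Lemma Ck_on_sqrt V k (U : set V) (f : V -> R) : open U ->
  (forall x, U x -> 0 < f x) -> Ck_on k U f -> Ck_on k U (fun x => Num.sqrt (f x)).
Proof.
move=> oU f0; elim: k => [|k IH].
  move=> cf x Ux; apply: (@continuous_comp _ _ _ f Num.sqrt); first exact: cf.
  exact: sqrt_continuous.
move=> Hf; have [df Df] := Hf; have Hs := IH (Ck_onS Hf); split=> [x Ux|v].
  by have [] := is_derive_comp1 0 (is_derive1_sqrt (f0 x Ux)) (df x Ux).
have s0 x : U x -> 2 * Num.sqrt (f x) != 0.
  by move=> /f0 fx; rewrite mulf_neq0 // lt0r_neq0 // sqrtr_gt0.
have := Ck_onM oU (Df v) (Ck_onV oU s0 (Ck_onM oU (Ck_on_cst k U (2:R)) Hs)).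
apply: eq_Ck_on => // x Ux.
by have [_ ->] := is_derive_comp1 v (is_derive1_sqrt (f0 x Ux)) (df x Ux).
Qed.

(** Both are treated in one induction because each is, up to sign, the derivative of the other. *)
Lemma Ck_on_sin_cos V k (U : set V) (f : V -> R) : open U ->
  Ck_on k U f -> Ck_on k U (fun x => sin (f x)) /\ Ck_on k U (fun x => cos (f x)).
Proof.
move=> oU; elim: k => [|k IH] Hf.
  split=> x Ux.
    by apply: (@continuous_comp _ _ _ f sin); [exact: Hf|exact: continuous_sin].
  by apply: (@continuous_comp _ _ _ f cos); [exact: Hf|exact: continuous_cos].
have [df Df] := Hf; have [Hs Hc] := IH (Ck_onS Hf).
split; (split=> [x Ux|v]).
- by have [] := is_derive_comp1 0 (is_derive_sin (f x)) (df x Ux).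
- apply: eq_Ck_on (Ck_onM oU (Df v) Hc) => // x Ux.
  by have [_ ->] := is_derive_comp1 v (is_derive_sin (f x)) (df x Ux).
- by have [] := is_derive_comp1 0 (is_derive_cos (f x)) (df x Ux).
- apply: eq_Ck_on (Ck_onM oU (Df v) (Ck_onN oU Hs)) => // x Ux.
  by have [_ ->] := is_derive_comp1 v (is_derive_cos (f x)) (df x Ux).
Qed.

End SmoothCalculus.

(** * Contractions and the local solution of an equation *)

Section InverseFunction.
Context {R : realType}.
Implicit Types (V W : normedModType R) (k n : nat).

Lemma Ck_on_prod V k (U : set V) (I : Type) (r : seq I) (F : I -> V -> R) :
  open U -> (forall i, Ck_on k U (F i)) -> Ck_on k U (fun x => \prod_(i <- r) F i x).
Proof.
move=> oU HF; elim: r => [|i r IH].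
  by apply: eq_Ck_on (Ck_on_cst k U (1 : R)) => // x _; rewrite big_nil.
by apply: eq_Ck_on (Ck_onM oU (HF i) IH) => // x _; rewrite big_cons.
Qed.

Lemma Ck_on_det V k n (U : set V) (M : V -> 'M[R]_n) : open U ->
  (forall i j, Ck_on k U (fun x => M x i j)) -> Ck_on k U (fun x => \det (M x)).
Proof.
move=> oU HM; rewrite /determinant; apply: Ck_on_sum => // s.
by apply: Ck_onM => //; [exact: Ck_on_cst|apply: Ck_on_prod].
Qed.

(** By the cofactor formula the entries of the inverse are rational in those of the matrix. *)
Lemma Ck_on_invmx V k n (U : set V) (M : V -> 'M[R]_n) : open U ->
  (forall x, U x -> M x \in unitmx) ->
  (forall i j, Ck_on k U (fun x => M x i j)) ->
  forall i j, Ck_on k U (fun x => invmx (M x) i j).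
Proof.
move=> oU uM HM i j.
have d0 x : U x -> \det (M x) != 0 by move=> /uM; rewrite unitmxE unitfE.
have Hc : Ck_on k U (fun x => \adj (M x) i j).
  apply: (@eq_Ck_on _ _ _ _ _ (fun x => (-1) ^+ (j + i) * \det (row' j (col' i (M x))))) => //.
    by move=> x _; rewrite mxE.
  apply: Ck_onM => //; first exact: Ck_on_cst.
  apply: Ck_on_det => // a b.
  by apply: eq_Ck_on (HM (lift j a) (lift i b)) => // x _; rewrite !mxE.
apply: eq_Ck_on (Ck_onM oU (Ck_onV oU d0 (Ck_on_det oU HM)) Hc) => // x Ux.
by rewrite /invmx uM // [RHS]mxE.
Qed.

Lemma mean_value V (f : V -> R) (x y : V) :
  (forall t : R, 0 <= t <= 1 -> differentiable f (y + t *: (x - y))) ->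
  exists2 t : R, 0 <= t <= 1 & f x - f y = 'd f (y + t *: (x - y)) (x - y).
Proof.
move=> df; pose g (t : R) := y + t *: (x - y).
have [dg g'E] : (forall t, differentiable g t) /\ (forall t, 'd g t 1 = x - y).
  have dZ t : differentiable (fun h : R => h *: (x - y)) t.
    by apply: differentiableZl.
  split=> t; first by apply: differentiableD.
  rewrite diffD // diff_cst /= add0r diffZl // -[X in X *: _]deriveE // derive_id.
  by rewrite scale1r.
have dfg (t : R) : 0 <= t <= 1 -> is_derive t 1 (f \o g) ('d f (g t) (x - y)).
  move=> /df dft; have dcomp : differentiable (f \o g) t by exact: differentiable_comp.
  apply: DeriveDef; first exact: diff_derivable.
  by rewrite deriveE // diff_comp // /= g'E.
have [|||c c01 E] := @MVT_segment R (f \o g) (fun t => 'd f (g t) (x - y)) 0 1.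
- exact: ler01.
- by move=> t /[!in_itv]/= /andP[t0 t1]; apply: dfg; rewrite !ltW.
- apply: derivable_within_continuous => t /[!in_itv]/= t01.
  by have [] := dfg t t01.
exists c; first by move: c01; rewrite in_itv.
by move: E; rewrite subr0 mulr1 /= /g scale1r scale0r addr0 (addrC y) subrK.
Qed.

HB.instance Definition _ m n := Complete.on (matrix R m n).

(** In the sup norm it suffices to bound each coordinate. By the mean value theorem on the segment,
    which stays in the convex ball, n partial derivatives of size at most 1/(2n) contribute at most
    1/2. *)
Lemma lipschitz_of_partials n (e : 'rV[R]_n -> 'rV[R]_n) (p : 'rV[R]_n) (r : R) :
  (forall x, `|x - p| < r -> differentiable e x) ->
  (forall x, `|x - p| < r -> forall i j, `|'J e x i j| <= (2 * n%:R)^-1) ->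
  forall x y, `|x - p| < r -> `|y - p| < r -> `|e x - e y| <= 2^-1 * `|x - y|.
Proof.
move=> de Je x y xr yr.
rewrite [leLHS]/Num.Def.normr/= mx_normrE (bigmax_le _) ?mulr_ge0//= => -[i j] _.
rewrite /= (ord1 i) !mxE.
have Bseg (t : R) : 0 <= t <= 1 -> `|y + t *: (x - y) - p| < r.
  move=> /andP[t0 t1].
  have -> : y + t *: (x - y) - p = (1 - t) *: (y - p) + t *: (x - p).
    apply/rowP => a; rewrite !mxE; ring.
  apply: le_lt_trans (ler_normD _ _) _; rewrite !normrZ ger0_norm ?subr_ge0 // (ger0_norm t0).
  have [->|t0'] := eqVneq t 0; first by rewrite mul0r addr0 subr0 mul1r.
  have tp : 0 < t by rewrite lt_neqAle eq_sym t0' t0.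
  nra.
have dej z : `|z - p| < r -> differentiable (fun x => e x 0 j : R) z.
  move=> /de dez; apply: (@differentiable_comp _ _ _ _ e (fun M : 'rV[R]_n => M 0 j : R)) => //.
  exact: differentiable_coord.
have [t t01 ->] := @mean_value _ (fun x => e x 0 j) x y (fun t t01 => dej _ (Bseg t t01)).
set z := y + _; have zr : `|z - p| < r by exact: Bseg.
have -> : 'd (fun x => e x 0 j : R) z (x - y) = \sum_i (x - y) 0 i * 'J e z i j.
  rewrite -deriveE; last exact: dej.
  have := deriveEjacobian (x - y) (de _ zr).
  move=> /(congr1 (fun M : 'rV[R]_n => M 0 j)); rewrite !mxE => <-.
  by rewrite derive_mx ?mxE //; apply: diff_derivable; exact: de.
apply: le_trans (ler_norm_sum _ _ _) _.
have H i0 : `|(x - y) 0 i0 * 'J e z i0 j| <= `|x - y| * (2 * n%:R)^-1.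
  rewrite normrM ler_pM //; last exact: Je.
  rewrite [leRHS]/Num.Def.normr/= mx_normrE.
  by apply: le_trans; last exact: (le_bigmax _ _ (0, i0)).
apply: le_trans (ler_sum _ (fun i0 _ => H i0)) _.
rewrite sumr_const card_ord -[leLHS]mulr_natr -mulrA.
have n0 : n%:R != 0 :> R by rewrite pnatr_eq0 -lt0n; exact: leq_ltn_trans (leq0n j) (ltn_ord j).
have -> : (2 * n%:R)^-1 * n%:R = 2^-1 :> R by field.
by rewrite mulrC.
Qed.

Lemma jacobianE n m (f : 'rV[R]_n -> 'rV[R]_m) (p : 'rV[R]_n) i j :
  differentiable f p -> 'J f p i j = 'D_('e_i) f p 0 j.
Proof. by move=> df; rewrite deriveEjacobian // -rowE [RHS]mxE. Qed.

Section Newton.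
Variables (n : nat) (f : 'rV[R]_n -> 'rV[R]_n) (p : 'rV[R]_n) (s : R).
Let B := invmx ('J f p).
Hypothesis s_gt0 : 0 < s.
Hypothesis contr : forall x y, `|x - p| <= s -> `|y - p| <= s ->
  `|(x - f x *m B) - (y - f y *m B)| <= 2^-1 * `|x - y|.

(** The contracted map x - f x *m B accounts for at most half of x - y, so the other summand carries
    at least half of it. *)
Lemma newton_expand x y : `|x - p| <= s -> `|y - p| <= s ->
  `|x - y| <= 2 * `|(f x - f y) *m B|.
Proof.
move=> xs ys; have := contr xs ys.
have -> : (x - f x *m B) - (y - f y *m B) = (x - y) - (f x - f y) *m B.
  by rewrite mulmxBl !opprB addrACA [RHS]addrACA (addrC (- (f x *m B))).
move=> H; have := ler_normD ((x - y) - (f x - f y) *m B) ((f x - f y) *m B).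
rewrite subrK; lra.
Qed.

(** Solutions are the fixed points of x + (z - f x) *m B. This map preserves the closed ball: the
    contraction contributes s/2 and the displacement of the centre less than s/2. *)
Lemma newton_solve z : `|(z - f p) *m B| < s / 2 -> 'J f p \in unitmx ->
  exists2 x, `|x - p| < s & f x = z.
Proof.
move=> zs uJ; pose K : set 'rV[R]_n := [set x | `|x - p| <= s].
pose T x := x + (z - f x) *m B.
have TE x : T x - p = ((x - f x *m B) - (p - f p *m B)) + (z - f p) *m B.
  apply/rowP => j; rewrite /T !mulmxBl !mxE; ring.
have Kp : K p by rewrite /K /= subrr normr0 ltW.
have TK : {homo T : x / K x >-> K x}.
  move=> x Kx; rewrite /K /= TE; apply: le_trans (ler_normD _ _) _.
  have := contr Kx Kp; move: Kx; rewrite /K /=; lra.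
have cg : is_contraction (mkfun_fun TK).
  exists (2^-1%:nng); split; first by rewrite /= invf_lt1 // ltr1n.
  move=> [x y] [Kx Ky] /=; rewrite /mkfun /T.
  rewrite (_ : _ - _ = (x - f x *m B) - (y - f y *m B)); first exact: contr.
  by apply/rowP => j; rewrite !mulmxBl !mxE; ring.
have cK : closed K.
  have -> : K = (fun x => `|x - p|) @^-1` [set t | t <= s] by [].
  apply: closed_comp; last exact: closed_le.
  move=> x _; apply: continuous_comp; last exact: norm_continuous.
  by apply: continuousB => //; exact: cst_continuous.
have [x Kx Tx] := banach_fixed_point cg cK (ex_intro _ p Kp).
have fx : f x = z.
  have : (z - f x) *m B = 0.
    have Tx' : x = x + (z - f x) *m B := Tx.
    by apply: (addrI x); rewrite addr0 -Tx'.
  move=> /(congr1 (fun M => M *m 'J f p)); rewrite mulmxKV // mul0mx => /eqP.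
  by rewrite subr_eq0 => /eqP.
exists x => //.
(* The fixed point is known to lie in the closed ball only; comparison with the centre makes the
   inequality strict. *)
have := newton_expand Kx Kp; rewrite fx; move: zs; lra.
Qed.
End Newton.

End InverseFunction.

(** * The inverse function theorem *)

Section LocalDiffeo.
Context {R : realType}.
Implicit Types (V W : normedModType R) (k n : nat).

Definition smooth_at V W (p : V) (f : V -> W) : Prop :=
  exists U, [/\ open U, U p & smooth_on U f].

Definition local_diffeo V W (p : V) (f : V -> W) : Prop :=
  exists U U', diffeo_on U U' f /\ U p.

Lemma mulmxr_continuous m n (B : 'M[R]_(m, n)) : continuous (mulmxr B : 'rV[R]_m -> 'rV[R]_n).
Proof.
suff H : Ck_on 0 setT (fun v : 'rV[R]_m => v *m B) by move=> v; exact: H.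
apply: Ck_on_row => [|j]; first exact: openT.
have H i : Ck_on 0 setT (fun v : 'rV[R]_m => v 0 i * B i j).
  apply: Ck_onM; [exact: openT| |exact: Ck_on_cst].
  by apply: (@Ck_on_coord _ _ _ _ _ (fun v : 'rV[R]_m => v)); [exact: openT|move=> x _; exact: id].
apply: eq_Ck_on (Ck_on_sum (index_enum _) openT H); first exact: openT.
by move=> v _; rewrite mxE.
Qed.

Lemma mulmxr_lipschitz m n (B : 'M[R]_(m, n)) :
  exists2 c : R, 0 < c & forall v : 'rV[R]_m, `|v *m B| <= c * `|v|.
Proof. exact: linear_lipschitz (@mulmxr_continuous _ _ B). Qed.

Lemma derive_comp_linear V W W' (L : {linear W -> W'}) (f : V -> W) (p v : V) :
  continuous L -> differentiable f p ->
  differentiable (L \o f) p /\ 'D_v (L \o f) p = L ('D_v f p).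
Proof.
move=> cL df; have dL := @linear_differentiable _ _ _ L (f p) cL.
have dLf : differentiable (L \o f) p := differentiable_comp df dL.
split=> //; rewrite !deriveE //.
have -> := diff_comp df dL.
by rewrite (diff_lin _ cL).
Qed.

(** The Jacobian of x - f x *m B vanishes at p, hence by continuity its entries are below any bound
    on a small ball. *)
Lemma newton_hypothesis n (f : 'rV[R]_n -> 'rV[R]_n) (p : 'rV[R]_n) (U : set 'rV[R]_n) :
  open U -> U p -> smooth_on U f -> 'J f p \in unitmx ->
  exists s : R, [/\ 0 < s, forall x, `|x - p| <= s -> U x &
    forall x y, `|x - p| <= s -> `|y - p| <= s ->
    `|(x - f x *m invmx ('J f p)) - (y - f y *m invmx ('J f p))| <= 2^-1 * `|x - y|].
Proof.
move=> oU Up sf uJ; set B := invmx _.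
pose e x := x - f x *m B.
have se : smooth_on U e.
  move=> k; apply: Ck_onD => //.
    by apply: (@Ck_on_linear _ _ _ _ _ idfun) => x; exact: id.
  apply: Ck_on_row => // j.
  have H i : Ck_on k U (fun v => f v 0 i * - B i j).
    by apply: Ck_onM => //; [apply: Ck_on_coord => //; exact: sf|exact: Ck_on_cst].
  apply: eq_Ck_on (Ck_on_sum (index_enum _) oU H) => // v _.
  by rewrite !mxE -sumrN; apply: eq_bigr => i _; rewrite mulrN.
have de x : U x -> differentiable e x by have [de _] := se 1%N; exact: de.
have df : differentiable f p by have [df _] := sf 1%N; exact: df.
have Je0 i j : 'J e p i j = 0.
  have [dfB DfB] := derive_comp_linear 'e_i (@mulmxr_continuous _ _ B) df.
  have DE : 'D_('e_i) e p = 'e_i - 'D_('e_i) f p *m B.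
    transitivity ('D_('e_i) id p - 'D_('e_i) (mulmxr B \o f) p).
      by apply: deriveB; [exact: derivable_id|exact: diff_derivable].
    by rewrite derive_id DfB.
  by rewrite jacobianE ?DE ?deriveEjacobian //; [rewrite mulmxK // subrr mxE|exact: de].
have nJ : \forall x \near p, U x /\ forall i j, `|'J e x i j| <= (2 * n%:R)^-1.
  have nU : \forall x \near p, U x by exact: open_nbhs_nbhs.
  near=> x; split; first by near: x.
  near: x; apply: filter_forall => i; apply: filter_forall => j.
  have c1 : {for p, continuous (fun x => 'D_('e_i) e x 0 j)}.
    apply: (Ck_on_continuous (k := 0) (U := U)) => //.
    by apply: Ck_on_coord => //; have [_ De] := se 1%N; exact: De.
  have n0 : 0 < (2 * n%:R)^-1 :> R.
    rewrite invr_gt0 mulr_gt0 // ltr0n; exact: leq_ltn_trans (leq0n j) (ltn_ord j).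
  move/cvgrPdist_le : c1 => /(_ _ n0) c1; near=> x.
  have Ux : U x by near: x.
  rewrite jacobianE; last exact: de.
  rewrite -normrN -sub0r -(Je0 i j) jacobianE; last exact: de.
  by near: x; exact: c1.
have [r /= r0 Hr] := (nbhs_ballP _ _).1 nJ.
have Hr' x : `|x - p| < r -> U x /\ forall i j, `|'J e x i j| <= (2 * n%:R)^-1.
  by move=> xr; apply: Hr; rewrite -ball_normE /= distrC.
have r2 : r / 2 < r by rewrite ltr_pdivrMr // ltr_pMr // ltr1n.
exists (r / 2); split; first by rewrite divr_gt0.
  by move=> x xr; have [] := Hr' x (le_lt_trans xr r2).
move=> x y xr yr.
apply: (@lipschitz_of_partials _ _ e p r); [| |exact: le_lt_trans r2..].
- by move=> z /Hr'[/de].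
- by move=> z /Hr'[].
Unshelve. all: by end_near. Qed.

(** The Lipschitz bound turns the linear approximation of [f] at [h z] into one of [h] at z with the
    inverse matrix. The derivatives of [h] are then rational in those of [f] composed with [h], so
    each order of smoothness of [h] yields the next. *)
Lemma inverse_smooth n (U V : set 'rV[R]_n) (f h : 'rV[R]_n -> 'rV[R]_n) (c : R) :
  open U -> open V -> smooth_on U f -> (forall x, U x -> 'J f x \in unitmx) ->
  (forall z, V z -> U (h z)) -> (forall z, V z -> f (h z) = z) -> 0 < c ->
  (forall z z', V z -> V z' -> `|h z - h z'| <= c * `|z - z'|) ->
  smooth_on V h.
Proof.
move=> oU oV sf uJ hU fh c0 lip.
have df x : U x -> differentiable f x by have [df _] := sf 1%N; exact: df.
have nV z : V z -> \forall k \near (0 : 'rV[R]_n), V (k + z).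
  move=> Vz; have /nbhs0P : \near z, V z by exact: open_nbhs_nbhs.
  by apply: filterS => k; rewrite addrC.
have ch z : V z -> {for z, continuous h}.
  move=> Vz; apply: (cvgrPdist_le (FF := nbhs_filter z) _ _).2 => e e0.
  have nVz : \near z, V z by exact: open_nbhs_nbhs.
  near=> w; apply: le_trans (lip _ _ Vz _) _; first by near: w.
  rewrite -ler_pdivlMl //; near: w.
  by apply: cvgr_dist_le => //; rewrite mulr_gt0 // invr_gt0.
have dh z : V z -> differentiable h z /\
    'd h z = mulmxr (invmx ('J f (h z))) :> ('rV[R]_n -> 'rV[R]_n).
  move=> Vz; set x := h z; have Ux : U x by exact: hU.
  apply: differentiable_is_linear_approx; first exact: mulmxr_continuous.
  move=> e e0 /=; set B := invmx _.
  have [c' c'0 Bc'] := mulmxr_lipschitz B.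
  (* The divisor compensates the norm bound c' of [B] and the Lipschitz constant c of [h]. *)
  have ep0 : 0 < e / (c' * c) by rewrite divr_gt0 // mulr_gt0.
  have [r /= r0 Hr] := (nbhs_ballP _ _).1 (differentiable_approx (df _ Ux) ep0).
  have nr : \forall k \near (0 : 'rV[R]_n), `|k| < c^-1 * r.
    have cr : 0 < c^-1 * r by rewrite mulr_gt0 // invr_gt0.
    apply/nbhs_ballP; exists (c^-1 * r) => // k /=.
    by rewrite -ball_normE /= sub0r normrN.
  near=> k; have Vk : V (k + z) by near: k; exact: nV.
  set D := h (k + z) - h z.
  have Dc : `|D| <= c * `|k| by apply: le_trans (lip _ _ Vk Vz) _; rewrite addrK.
  have Dr : `|D| < r.
    apply: le_lt_trans Dc _; rewrite -ltr_pdivlMl //; near: k.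
    exact: nr.
  have := Hr D; rewrite -ball_normE /= sub0r normrN => /(_ Dr).
  rewrite /D subrK !fh // addrK -/D -(mul_rV_lin1 ('d f x)) -/(jacobian f x) => H.
  have -> : D - k *m B = - ((k - D *m 'J f x) *m B).
    by rewrite mulmxBl mulmxK ?opprB //; exact: uJ.
  rewrite normrN; apply: le_trans (Bc' _) _.
  apply: le_trans (ler_wpM2l (ltW c'0) H) _.
  apply: le_trans (ler_wpM2l (ltW c'0) (ler_wpM2l (ltW ep0) Dc)) _.
  rewrite le_eqVlt; apply/orP; left; apply/eqP; field.
  by rewrite !lt0r_neq0.
move=> k; elim: k => [|k IH]; first exact: ch.
split=> [z Vz|v]; first by have [] := dh z Vz.
apply: (@eq_Ck_on _ _ _ _ _ (fun z => v *m invmx ('J f (h z)))) => //.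
  by move=> z Vz; have [dhz E] := dh z Vz; rewrite deriveE // E.
apply: Ck_on_row => // j.
have Hi i : Ck_on k V (fun z => invmx ('J f (h z)) i j).
  apply: Ck_on_invmx => //; first by move=> z /hU /uJ.
  move=> a b.
  have [_ Df] := sf k.+1.
  apply: eq_Ck_on (Ck_on_comp_row oV oU hU IH (Ck_on_coord b oU (Df 'e_a))) => // z Vz.
  by rewrite jacobianE //; exact/df/hU.
apply: eq_Ck_on (Ck_on_sum (index_enum _) oV
  (fun i => Ck_onM oV (Ck_on_cst k V (v 0 i)) (Hi i))) => // z _.
by rewrite mxE.
Unshelve. all: by end_near. Qed.

Theorem inverse_function n (f : 'rV[R]_n -> 'rV[R]_n) (p : 'rV[R]_n) :
  smooth_at p f -> 'J f p \in unitmx -> local_diffeo p f.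
Proof.
move=> [U [oU Up sf]] uJ.
have [s [s0 sU contr]] := newton_hypothesis oU Up sf uJ.
set B := invmx ('J f p).
have df x : `|x - p| < s -> differentiable f x.
  by move=> /ltW /sU; have [df _] := sf 1%N; exact: df.
have [c c0 Bc] := mulmxr_lipschitz B.
pose U0 : set 'rV[R]_n := [set x | `|x - p| < s].
have nc (q : 'rV[R]_n) : continuous (fun x => `|x - q|).
  move=> x; apply: continuous_comp; last exact: norm_continuous.
  by apply: continuousB => //; exact: cst_continuous.
have oU0 : open U0.
  by apply: (@open_comp _ _ (fun x => `|x - p|) [set t | t < s]); [move=> x _; exact: nc|exact: open_lt].
pose V : set 'rV[R]_n := [set z | `|(z - f p) *m B| < s / 2].
have oV : open V.
  apply: (@open_comp _ _ (fun z => `|(z - f p) *m B|) [set t | t < s / 2]); last exact: open_lt.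
  move=> x _; apply: continuous_comp; last exact: norm_continuous.
  apply: (@continuous_comp _ _ _ (fun z => z - f p) (mulmxr B)); last exact: mulmxr_continuous.
  by apply: continuousB => //; exact: cst_continuous.
(* Along a kernel vector of the Jacobian [f] would vary by o(t), against the expansion estimate. *)
have uJx x : U0 x -> 'J f x \in unitmx.
  move=> Ux; rewrite -row_free_unit; apply: inj_row_free => v vJ.
  have [//|v0] := eqVneq v 0; exfalso.
  have v0' : 0 < `|v| by rewrite normr_gt0.
  (* With the factor 2 of the expansion estimate and the bound c for [B], this error makes the
     increment at most half of itself. *)
  have e0 : 0 < (4 * c)^-1 by rewrite invr_gt0 mulr_gt0.
  have n1 : \forall t \near (0 : R), `|f (t *: v + x) - f x - 'd f x (t *: v)| <= (4 * c)^-1 * `|t *: v|.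
    have c1 : (t *: v @[t --> (0 : R)]) --> (0 : 'rV[R]_n).
      by rewrite -[X in _ --> X](scale0r v); apply: cvgZr_tmp.
    exact: c1 (differentiable_approx (df _ Ux) e0).
  have n2 : \forall t \near (0 : R), U0 (t *: v + x).
    have c1 : (t *: v + x @[t --> (0 : R)]) --> x.
      by rewrite -[X in _ --> X]add0r -[X in _ --> X + _](scale0r v); apply: cvgD; [apply: cvgZr_tmp|exact: cvg_cst].
    by apply: c1; exact: open_nbhs_nbhs.
  have [r /= r0 Hr] := (nbhs_ballP _ _).1 (filterI n1 n2).
  have [] := Hr (r / 2).
    rewrite -ball_normE /= sub0r normrN gtr0_norm ?divr_gt0 //.
    by rewrite ltr_pdivrMr // ltr_pMr // ltr1n.
  rewrite linearZ /= -(mul_rV_lin1 ('d f x)) -/(jacobian f x) vJ scaler0 subr0 => H1 H2.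
  have := newton_expand contr (ltW H2) (ltW Ux); rewrite addrK.
  have := Bc (f ((r / 2) *: v + x) - f x).
  have : 0 < `|(r / 2) *: v| by rewrite normrZ mulr_gt0 // gtr0_norm ?divr_gt0.
  move: H1; set a := `|_ *: v|; set b := `|f _ - f x|; set d := `|_ *m B| => H1 a0 H3 H4.
  have : c * b <= c * ((4 * c)^-1 * a) by rewrite ler_pM2l.
  have -> : c * ((4 * c)^-1 * a) = a / 4 by field; rewrite lt0r_neq0.
  lra.
have solve z : V z -> exists2 x, U0 x & f x = z.
  by move=> Vz; exact: newton_solve contr z Vz uJ.
(* [p] is only the default where no preimage exists; uniqueness of the preimage in [U0] comes from
   the expansion estimate. *)
pose h z := xget p [set x | U0 x /\ f x = z].
have hP z : V z -> U0 (h z) /\ f (h z) = z.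
  by move=> /solve[x Ux fx]; apply: (@xgetPex _ p [set x | U0 x /\ f x = z]); exists x.
exists (U0 `&` f @^-1` V), V; split; last first.
  by split; rewrite /U0 /V /= ?subrr ?mul0mx ?normr0 // divr_gt0.
split => //.
- rewrite -[_ `&` _]/([set x | U0 x /\ (f @^-1` V) x]).
  rewrite openE => x [Ux Vx]; rewrite /interior /=.
  have n1 : \near x, U0 x by exact: open_nbhs_nbhs.
  have n2 : \near x, (f @^-1` V) x.
    have := differentiable_continuous (df x Ux); apply.
    exact: open_nbhs_nbhs.
  exact: filterI n1 n2.
- by move=> k; apply: sub_Ck_on (sf k) => x [/ltW /sU].
- exists h; split.
  + apply: (@inverse_smooth _ U0 V f h (2 * c)) => //.
    * by move=> k; apply: sub_Ck_on (sf k) => x /ltW /sU.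
    * by move=> z /hP[].
    * by move=> z /hP[].
    * by rewrite mulr_gt0.
    * move=> z z' /hP[Uz fz] /hP[Uz' fz'].
      apply: le_trans (newton_expand contr (ltW Uz) (ltW Uz')) _.
      by rewrite fz fz' -mulrA ler_pM2l.
  + by move=> x [].
  + by move=> z Vz; have [Uz fz] := hP z Vz; split => //; rewrite /preimage /= fz.
  + move=> x [Ux Vx]; have [Uz fz] := hP _ Vx.
    have := newton_expand contr (ltW Uz) (ltW Ux).
    rewrite fz subrr mul0mx normr0 mulr0 normr_le0 subr_eq0 => /eqP //.
  + by move=> z /hP[].
Qed.

End LocalDiffeo.

(** * Germs of smooth maps and of local diffeomorphisms *)

Section Germs.
Context {R : realType}.
Implicit Types (V W : normedModType R) (k n : nat).

Lemma Ck_on_local V W k (U : set V) (f : V -> W) :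
  (forall x, U x -> exists2 Q, Q x & Ck_on k Q f) -> Ck_on k U f.
Proof.
elim: k f => [|k IH] f H; first by move=> x /H[Q Qx]; apply.
split=> [x /H[Q Qx [df _]]|v]; first exact: df.
by apply: IH => x /H[Q Qx [_ Df]]; exists Q => //; exact: Df.
Qed.

Lemma smooth_on_at V W (U : set V) (f : V -> W) :
  (forall x, U x -> smooth_at x f) -> smooth_on U f.
Proof. by move=> H k; apply: Ck_on_local => x /H[Q [_ Qx sf]]; exists Q. Qed.

Lemma smooth_at_on V W (U : set V) (f : V -> W) (x : V) :
  open U -> U x -> smooth_on U f -> smooth_at x f.
Proof. by move=> oU Ux sf; exists U. Qed.

Lemma smooth_at_differentiable V W (x : V) (f : V -> W) :
  smooth_at x f -> differentiable f x.
Proof. by move=> [U [oU Ux /(_ 1%N)[df _]]]; exact: df. Qed.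

Lemma smooth_at_continuous V W (x : V) (f : V -> W) :
  smooth_at x f -> {for x, continuous f}.
Proof. by move=> /smooth_at_differentiable; exact: differentiable_continuous. Qed.

Lemma near_open V (x : V) (P : set V) :
  (\near x, P x) -> exists U, [/\ open U, U x & U `<=` P].
Proof. move=> xP; have : nbhs x P by exact: xP.
by rewrite nbhsE => -[U [oU Ux] UP]; exists U. Qed.

Lemma continuous_near V W (x : V) (f : V -> W) (A : set W) :
  {for x, continuous f} -> open A -> A (f x) -> \forall y \near x, A (f y).
Proof. by move=> cf oA Afx; apply: (cf A); exact: open_nbhs_nbhs. Qed.

Lemma smooth_at_cst V W (x : V) (w : W) : smooth_at x (fun=> w).
Proof. by exists setT; split=> // [|k]; [exact: openT|exact: Ck_on_cst]. Qed.

Lemma smooth_at_linear V W (x : V) (L : {linear V -> W}) : continuous L -> smooth_at x L.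
Proof. by move=> cL; exists setT; split=> // [|k]; [exact: openT|exact: Ck_on_linear]. Qed.

Lemma smooth_at_id V (x : V) : smooth_at x (fun y : V => y).
Proof. by apply: (@smooth_at_linear _ _ _ idfun) => y; exact: id. Qed.

Lemma smooth_at_coord V n (x : V) (f : V -> 'rV[R]_n) j :
  smooth_at x f -> smooth_at x (fun y => f y 0 j).
Proof. by move=> [U [oU Ux sf]]; exists U; split=> // k; exact: Ck_on_coord. Qed.

Lemma smooth_atD V (x : V) (f g : V -> R) :
  smooth_at x f -> smooth_at x g -> smooth_at x (fun y => f y + g y).
Proof.
move=> [U [oU Ux sf]] [Q [oO Qx sg]].
exists (U `&` Q); split=> //; first exact: openI.
by move=> k; apply: Ck_onD; [exact: openI|apply: sub_Ck_on (sf k)|apply: sub_Ck_on (sg k)] => y [].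
Qed.

Lemma smooth_atM V (x : V) (f g : V -> R) :
  smooth_at x f -> smooth_at x g -> smooth_at x (fun y => f y * g y).
Proof.
move=> [U [oU Ux sf]] [Q [oO Qx sg]].
exists (U `&` Q); split=> //; first exact: openI.
by move=> k; apply: Ck_onM; [exact: openI|apply: sub_Ck_on (sf k)|apply: sub_Ck_on (sg k)] => y [].
Qed.

Lemma smooth_atN V (x : V) (f : V -> R) : smooth_at x f -> smooth_at x (fun y => - f y).
Proof. by move=> [U [oU Ux sf]]; exists U; split=> // k; exact: Ck_onN. Qed.

Lemma smooth_atX V (x : V) (f : V -> R) m : smooth_at x f -> smooth_at x (fun y => f y ^+ m).
Proof.
move=> sf; elim: m => [|m IH]; first exact: smooth_at_cst.
rewrite (_ : (fun y => _) = (fun y => f y * f y ^+ m)); first exact: smooth_atM.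
by apply/funext => y; rewrite exprS.
Qed.

Lemma smooth_atV V (x : V) (f : V -> R) : smooth_at x f -> f x != 0 ->
  smooth_at x (fun y => (f y)^-1).
Proof.
move=> sf fx; have /near_open[Q [oO Qx fO]] : \near x, f x != 0.
  exact: continuous_near (smooth_at_continuous sf) (@open_neq _ 0) fx.
have [U [oU Ux {}sf]] := sf; exists (U `&` Q); split=> //; first exact: openI.
move=> k; apply: Ck_onV; [exact: openI|by move=> y [_ /fO]|].
by apply: sub_Ck_on (sf k) => y [].
Qed.

Lemma smooth_at_sqrt V (x : V) (f : V -> R) : smooth_at x f -> 0 < f x ->
  smooth_at x (fun y => Num.sqrt (f y)).
Proof.
move=> sf fx; have /near_open[Q [oO Qx fO]] : \near x, 0 < f x.
  exact: continuous_near (smooth_at_continuous sf) (@open_gt _ 0) fx.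
have [U [oU Ux {}sf]] := sf; exists (U `&` Q); split=> //; first exact: openI.
move=> k; apply: Ck_on_sqrt; [exact: openI|by move=> y [_ /fO]|].
by apply: sub_Ck_on (sf k) => y [].
Qed.

Lemma smooth_at_sin V (x : V) (f : V -> R) : smooth_at x f -> smooth_at x (fun y => sin (f y)).
Proof. by move=> [U [oU Ux sf]]; exists U; split=> // k; apply: (Ck_on_sin_cos oU (sf k)).1. Qed.

Lemma smooth_at_cos V (x : V) (f : V -> R) : smooth_at x f -> smooth_at x (fun y => cos (f y)).
Proof. by move=> [U [oU Ux sf]]; exists U; split=> // k; apply: (Ck_on_sin_cos oU (sf k)).2. Qed.

Lemma smooth_at_row V n (x : V) (f : V -> 'rV[R]_n) :
  (forall j, smooth_at x (fun y => f y 0 j)) -> smooth_at x f.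
Proof.
move=> H; have /choice[U HU] : forall j, exists U : set V,
    [/\ open U, U x & smooth_on U (fun y => f y 0 j)] by [].
have /near_open[Q [oO Qx OU]] : \near x, forall j, U j x.
  by apply: filter_forall => j; have [oU Ux _] := HU j; exact: open_nbhs_nbhs.
exists Q; split=> // k; apply: Ck_on_row => // j.
by have [_ _ sf] := HU j; apply: sub_Ck_on (sf k) => y /OU.
Qed.

Lemma smooth_at_comp V n m (x : V) (g : V -> 'rV[R]_n) (f : 'rV[R]_n -> 'rV[R]_m) :
  smooth_at x g -> smooth_at (g x) f -> smooth_at x (fun y => f (g y)).
Proof.
move=> sg [Q [oO Ogx sf]].
have /near_open[T [oT Tx gT]] : \near x, Q (g x).
  exact: continuous_near (smooth_at_continuous sg) oO _.
have [U [oU Ux {}sg]] := sg; exists (U `&` T); split=> //; first exact: openI.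
move=> k; apply: Ck_on_row => [|j]; first exact: openI.
apply: (@Ck_on_comp_row _ _ _ _ _ Q (fun z => f z 0 j)) => //; first exact: openI.
- by move=> y [_ /gT].
- by apply: sub_Ck_on (sg k) => y [].
- exact: Ck_on_coord.
Qed.

Lemma diffeo_on_restrict V W (U : set V) (U' : set W) (f : V -> W) (Q : set V) :
  diffeo_on U U' f -> open Q -> exists Q', diffeo_on (U `&` Q) Q' f.
Proof.
move=> [oU oU' sf [h [sh fU hU hf fh]]] oO.
exists (U' `&` h @^-1` Q); split; first exact: openI.
- rewrite openE => y [Uy Oy]; apply: filterI; first exact: open_nbhs_nbhs.
  have ch : {for y, continuous h} by apply: (Ck_on_continuous (sh 0%N)).
  by apply: ch; exact: open_nbhs_nbhs.
- by move=> k; apply: sub_Ck_on (sf k) => y [].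
exists h; split.
- by move=> k; apply: sub_Ck_on (sh k) => y [].
- by move=> x [Ux Qx]; split; [exact: fU|rewrite /preimage /= hf].
- by move=> y [Uy Oy]; split => //; exact: hU.
- by move=> x [Ux _]; exact: hf.
- by move=> y [Uy _]; exact: fh.
Qed.

Lemma local_diffeo_smooth V W (p : V) (f : V -> W) : local_diffeo p f -> smooth_at p f.
Proof. by move=> [U [U' [[oU _ sf _] Up]]]; exists U. Qed.

Lemma diffeo_on_inv V W (U : set V) (U' : set W) (f : V -> W) : diffeo_on U U' f ->
  exists h, [/\ diffeo_on U' U h, forall x, U x -> U' (f x),
    forall x, U x -> h (f x) = x & forall y, U' y -> f (h y) = y].
Proof.
move=> [oU oU' sf [h [sh fU hU hf fh]]]; exists h; split=> //.
by split=> //; exists f.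
Qed.

Lemma local_diffeo_inv V W (p : V) (f : V -> W) : local_diffeo p f ->
  exists h, [/\ local_diffeo (f p) h, h (f p) = p,
    \forall x \near p, h (f x) = x & \forall y \near f p, f (h y) = y].
Proof.
move=> [U [U' [/[dup] df /diffeo_on_inv[h [dh fU hf fh]] Up]]]; exists h; split.
- by exists U', U; split => //; exact: fU.
- exact: hf.
- by have [oU _ _ _] := df; apply: filterS (open_nbhs_nbhs (conj oU Up)) => x /hf.
- have [oU' _ _ _] := dh.
  by apply: filterS (open_nbhs_nbhs (conj oU' (fU _ Up))) => x /fh.
Qed.

Lemma diffeo_on_near_eq V W (U : set V) (U' : set W) (f g : V -> W) :
  (forall x, U x -> f x = g x) -> diffeo_on U U' f -> diffeo_on U U' g.
Proof.
move=> fg [oU oU' sf [h [sh fU hU hf fh]]]; split=> //.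
  by move=> k; apply: eq_Ck_on (sf k).
exists h; split=> //.
- by move=> x Ux; rewrite -fg //; exact: fU.
- by move=> x Ux; rewrite -fg //; exact: hf.
- by move=> y Uy; rewrite -fg ?fh //; exact: hU.
Qed.

Lemma local_diffeo_near_eq V W (p : V) (f g : V -> W) :
  {near p, f =1 g} -> local_diffeo p f -> local_diffeo p g.
Proof.
move=> /near_open[Q [oO Op fg]] [U [U' [df Up]]].
have [Q' dO] := diffeo_on_restrict df oO.
exists (U `&` Q), Q'; split=> //.
by apply: diffeo_on_near_eq dO => x [_ /fg].
Qed.

Lemma local_diffeo_comp n (p : 'rV[R]_n) (f g : 'rV[R]_n -> 'rV[R]_n) :
  local_diffeo p f -> local_diffeo (f p) g -> local_diffeo p (fun x => g (f x)).
Proof.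
move=> [U [U' [df Up]]] [W [W' [dg Wfp]]].
have /near_open[Q [oO Op fO]] : \near p, W (f p).
  have cf : {for p, continuous f} by apply: smooth_at_continuous; apply: local_diffeo_smooth; exists U, U'.
  by have [oW _ _ _] := dg; exact: continuous_near cf oW _.
have [T [oU oT sf [h [sh fU hU hf fh]]]] := diffeo_on_restrict df oO.
have [W2 [oW oW2 sg [h' [sh' gW hW hg gh]]]] := diffeo_on_restrict dg oT.
exists (U `&` Q), W2; split=> //.
have fW x : (U `&` Q) x -> (W `&` T) (f x).
  by move=> UOx; split; [apply: fO; case: UOx|exact: fU].
split=> //.
  apply: smooth_on_at => x UOx; apply: smooth_at_comp; first by exists (U `&` Q).
  by exists (W `&` T); split=> //; exact: fW.
exists (fun y => h (h' y)); split.
- apply: smooth_on_at => y W2y; apply: smooth_at_comp; first by exists W2.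
  by exists T; split=> //; have [] := hW _ W2y.
- by move=> x UOx; apply/gW/fW.
- by move=> y /hW[_ /hU].
- by move=> x UOx; rewrite hg ?hf //; exact: fW.
- by move=> y W2y; have [Wy Ty] := hW _ W2y; rewrite fh ?gh.
Qed.

(** Jacobians of the explicit coordinate changes below are read off from algebraic factorizations of
    increments; [c] is the difference quotient, extended continuously to 0. *)
Lemma derive_axis V (f : V -> R) (p v : V) (c : R -> R) : {for 0, continuous c} ->
  (\forall s \near (0 : R), f (s *: v + p) = f p + s * c s) -> 'D_v f p = c 0.
Proof.
move=> cc H; apply/cvg_lim => //.
have cc' : c s @[s --> 0^'] --> c 0 by apply: cvg_trans cc; apply: cvg_app; exact: cvg_within.
apply: cvg_trans cc'; apply: near_eq_cvg; near=> s.
rewrite /= (_ : f (s *: v + p) = f p + s * c s); last first.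
  by near: s; exact: cvg_within H.
rewrite [f p + _]addrC addrK /GRing.scale /= mulKf //.
by near: s; exact: nbhs_dnbhs_neq.
Unshelve. all: by end_near. Qed.

Lemma jacobian_unit_trig n (f : 'rV[R]_n -> 'rV[R]_n) (p : 'rV[R]_n) :
  differentiable f p ->
  (forall i j : 'I_n, (i < j)%N -> 'D_('e_i) (fun x => f x 0 j) p = 0) ->
  (forall i, 'D_('e_i) (fun x => f x 0 i) p != 0) -> 'J f p \in unitmx.
Proof.
move=> df H0 H1.
have E i j : 'J f p i j = 'D_('e_i) (fun x => f x 0 j) p.
  by rewrite jacobianE // derive_mx ?mxE //; exact: diff_derivable.
rewrite unitmxE det_trig; last first.
  by apply/is_trig_mxP => i j ij; rewrite E H0.
by rewrite unitfE; apply/prodf_neq0 => i _; rewrite E.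
Qed.

(** [E] and [Phi] start from a common parameter space, [P] and [Psi] from a common plane. The
    coordinate changes of the definition are [E] after the inverse of [Phi] and [Psi] after the
    inverse of [P], so explicit formulas are asked for in one direction only. *)
Lemma locally_given_by_param (m g : 'rV[R]_3 -> 'rV[R]_2) (E Phi : 'rV[R]_3 -> 'rV[R]_3)
    (e : 'rV[R]_3 -> 'rV[R]_2) (P Psi : 'rV[R]_2 -> 'rV[R]_2) :
  local_diffeo 0 E -> local_diffeo 0 Phi -> Phi 0 = 0 ->
  local_diffeo 0 P -> local_diffeo 0 Psi -> Psi 0 = 0 ->
  {for 0, continuous e} -> e 0 = 0 ->
  (\forall q \near (0 : 'rV[R]_3), g (E q) = P (e q)) ->
  (\forall q \near (0 : 'rV[R]_3), Psi (e q) = m (Phi q)) ->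
  locally_given_by m g (E 0).
Proof.
move=> dE dPhi Phi0 dP dPsi Psi0 ce e0 gE PsiE.
have [Phi' []] := local_diffeo_inv dPhi; rewrite Phi0 => dPhi' Phi'0 _ PhiK.
have [P' [dP' P'0 PK _]] := local_diffeo_inv dP.
have g0 : g (E 0) = P 0 by rewrite (nbhs_singleton gE) e0.
have dphi : local_diffeo 0 (fun q => E (Phi' q)).
  by apply: local_diffeo_comp => //; rewrite Phi'0.
have dpsi : local_diffeo (P 0) (fun y => Psi (P' y)).
  by apply: local_diffeo_comp => //; rewrite P'0.
have [V [V' [dV VP]]] := dpsi.
have cPhi' : {for 0, continuous Phi'} by apply/smooth_at_continuous/local_diffeo_smooth.
have /near_open[Q [oO O0 HO]] : \forall u \near (0 : 'rV[R]_3),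
    V (g (E (Phi' u))) /\ Psi (P' (g (E (Phi' u)))) = m u.
  have Hq : \forall q \near (0 : 'rV[R]_3), V (g (E q)) /\ Psi (P' (g (E q))) = m (Phi q).
    have ceP : {for 0, continuous (fun q => P (e q))}.
      apply: continuous_comp => //; rewrite e0.
      exact/smooth_at_continuous/local_diffeo_smooth.
    have nV : \forall q \near (0 : 'rV[R]_3), V (P (e q)).
      by have [oV _ _ _] := dV; apply: continuous_near ceP oV _; rewrite e0.
    have nP : \forall q \near (0 : 'rV[R]_3), P' (P (e q)) = e q.
      by apply: (ce [set z | P' (P z) = z]); rewrite e0.
    near=> q.
    have -> : g (E q) = P (e q) by near: q.
    split; first by near: q.
    have -> : P' (P (e q)) = e q by near: q.
    by near: q.
  have H1 : \forall u \near (0 : 'rV[R]_3),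
      V (g (E (Phi' u))) /\ Psi (P' (g (E (Phi' u)))) = m (Phi (Phi' u)).
    by apply: (cPhi' [set q | V (g (E q)) /\ Psi (P' (g (E q))) = m (Phi q)]); rewrite Phi'0.
  near=> u; have [H2 H3] : V (g (E (Phi' u))) /\ Psi (P' (g (E (Phi' u)))) = m (Phi (Phi' u)).
    by near: u.
  split=> //; rewrite H3; congr (m _); near: u; exact: PhiK.
have [U [U' [dU U0]]] := dphi.
have [Q' dO] := diffeo_on_restrict dU oO.
exists (U `&` Q), Q', V, V', (fun q => E (Phi' q)), (fun y => Psi (P' y)); split=> //.
- by rewrite Phi'0.
- by rewrite g0 P'0.
- by move=> u [_ /HO].
Unshelve. all: by end_near. Qed.

End Germs.

Ltac smooth_step :=
  first [ assumption | lazymatch goal with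
  | |- smooth_at _ (fun _ => ?c) => apply: smooth_at_cst
  | |- smooth_at _ (fun x => @GRing.add _ (@?f x) (@?g x)) => apply: (@smooth_atD _ _ _ f g)
  | |- smooth_at _ (fun x => @GRing.opp _ (@?f x)) => apply: (@smooth_atN _ _ _ f)
  | |- smooth_at _ (fun x => @GRing.mul _ (@?f x) (@?g x)) => apply: (@smooth_atM _ _ _ f g)
  | |- smooth_at _ (fun x => @GRing.exp _ (@?f x) ?n) => apply: (@smooth_atX _ _ _ f n)
  | |- smooth_at _ (fun x => @GRing.inv _ (@?f x)) => apply: (@smooth_atV _ _ _ f)
  | |- smooth_at _ (fun x => Num.sqrt (@?f x)) => apply: (@smooth_at_sqrt _ _ _ f)
  | |- smooth_at _ (fun x => sin (@?f x)) => apply: (@smooth_at_sin _ _ _ f)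
  | |- smooth_at _ (fun x => cos (@?f x)) => apply: (@smooth_at_cos _ _ _ f)
  | |- smooth_at _ (fun x => fun_of_matrix x 0 ?i) => exact: (smooth_at_coord i (smooth_at_id _))
  | |- smooth_at _ (fun x => x) => exact: smooth_at_id
  end ].
Ltac smooth := repeat smooth_step.

(** * Coordinates in dimensions 2 and 3, embedded circles *)

Section Space.
Context {R : realType}.
Implicit Types (V W : normedModType R).

Definition row3 (a b c : R) : 'rV[R]_3 :=
  \row_(j < 3) (if j == 0 then a else if j == 1 then b else c).

Lemma row3_0 a b c : row3 a b c 0 0 = a. Proof. by rewrite mxE. Qed.
Lemma row3_1 a b c : row3 a b c 0 1 = b. Proof. by rewrite mxE. Qed.
Lemma row3_2 a b c : row3 a b c 0 2%R = c. Proof. by rewrite mxE. Qed.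
Definition row3E := (row3_0, row3_1, row3_2).

Lemma row2_0 (a b : R) : row2 a b 0 0 = a. Proof. by rewrite mxE. Qed.
Lemma row2_1 (a b : R) : row2 a b 0 1 = b. Proof. by rewrite mxE. Qed.
Definition row2E := (row2_0, row2_1).

Lemma ord3P (P : 'I_3 -> Prop) : P 0 -> P 1 -> P 2%R -> forall j, P j.
Proof.
by move=> P0 P1 P2 [[|[|[|//]]] H]; [move: P0|move: P1|move: P2];
  congr (P _); apply: val_inj.
Qed.

Lemma ord2P (P : 'I_2 -> Prop) : P 0 -> P 1 -> forall j, P j.
Proof.
by move=> P0 P1 [[|[|//]] H]; [move: P0|move: P1]; congr (P _); apply: val_inj.
Qed.

Lemma sum_ord3 (F : 'I_3 -> R) : \sum_j F j = F 0 + F 1 + F 2%R.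
Proof.
rewrite !big_ord_recl big_ord0 addr0 addrA.
by congr (F _ + F _ + F _); apply: val_inj.
Qed.

Lemma sum_ord2 (F : 'I_2 -> R) : \sum_j F j = F 0 + F 1.
Proof. by rewrite !big_ord_recl big_ord0 addr0; congr (F _ + F _); apply: val_inj. Qed.

Lemma row3_eta (x : 'rV[R]_3) : x = row3 (x 0 0) (x 0 1) (x 0 2%R).
Proof. by apply/rowP; apply: ord3P; rewrite row3E. Qed.

Lemma eq_row3 (x y : 'rV[R]_3) :
  x 0 0 = y 0 0 -> x 0 1 = y 0 1 -> x 0 2%R = y 0 2%R -> x = y.
Proof. by move=> *; apply/rowP; apply: ord3P. Qed.

Lemma eq_row2 (x y : 'rV[R]_2) : x 0 0 = y 0 0 -> x 0 1 = y 0 1 -> x = y.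
Proof. by move=> *; apply/rowP; apply: ord2P. Qed.

Lemma smooth_at_row3 V (p : V) (f g h : V -> R) : smooth_at p f -> smooth_at p g ->
  smooth_at p h -> smooth_at p (fun x => row3 (f x) (g x) (h x)).
Proof.
move=> sf sg sh; apply: smooth_at_row; apply: ord3P.
- by under eq_fun do rewrite row3E.
- by under eq_fun do rewrite row3E.
- by under eq_fun do rewrite row3E.
Qed.

Lemma smooth_at_row2 V (p : V) (f g : V -> R) : smooth_at p f -> smooth_at p g ->
  smooth_at p (fun x => row2 (f x) (g x)).
Proof.
move=> sf sg; apply: smooth_at_row; apply: ord2P.
- by under eq_fun do rewrite row2E.
- by under eq_fun do rewrite row2E.
Qed.

Lemma smooth_at_fst V W (p : V * W) : smooth_at p (fst : V * W -> V).
Proof. by apply: smooth_at_linear => x; exact: cvg_fst. Qed.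

Lemma smooth_at_snd V W (p : V * W) : smooth_at p (snd : V * W -> W).
Proof. by apply: smooth_at_linear => x; exact: cvg_snd. Qed.

Lemma unit_circle_param (a b : R) : a ^+ 2 + b ^+ 2 = 1 ->
  exists2 t : R, 0 <= t < 1 & cos (2 * pi * t) = a /\ sin (2 * pi * t) = b.
Proof.
move=> ab1; have pi0 : 0 < pi :> R by exact: pi_gt0.
have a1 : -1 <= a <= 1 by have := sqr_ge0 b; nra.
have [b0|b0] := leP 0 b.
- exists (acos a / (2 * pi)).
    have := acos_ge0 a1; have := acos_lepi a1 => H1 H2.
    rewrite divr_ge0 ?mulr_ge0 ?pi_ge0 //= ltr_pdivrMr ?mulr_gt0 // mul1r; lra.
  rewrite mulrC divfK ?mulf_neq0 ?gt_eqF // acosK ?in_itv //; split => //.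
  by rewrite sin_acos // -ab1 addrC addKr sqrtr_sqr ger0_norm.
- have a1' : -1 <= a < 1.
    by move: a1 => /andP[-> a1] /=; rewrite lt_neqAle a1 andbT; apply/eqP => aE; move: ab1; rewrite aE; nra.
  exists ((2 * pi - acos a) / (2 * pi)).
    have := acos_gt0 a1'; have := acos_lepi a1 => H1 H2.
    rewrite divr_ge0 ?mulr_ge0 ?pi_ge0 //=; last lra.
    rewrite ltr_pdivrMr ?mulr_gt0 // mul1r; lra.
  rewrite mulrC divfK ?mulf_neq0 ?gt_eqF //.
  have -> : 2 * pi - acos a = - acos a + pi *+ 2 by rewrite mulr2n; ring.
  rewrite cosD2pi sinD2pi cosN sinN acosK ?in_itv //; split => //.
  by rewrite sin_acos // -ab1 addrC addKr sqrtr_sqr ltr0_norm // opprK.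
Qed.

(** Half the difference of the angles has absolute value below pi; the cosine of its double is 1, so
    its sine vanishes. *)
Lemma unit_circle_inj (s t : R) : 0 <= s < 1 -> 0 <= t < 1 ->
  cos (2 * pi * s) = cos (2 * pi * t) -> sin (2 * pi * s) = sin (2 * pi * t) -> s = t.
Proof.
move=> s01 t01 cE sE; have pi0 : 0 < pi :> R by exact: pi_gt0.
pose d := pi * (s - t).
have dE : 2 * pi * s - 2 * pi * t = d + d by rewrite /d; ring.
have c1 : cos (d + d) = 1.
  by rewrite -dE cosB cE sE -!expr2 cos2Dsin2.
have s0 : sin d = 0.
  move: c1; rewrite cosD; have := cos2Dsin2 d => H1 H2.
  by apply/eqP; rewrite -(@sqrf_eq0 R); apply/eqP; move: H1 H2; rewrite !expr2; lra.
move: s01 t01 => /andP[s0' s1] /andP[t0' t1].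
have pos (x : R) : 0 < x < 1 -> 0 < sin (pi * x).
  by move=> /andP[x0 x1]; apply: sin_gt0_pi; rewrite (mulr_gt0 pi0 x0) /= gtr_pMr.
have [st|ts|//] := ltgtP s t; exfalso.
  have : 0 < sin (pi * (t - s)) by apply: pos; apply/andP; split; lra.
  by rewrite -opprB mulrN sinN -/d s0 oppr0 ltxx.
have : 0 < sin (pi * (s - t)) by apply: pos; apply/andP; split; lra.
by rewrite -/d s0 ltxx.
Qed.

Definition circle_loop (t : R^o) : 'rV[R]_3 := row3 (cos (2 * pi * t)) (sin (2 * pi * t)) 0.

Lemma circle_loop_smooth t : smooth_at t circle_loop.
Proof. by apply: smooth_at_row3; smooth. Qed.

Lemma round_circleP x : round_circle x <-> exists2 t, 0 <= t < 1 & circle_loop t = x.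
Proof.
split=> [[/unit_circle_param[t t01 [ct st]] x2]|[t _ <-]].
  by exists t => //; rewrite [RHS]row3_eta x2 /circle_loop ct st.
by split; rewrite !row3E // cos2Dsin2.
Qed.

Lemma circle_loop_derive t : 'D_1 circle_loop t != 0.
Proof.
have dc := smooth_at_differentiable (circle_loop_smooth t).
have dl : differentiable (fun t : R => 2 * pi * t) t by apply: differentiableM.
have Dl : 'D_1 (fun t : R => 2 * pi * t) t = 2 * pi.
  apply: (@derive_axis _ _ (fun t : R => 2 * pi * t) t 1 (fun=> 2 * pi)); first exact: cst_continuous.
  by near=> s; rewrite /GRing.scale /=; ring.
have pi0 : 2 * pi != 0 :> R by rewrite mulf_neq0 // gt_eqF // pi_gt0.
apply/eqP => D0.
have E j : 'D_1 (fun t => circle_loop t 0 j) t = 0.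
  have := derive_mx (@diff_derivable _ _ _ circle_loop t (1 : R^o) dc).
  by rewrite D0 => /(congr1 (fun M : 'rV[R]_3 => M 0 j)); rewrite !mxE => <-.
have := E 0; have := E 1.
have -> : (fun t => circle_loop t 0 0) = (fun t => cos (2 * pi * t)).
  by apply/funext => u; rewrite row3E.
have -> : (fun t => circle_loop t 0 1) = (fun t => sin (2 * pi * t)).
  by apply/funext => u; rewrite row3E.
have [_ ->] := @is_derive_comp1 R R^o sin (fun t => 2 * pi * t) t 1 _ (is_derive_sin (2 * pi * t)) dl.
have [_ ->] := @is_derive_comp1 R R^o cos (fun t => 2 * pi * t) t 1 _ (is_derive_cos (2 * pi * t)) dl.
rewrite Dl mulrN => /eqP; rewrite mulf_eq0 (negPf pi0) /= => /eqP c0.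
move=> /eqP; rewrite oppr_eq0 mulf_eq0 (negPf pi0) /= => /eqP s0.
have := cos2Dsin2 (2 * pi * t); rewrite c0 s0 expr0n addr0 => /eqP.
by rewrite eq_sym oner_eq0.
Unshelve. all: by end_near. Qed.

Lemma round_circle_embedded : embedded_circle (@round_circle R).
Proof.
exists circle_loop; split.
- by apply: smooth_on_at => t _; exact: circle_loop_smooth.
- move=> t; rewrite /circle_loop mulrDr mulr1 (_ : 2 * pi = pi *+ 2); last by rewrite mulr_natl.
  by rewrite cosD2pi sinD2pi.
- move=> s t s01 t01 E; apply: unit_circle_inj => //.
    by have := congr1 (fun M : 'rV[R]_3 => M 0 0) E; rewrite !row3E.
  by have := congr1 (fun M : 'rV[R]_3 => M 0 1) E; rewrite !row3E.
- exact: circle_loop_derive.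
- apply/seteqP; split=> x.
    by move=> /round_circleP[t _ <-]; exists t.
  by move=> [t _ <-]; split; rewrite !row3E // cos2Dsin2.
Qed.

Lemma embedded_circle_image (K : set 'rV[R]_3) (f : 'rV[R]_3 -> 'rV[R]_3) :
  diffeo_on setT setT f -> embedded_circle K -> embedded_circle (f @` K).
Proof.
move=> df [c [sc cp ci cD ->]]; have [_ _ sf [h [sh _ _ hf _]]] := df.
have sfc t : smooth_at t (fun t => f (c t)).
  by apply: smooth_at_comp; [apply: smooth_at_on sc => //; exact: openT|apply: smooth_at_on sf => //; exact: openT].
exists (fun t => f (c t)); split.
- by apply: smooth_on_at => t _; exact: sfc.
- by move=> t; rewrite cp.
- by move=> s t s01 t01 /(congr1 h); rewrite !hf //; exact: ci.
- move=> t; apply/eqP => D0; have := cD t; apply/negP; rewrite negbK; apply/eqP.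
  have dfc := smooth_at_differentiable (sfc t).
  have dh : differentiable h (f (c t)).
    by apply: smooth_at_differentiable; apply: smooth_at_on sh => //; exact: openT.
  have cE : c = h \o (fun t => f (c t)) by apply/funext => u /=; rewrite hf.
  rewrite cE deriveE; last exact: differentiable_comp.
  by rewrite diff_comp //= -[X in 'd h _ X]deriveE // D0 linear0.
- apply/seteqP; split=> x; first by move=> [_ [t _ <-] <-]; exists t.
  by move=> [t _ <-]; exists (c t) => //; exists t.
Qed.

End Space.

(** * The map and its singular set *)

Section HopfMap.
Context {R : realType}.
Implicit Types (x v : 'rV[R]_3) (a b c d : R).

(* With U = a + ib and V = c + id: qre + i qim = U^2 - V^2, clif = Re (U conj V), and weight is a positive
   perturbation of the constant 100 that breaks the symmetries of U^2 - V^2. *)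
Definition qre a b c d : R := a ^+ 2 - b ^+ 2 - c ^+ 2 + d ^+ 2.
Definition qim a b c d : R := 2 * (a * b - c * d).
Definition clif a b c d : R := a * c + b * d.
Definition weight a b c d : R :=
  100 + 7 * (d - clif a b c d * b) + 3 * (a * d - b * c).

(** The differential of [weight] at (a, b, c, d) on the vector (p, q, r, s); [dre] and [dim] are
    those of the real and imaginary parts of g. *)
Definition dweight a b c d (p q r s : R) : R :=
  7 * (s - (a * r + c * p + b * s + d * q) * b - clif a b c d * q)
  + 3 * (a * s + d * p - b * r - c * q).
Definition dre a b c d (p q r s : R) : R :=
  2 * (a * p - b * q - c * r + d * s) * weight a b c d + qre a b c d * dweight a b c d p q r s.
Definition dim a b c d (p q r s : R) : R :=
  2 * (a * q + b * p - c * s - d * r) * weight a b c d + qim a b c d * dweight a b c d p q r s.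

Lemma is_derive_sphere_map (V : normedModType R) (A B C D : V -> R) (x v : V) (p q r s : R) :
  is_derive x v A p -> is_derive x v B q -> is_derive x v C r -> is_derive x v D s ->
  is_derive x v (fun y => qre (A y) (B y) (C y) (D y) * weight (A y) (B y) (C y) (D y))
    (dre (A x) (B x) (C x) (D x) p q r s) /\
  is_derive x v (fun y => qim (A y) (B y) (C y) (D y) * weight (A y) (B y) (C y) (D y))
    (dim (A x) (B x) (C x) (D x) p q r s).
Proof.
move=> HA HB HC HD; rewrite /qre /qim /weight /clif; split.
  by apply: is_derive_eq; rewrite /dre /qre /weight /dweight /clif /GRing.scale /=; ring.
by apply: is_derive_eq; rewrite /dim /qim /weight /dweight /clif /GRing.scale /=; ring.
Qed.

Lemma sphere_bounds a b c d : a ^+ 2 + b ^+ 2 + c ^+ 2 + d ^+ 2 = 1 ->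
  [/\ -1 <= d <= 1, -1 <= clif a b c d * b <= 1 & -1 <= a * d - b * c <= 1].
Proof.
move=> E.
have a2 := sqr_ge0 a; have b2 := sqr_ge0 b; have c2 := sqr_ge0 c; have d2 := sqr_ge0 d.
have b1 : -1 <= b <= 1 by nra.
have h1 : -1 <= clif a b c d <= 1.
  have := sqr_ge0 (a - c); have := sqr_ge0 (a + c).
  have := sqr_ge0 (b - d); have := sqr_ge0 (b + d).
  by rewrite /clif; nra.
split; first nra.
  by nra.
have := sqr_ge0 (a - d); have := sqr_ge0 (a + d).
have := sqr_ge0 (b - c); have := sqr_ge0 (b + c).
by nra.
Qed.

Lemma weight_gt0 a b c d : a ^+ 2 + b ^+ 2 + c ^+ 2 + d ^+ 2 = 1 -> 0 < weight a b c d.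
Proof. by move=> /sphere_bounds[/andP[? ?] /andP[? ?] /andP[? ?]]; rewrite /weight; lra. Qed.

(** Along minus the gradient of [clif] on the sphere, the derivative of log |g| is [clif] times this
    bracket divided by the weight. Positivity thus forces critical points of |g| onto the torus. *)
Lemma dbracket_gt0 a b c d : a ^+ 2 + b ^+ 2 + c ^+ 2 + d ^+ 2 = 1 ->
  0 < 4 * weight a b c d + 21 * (d - 2 * clif a b c d * b) + 12 * (a * d - b * c).
Proof. by move=> /sphere_bounds[/andP[? ?] /andP[? ?] /andP[? ?]]; rewrite /weight; lra. Qed.

(** The covector is tested on explicit tangent vectors: (iU, iV), which turns U^2 - V^2; minus the
    gradient of [clif], which only scales it; and (iV, iU), which leaves it unchanged and so sees
    the weight alone. *)
Lemma sphere_map_singular a b c d (l m : R) : a ^+ 2 + b ^+ 2 + c ^+ 2 + d ^+ 2 = 1 ->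
  (forall p q r s, a * p + b * q + c * r + d * s = 0 ->
     l * dre a b c d p q r s + m * dim a b c d p q r s = 0) ->
  (l = 0 /\ m = 0) \/
  clif a b c d = 0 /\ 7 * a + 3 * (a ^+ 2 + b ^+ 2 - c ^+ 2 - d ^+ 2) = 0.
Proof.
move=> E H.
have Q0 := weight_gt0 E; have B0 := dbracket_gt0 E.
have Q0' : weight a b c d != 0 by rewrite gt_eqF.
set h := clif a b c d in Q0 B0 Q0' *.
pose G := qre a b c d; pose I := qim a b c d.
have [[Gr Gi]|G0] := pselect (G = 0 /\ I = 0).
  left.
  have Gr' : a ^+ 2 - b ^+ 2 - c ^+ 2 + d ^+ 2 = 0 by exact: Gr.
  have Gi' : 2 * (a * b - c * d) = 0 by exact: Gi.
  have ab : a ^+ 2 + b ^+ 2 = c ^+ 2 + d ^+ 2.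
    have : (a ^+ 2 + b ^+ 2) ^+ 2 = (c ^+ 2 + d ^+ 2) ^+ 2.
      have -> : (a ^+ 2 + b ^+ 2) ^+ 2 = (a ^+ 2 - b ^+ 2) ^+ 2 + (2 * (a * b)) ^+ 2 by ring.
      have -> : a ^+ 2 - b ^+ 2 = c ^+ 2 - d ^+ 2 by lra.
      have -> : 2 * (a * b) = 2 * (c * d) by lra.
      ring.
    by move=> /eqP; rewrite eqrXn2 ?addr_ge0 ?sqr_ge0 // => /eqP.
  (* The vectors (U, -V) and (iU, -iV) are tangent, the first because |U| = |V|. As U^2 = V^2 here,
     U^2 - V^2 has the independent derivatives 4 U^2 and 4 i U^2 along them. *)
  have H1 : l * dre a b c d a b (- c) (- d) + m * dim a b c d a b (- c) (- d) = 0.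
    by apply: H; lra.
  have H2 : l * dre a b c d (- b) a d (- c) + m * dim a b c d (- b) a d (- c) = 0.
    by apply: H; ring.
  have {}H1 : l * (a ^+ 2 - b ^+ 2) + m * (2 * a * b) = 0.
    apply: (mulIf Q0'); apply: (mulIf (_ : 4 != 0 :> R)) => //; rewrite !mul0r -[RHS]H1.
    rewrite /dre /dim -/G -/I Gr Gi !mul0r !addr0.
    have -> : 2 * (a * a - b * b - c * - c + d * - d) = 4 * (a ^+ 2 - b ^+ 2) by lra.
    have -> : 2 * (a * b + b * a - c * - d - d * - c) = 4 * (2 * a * b) by lra.
    ring.
  have {}H2 : - l * (2 * a * b) + m * (a ^+ 2 - b ^+ 2) = 0.
    apply: (mulIf Q0'); apply: (mulIf (_ : 4 != 0 :> R)) => //; rewrite !mul0r -[RHS]H2.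
    rewrite /dre /dim -/G -/I Gr Gi !mul0r !addr0.
    have -> : 2 * (a * - b - b * a - c * d + d * - c) = - 4 * (2 * a * b) by lra.
    have -> : 2 * (a * a + b * - b - c * - c - d * d) = 4 * (a ^+ 2 - b ^+ 2) by lra.
    ring.
  have n4 : (a ^+ 2 - b ^+ 2) ^+ 2 + (2 * a * b) ^+ 2 = 1 / 4.
    have -> : (a ^+ 2 - b ^+ 2) ^+ 2 + (2 * a * b) ^+ 2 = (a ^+ 2 + b ^+ 2) ^+ 2 by ring.
    have -> : a ^+ 2 + b ^+ 2 = 1 / 2 by lra.
    by field.
  set u := _ - _ in H1 H2 n4; set v := 2 * a * b in H1 H2 n4.
  have l0 : l * (u ^+ 2 + v ^+ 2) = 0.
    have -> : l * (u ^+ 2 + v ^+ 2) = (l * u + m * v) * u - (- l * v + m * u) * v by ring.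
    by rewrite H1 H2; ring.
  have m0 : m * (u ^+ 2 + v ^+ 2) = 0.
    have -> : m * (u ^+ 2 + v ^+ 2) = (l * u + m * v) * v + (- l * v + m * u) * u by ring.
    by rewrite H1 H2; ring.
  by move: l0 m0; rewrite n4; lra.
have [lG|lG] := eqVneq (l * G + m * I) 0.
  left.
  (* Along (iU, iV) the radial change of g is killed by the covector in this case, and the rotation
     of g gives a second orthogonality relation. *)
  have := H (- b) a (- d) c; rewrite /dre /dim -/G -/I => /(_ ltac:(ring)).
  set W := weight a b c d; set dm := dweight _ _ _ _ _ _ _ _ => HY.
  have {}HY : 2 * W * (m * G - l * I) = 0.
    rewrite -[RHS]HY; apply/eqP; rewrite -subr_eq0; apply/eqP.
    transitivity (- dm * (l * G + m * I)); last by rewrite lG mulr0.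
    by rewrite /G /I /qre /qim; ring.
  have {}HY : m * G - l * I = 0.
    by move: HY => /eqP; rewrite mulf_eq0 mulf_eq0 (negPf Q0') orbF pnatr_eq0 /= => /eqP.
  have GI : G ^+ 2 + I ^+ 2 != 0.
    apply/negP; rewrite paddr_eq0 ?sqr_ge0 // !sqrf_eq0 => /andP[/eqP G1 /eqP I1].
    exact: G0.
  split; apply: (mulIf GI); rewrite mul0r.
    transitivity ((l * G + m * I) * G - (m * G - l * I) * I); first ring.
    by rewrite lG HY; ring.
  transitivity ((l * G + m * I) * I + (m * G - l * I) * G); first ring.
  by rewrite lG HY; ring.
right.
have h0 : h = 0.
  (* Minus the gradient of [clif], with its radial part removed. *)
  have := H (- c + 2 * h * a) (- d + 2 * h * b) (- a + 2 * h * c) (- b + 2 * h * d).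
  have -> : a * (- c + 2 * h * a) + b * (- d + 2 * h * b) + c * (- a + 2 * h * c) +
      d * (- b + 2 * h * d) = 2 * h * (a ^+ 2 + b ^+ 2 + c ^+ 2 + d ^+ 2) - 2 * clif a b c d.
    by rewrite /clif; ring.
  rewrite E mulr1 subrr => /(_ erefl) HZ.
  have : (l * G + m * I) * (h * (4 * weight a b c d + 21 * (d - 2 * h * b) + 12 * (a * d - b * c))) = 0.
    rewrite -[RHS]HZ /dre /dim -/G -/I /dweight -/h.
    set W := weight a b c d.
    have -> : 2 * (a * (- c + 2 * h * a) - b * (- d + 2 * h * b) - c * (- a + 2 * h * c) +
       d * (- b + 2 * h * d)) = 4 * h * G by rewrite /G /qre; ring.
    have -> : 2 * (a * (- d + 2 * h * b) + b * (- c + 2 * h * a) - c * (- b + 2 * h * d) -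
       d * (- a + 2 * h * c)) = 4 * h * I by rewrite /I /qim; ring.
    have -> : a * (- a + 2 * h * c) + c * (- c + 2 * h * a) + b * (- b + 2 * h * d) +
       d * (- d + 2 * h * b) = 4 * h * clif a b c d - (a ^+ 2 + b ^+ 2 + c ^+ 2 + d ^+ 2).
      by rewrite /clif; ring.
    by rewrite E -/h; ring.
  move=> /eqP; rewrite mulf_eq0 (negPf lG) /= mulf_eq0 (gt_eqF B0) orbF => /eqP //.
split => //.
(* The vector (iV, iU) is tangent to the circle of the torus on which U^2 - V^2 is constant. *)
have := H (- d) c (- b) a; rewrite /dre /dim -/G -/I => /(_ ltac:(ring)) HP.
have : (l * G + m * I) * (7 * a + 3 * (a ^+ 2 + b ^+ 2 - c ^+ 2 - d ^+ 2)) = 0.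
  by rewrite -[RHS]HP /dweight -/h h0; ring.
by move=> /eqP; rewrite mulf_eq0 (negPf lG) /= => /eqP.
Qed.

End HopfMap.

Section Singular.
Context {R : realType}.
Implicit Types (x v : 'rV[R]_3) (g : 'rV[R]_3 -> 'rV[R]_2).

Lemma singular_covector g x : differentiable g x -> singular_set g x ->
  exists l m : R, ~ (l = 0 /\ m = 0) /\
    forall v, l * 'D_v g x 0 0 + m * 'D_v g x 0 1 = 0.
Proof.
move=> dg; rewrite /singular_set /= => rJ.
have [u [uJ u0]] : exists u : 'rV[R]_2, u *m ('J g x)^T = 0 /\ u != 0.
  apply: contrapT => /forallNP H; move: rJ; rewrite -mxrank_tr ltnNge => /negP; apply.
  have : row_free ('J g x)^T.
    apply: inj_row_free => u uJ; apply/eqP; apply: contrapT => u0; apply: (H u).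
    by split=> //; apply/negP.
  by rewrite /row_free => /eqP ->.
exists (u 0 0), (u 0 1); split.
  move=> [u00 u01]; move/negP: u0; apply; apply/eqP.
  by apply: eq_row2; rewrite mxE.
move=> v; have : 'D_v g x *m u^T = 0.
  by rewrite deriveEjacobian // -mulmxA -[_ *m u^T]trmxK trmx_mul trmxK uJ trmx0 mulmx0.
move=> /(congr1 (fun M : 'M[R]_1 => M 0 0)); rewrite [LHS]mxE [RHS]mxE.
by rewrite sum_ord2 !mxE mulrC (mulrC (u 0 1)).
Qed.

Lemma singular_of_kernel g x v w : differentiable g x ->
  'D_v g x = 0 -> 'D_w g x = 0 ->
  (forall s t : R, s *: v + t *: w = 0 -> s = 0 /\ t = 0) -> singular_set g x.
Proof.
move=> dg Dv Dw vw; rewrite /singular_set /=.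
pose A : 'M[R]_(1 + 1, 3) := col_mx v w.
have AJ : A *m 'J g x = 0.
  by rewrite /A mul_col_mx -!deriveEjacobian // Dv Dw col_mx0.
have fA : row_free A.
  apply: inj_row_free => u; rewrite -[u]hsubmxK /A mul_row_col.
  rewrite [lsubmx u]mx11_scalar [rsubmx u]mx11_scalar !mul_scalar_mx => /vw[-> ->].
  by rewrite !raddf0 row_mx0.
have := mulmx0_rank_max AJ; move/eqP: fA => ->.
by rewrite -(leq_add2l (1 + 1)%N).
Qed.

End Singular.

Section HopfMap3.
Context {R : realType}.
Implicit Types (x v : 'rV[R]_3).

Definition nrm x : R := 1 + (x 0 0 ^+ 2 + x 0 1 ^+ 2 + x 0 2%R ^+ 2).
(* (st1 + i st2, st3 + i st4) is the point (U, V) of the unit sphere of C^2 given by inverse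
   stereographic projection. *)
Definition st1 x : R := 2 / nrm x - 1.
Definition st2 x : R := 2 * x 0 0 / nrm x.
Definition st3 x : R := 2 * x 0 2%R / nrm x.
Definition st4 x : R := 2 * x 0 1 / nrm x.

Definition hopf_map x : 'rV[R]_2 :=
  row2 (qre (st1 x) (st2 x) (st3 x) (st4 x) * weight (st1 x) (st2 x) (st3 x) (st4 x))
       (qim (st1 x) (st2 x) (st3 x) (st4 x) * weight (st1 x) (st2 x) (st3 x) (st4 x)).

Lemma nrm_gt0 x : 0 < nrm x.
Proof. by rewrite /nrm ltr_pwDl // !addr_ge0 ?sqr_ge0. Qed.

Lemma nrm_neq0 x : nrm x != 0. Proof. by rewrite gt_eqF // nrm_gt0. Qed.

Lemma st_sphere x : st1 x ^+ 2 + st2 x ^+ 2 + st3 x ^+ 2 + st4 x ^+ 2 = 1.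
Proof.
have n0 := nrm_neq0 x; rewrite /st1 /st2 /st3 /st4; move: n0; rewrite /nrm => n0.
by field.
Qed.

Lemma nrm_smooth x : smooth_at x nrm. Proof. by rewrite /nrm; smooth. Qed.

Lemma st_smooth x : [/\ smooth_at x st1, smooth_at x st2, smooth_at x st3 & smooth_at x st4].
Proof.
have n0 := nrm_neq0 x; have sn := nrm_smooth x.
by split; rewrite /st1 /st2 /st3 /st4; smooth.
Qed.

Lemma hopf_map_smooth x : smooth_at x hopf_map.
Proof.
have [s1 s2 s3 s4] := st_smooth x.
by apply: smooth_at_row2; rewrite /qre /qim /weight /clif; smooth.
Qed.

(* The differential of the stereographic projection, on a vector (p, q, r, s) tangent to the sphere. *)
Definition st_push x (p q r s : R) : 'rV[R]_3 :=
  (nrm x / 2) *: row3 (q - x 0 0 * p) (s - x 0 1 * p) (r - x 0 2%R * p).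

Lemma is_derive_invf (V : normedModType R) (f : V -> R) (x v : V) (df : R) :
  f x != 0 -> is_derive x v f df -> is_derive x v (fun y => (f y)^-1) (- df / f x ^+ 2).
Proof.
move=> f0 [Hf <-]; apply: DeriveDef; first exact: derivableV.
by rewrite deriveV // /GRing.scale /= mulNr mulNr mulrC.
Qed.

Lemma is_derive_st x (p q r s : R) :
  st1 x * p + st2 x * q + st3 x * r + st4 x * s = 0 ->
  [/\ is_derive x (st_push x p q r s) st1 p, is_derive x (st_push x p q r s) st2 q,
      is_derive x (st_push x p q r s) st3 r & is_derive x (st_push x p q r s) st4 s].
Proof.
set v := st_push x p q r s => T.
have cD (j : 'I_3) : is_derive x v (fun y : 'rV[R]_3 => y 0 j) (v 0 j).
  apply: DeriveDef.
    by apply: diff_derivable; exact: (@differentiable_coord _ _ _ x 0 j).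
  have dI : derivable (fun y : 'rV[R]_3 => y) x v by exact: derivable_id.
  by have := derive_mx dI; rewrite derive_id => /(congr1 (fun M : 'rV[R]_3 => M 0 j)); rewrite !mxE => <-.
have n0 := nrm_neq0 x.
have T' : p * (2 - nrm x) + 2 * (x 0 0 * q + x 0 1 * s + x 0 2%R * r) = 0.
  by apply: (mulIf (invr_neq0 n0)); rewrite mul0r -[RHS]T /st1 /st2 /st3 /st4; field.
have v0 : v 0 0 = nrm x / 2 * (q - x 0 0 * p) by rewrite /v /st_push mxE row3E.
have v1 : v 0 1 = nrm x / 2 * (s - x 0 1 * p) by rewrite /v /st_push mxE row3E.
have v2 : v 0 2%R = nrm x / 2 * (r - x 0 2%R * p) by rewrite /v /st_push mxE row3E.
have nD : is_derive x v nrm (- (p * nrm x ^+ 2) / 2).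
  rewrite {1}/nrm; apply: is_derive_eq; rewrite !v0 !v1 !v2 /GRing.scale /=.
  transitivity (nrm x * ((p * (2 - nrm x) + 2 * (x 0 0 * q + x 0 1 * s + x 0 2%R * r)) / 2) -
    p * nrm x ^+ 2 / 2); first by rewrite /nrm; field.
  by rewrite T' mul0r mulr0 sub0r mulNr.
have iD : is_derive x v (fun y => (nrm y)^-1) (p / 2).
  by apply: (is_derive_eq (is_derive_invf n0 nD)); field.
have vD (j : 'I_3) := is_deriveM (is_deriveM (is_derive_cst (2 : R) x v) (cD j)) iD.
split.
- have H := is_deriveB (is_deriveM (is_derive_cst (2 : R) x v) iD) (is_derive_cst (1 : R) x v).
  by apply: (is_derive_eq H); rewrite /GRing.scale /=; field.
- by apply: (is_derive_eq (vD 0)); rewrite v0 ?fctE /GRing.scale /=; field.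
- by apply: (is_derive_eq (vD 2%R)); rewrite v2 ?fctE /GRing.scale /=; field.
- by apply: (is_derive_eq (vD 1)); rewrite v1 ?fctE /GRing.scale /=; field.
Qed.

Lemma derive_hopf_map x (p q r s : R) :
  st1 x * p + st2 x * q + st3 x * r + st4 x * s = 0 ->
  'D_(st_push x p q r s) hopf_map x =
  row2 (dre (st1 x) (st2 x) (st3 x) (st4 x) p q r s)
       (dim (st1 x) (st2 x) (st3 x) (st4 x) p q r s).
Proof.
move=> /is_derive_st[H1 H2 H3 H4].
have [Hre Him] := is_derive_sphere_map H1 H2 H3 H4.
have dg := smooth_at_differentiable (hopf_map_smooth x).
rewrite derive_mx; last exact: diff_derivable.
apply: eq_row2; rewrite !mxE.
  rewrite -(derive_val (is_derive := Hre)); congr ('D__ _ _).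
  by apply/funext => y; rewrite row2E.
rewrite -(derive_val (is_derive := Him)); congr ('D__ _ _).
by apply/funext => y; rewrite row2E.
Qed.

Definition on_clifford x := clif (st1 x) (st2 x) (st3 x) (st4 x) = 0.
Definition on_fold x :=
  7 * st1 x + 3 * (st1 x ^+ 2 + st2 x ^+ 2 - st3 x ^+ 2 - st4 x ^+ 2) = 0.

Lemma hopf_map_singular x : singular_set hopf_map x <-> on_clifford x /\ on_fold x.
Proof.
have dg := smooth_at_differentiable (hopf_map_smooth x).
have E := st_sphere x.
split=> [sx|[h0 p0]].
  have [l [m [lm H]]] := singular_covector dg sx.
  have HH p q r s : st1 x * p + st2 x * q + st3 x * r + st4 x * s = 0 ->
      l * dre (st1 x) (st2 x) (st3 x) (st4 x) p q r s +
      m * dim (st1 x) (st2 x) (st3 x) (st4 x) p q r s = 0.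
    by move=> T; have := H (st_push x p q r s); rewrite derive_hopf_map // !row2E.
  by have [//|//] := sphere_map_singular E HH.
rewrite /on_clifford in h0; rewrite /on_fold in p0.
pose a := st1 x; pose b := st2 x; pose c := st3 x; pose d := st4 x.
have dhP : a * - b + c * - d + b * a + d * c = 0 by ring.
have wP : 'D_(st_push x (- d) c (- b) a) hopf_map x = 0.
  rewrite derive_hopf_map -/a -/b -/c -/d; last by ring.
  apply: eq_row2; rewrite row2E mxE.
    transitivity (qre a b c d * (7 * a + 3 * (a ^+ 2 + b ^+ 2 - c ^+ 2 - d ^+ 2) -
      7 * clif a b c d * c)); last by rewrite h0 p0; ring.
    by rewrite /dre /dweight /qre; ring.
  transitivity (qim a b c d * (7 * a + 3 * (a ^+ 2 + b ^+ 2 - c ^+ 2 - d ^+ 2) -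
    7 * clif a b c d * c)); last by rewrite h0 p0; ring.
  by rewrite /dim /dweight /qim; ring.
have h0' : a * c + b * d = 0 by exact: h0.
have E' : a ^+ 2 + b ^+ 2 + c ^+ 2 + d ^+ 2 = 1 by exact: E.
have wZ : 'D_(st_push x (- c) (- d) (- a) (- b)) hopf_map x = 0.
  rewrite derive_hopf_map -/a -/b -/c -/d; last first.
    by transitivity (- 2 * (a * c + b * d)); [ring|rewrite h0' mulr0].
  have dhZ : a * - a + c * - c + b * - b + d * - d = - 1.
    by rewrite -[in RHS]E'; ring.
  have h0c : clif a b c d = 0 by exact: h0.
  apply: eq_row2; rewrite row2E mxE /dre /dim /dweight dhZ h0c.
    by ring.
  by ring.
(* A vector killed by the projection lies along the projecting line through (-1, 0, 0, 0), which is
   not tangent to the sphere. So the combination already vanishes in R^4, where the two vectors are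
   orthonormal. *)
apply: (singular_of_kernel dg wP wZ) => s t H.
have n0 := nrm_neq0 x.
pose y1 := s * - d + t * - c; pose y2 := s * c + t * - d.
pose y3 := s * - b + t * - a; pose y4 := s * a + t * - b.
have n2 : nrm x / 2 != 0 by rewrite mulf_neq0.
have E2 : y2 = x 0 0 * y1.
  apply/eqP; rewrite -subr_eq0 -(mulrI_eq0 _ (mulfI n2)); apply/eqP.
  have := congr1 (fun M : 'rV[R]_3 => M 0 0) H; rewrite !mxE /= => <-.
  by rewrite /y1 /y2; ring.
have E4 : y4 = x 0 1 * y1.
  apply/eqP; rewrite -subr_eq0 -(mulrI_eq0 _ (mulfI n2)); apply/eqP.
  have := congr1 (fun M : 'rV[R]_3 => M 0 1) H; rewrite !mxE /= => <-.
  by rewrite /y1 /y4; ring.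
have E3 : y3 = x 0 2%R * y1.
  apply/eqP; rewrite -subr_eq0 -(mulrI_eq0 _ (mulfI n2)); apply/eqP.
  have := congr1 (fun M : 'rV[R]_3 => M 0 2%R) H; rewrite !mxE /= => <-.
  by rewrite /y1 /y3; ring.
have T : a * y1 + b * y2 + c * y3 + d * y4 = 0.
  transitivity (- 2 * t * (a * c + b * d)); last by rewrite h0'; ring.
  by rewrite /y1 /y2 /y3 /y4; ring.
have y10 : y1 = 0.
  move: T; rewrite E2 E3 E4.
  have -> : a * y1 + b * (x 0 0 * y1) + c * (x 0 2%R * y1) + d * (x 0 1 * y1) = y1.
    by move: n0; rewrite /a /b /c /d /st1 /st2 /st3 /st4 /nrm => n0; field.
  by [].
move: E2 E3 E4; rewrite y10 !mulr0 => E2 E3 E4.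
split.
  transitivity (y1 * - d + y2 * c + y3 * - b + y4 * a).
    by rewrite -[LHS]mulr1 -E' /y1 /y2 /y3 /y4; ring.
  by rewrite y10 E2 E3 E4; ring.
transitivity (y1 * - c + y2 * - d + y3 * - a + y4 * - b).
  by rewrite -[LHS]mulr1 -E' /y1 /y2 /y3 /y4; ring.
by rewrite y10 E2 E3 E4; ring.
Qed.

End HopfMap3.

(** * The fibre over the origin *)

Section Fibre.
Context {R : realType}.
Implicit Types (x p : 'rV[R]_3).

Lemma hopf_map_eq0 x : hopf_map x = 0 <->
  (st1 x = st3 x /\ st2 x = st4 x) \/ (st1 x = - st3 x /\ st2 x = - st4 x).
Proof.
have w0 := weight_gt0 (st_sphere x).
have wn0 : weight (st1 x) (st2 x) (st3 x) (st4 x) != 0 by rewrite gt_eqF.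
(* This is |U - V|^2 |U + V|^2 = |U^2 - V^2|^2. *)
have E a b c d : ((a - c) ^+ 2 + (b - d) ^+ 2) * ((a + c) ^+ 2 + (b + d) ^+ 2) =
    qre a b c d ^+ 2 + qim a b c d ^+ 2 :> R by rewrite /qre /qim; ring.
split=> [H|].
  have /eqP : qre (st1 x) (st2 x) (st3 x) (st4 x) = 0.
    have := congr1 (fun M : 'rV[R]_2 => M 0 0) H; rewrite /hopf_map row2E mxE => /eqP.
    by rewrite mulf_eq0 (negPf wn0) orbF => /eqP.
  have /eqP : qim (st1 x) (st2 x) (st3 x) (st4 x) = 0.
    have := congr1 (fun M : 'rV[R]_2 => M 0 1) H; rewrite /hopf_map row2E mxE => /eqP.
    by rewrite mulf_eq0 (negPf wn0) orbF => /eqP.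
  move=> /eqP q2 /eqP q1; have := E (st1 x) (st2 x) (st3 x) (st4 x).
  rewrite q1 q2 expr0n /= addr0 => /eqP; rewrite mulf_eq0 => /orP[].
    by rewrite paddr_eq0 ?sqr_ge0 // !sqrf_eq0 !subr_eq0 => /andP[/eqP ? /eqP ?]; left.
  by rewrite paddr_eq0 ?sqr_ge0 // !sqrf_eq0 !addr_eq0 => /andP[/eqP ? /eqP ?]; right.
move=> [[H1 H2]|[H1 H2]]; rewrite /hopf_map H1 H2; apply: eq_row2; rewrite row2E mxE /qre /qim; ring.
Qed.

(** If U = V or U = - V, then Re (U conj V) is 1/2 or -1/2, so the point is off the Clifford
    torus. *)
Lemma hopf_map_regular0 : regular_value (@hopf_map R) 0.
Proof.
move=> x /hopf_map_eq0 H /hopf_map_singular[].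
rewrite /on_clifford /clif => h0 _.
have := st_sphere x; case: H h0 => -[-> ->]; nra.
Qed.

(** The equation U = e V, cleared of denominators. *)
Definition fibre_circle (e : R) : set 'rV[R]_3 :=
  [set x : 'rV[R]_3 | x 0 0 = e * x 0 1 /\ 2 - nrm x = 2 * e * x 0 2%R].

Lemma hopf_fibreE : @hopf_map R @^-1` [set 0] = fibre_circle 1 `|` fibre_circle (-1).
Proof.
have H x (e : R) : st1 x = e * st3 x /\ st2 x = e * st4 x <-> fibre_circle e x.
  have n0 := nrm_neq0 x; have E1 : st1 x = (2 - nrm x) / nrm x by rewrite /st1; field.
  rewrite E1 /st2 /st3 /st4 /fibre_circle /=; split=> -[H1 H2]; split.
  - apply: (mulIf (_ : 2 / nrm x != 0)); first by rewrite mulf_neq0 ?invr_neq0.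
    by transitivity (2 * x 0 0 / nrm x); [ring|rewrite H2; ring].
  - by apply: (mulIf (invr_neq0 n0)); rewrite H1; ring.
  - by rewrite H2; ring.
  - by rewrite H1; ring.
apply/seteqP; split=> x.
  move=> /hopf_map_eq0[[H1 H2]|[H1 H2]]; [left|right]; apply/H.
    by rewrite !mul1r.
  by rewrite !mulN1r.
by move=> [/H|/H]; rewrite ?mul1r ?mulN1r => HH; apply/hopf_map_eq0; [left|right].
Qed.

(** For e^2 = 1 the fibre circle is the ellipse 2 x_1^2 + (x_2 + e)^2 = 2 in the plane x_0 = e x_1;
    p_2 is the transversal parameter. *)
Definition fibre_param (e : R) p : 'rV[R]_3 :=
  row3 (e * p 0 0 + p 0 2%R) (p 0 0) (Num.sqrt 2 * p 0 1 - e).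

Lemma fibre_param_diffeo e : diffeo_on setT setT (fibre_param e).
Proof.
have r2 : Num.sqrt 2 != 0 :> R by rewrite gt_eqF // sqrtr_gt0.
split=> //; [exact: openT|exact: openT|..].
  by apply: smooth_on_at => p _; apply: smooth_at_row3; smooth.
exists (fun x => row3 (x 0 1) ((x 0 2%R + e) / Num.sqrt 2) (x 0 0 - e * x 0 1)); split => //.
- by apply: smooth_on_at => p _; apply: smooth_at_row3; smooth.
- by move=> p _; rewrite /fibre_param; apply: eq_row3; rewrite !row3E //; field.
- by move=> p _; rewrite /fibre_param; apply: eq_row3; rewrite !row3E //; field.
Qed.

Lemma fibre_circleE e : e ^+ 2 = 1 -> fibre_circle e = fibre_param e @` @round_circle R.
Proof.
move=> e1; have r2 : Num.sqrt 2 != 0 :> R by rewrite gt_eqF // sqrtr_gt0.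
have s2 : Num.sqrt 2 ^+ 2 = 2 :> R by rewrite sqr_sqrtr.
apply/seteqP; split=> x.
  move=> [H1 H2]; exists (row3 (x 0 1) ((x 0 2%R + e) / Num.sqrt 2) 0).
    split; rewrite !row3E // exprMn exprVn s2.
    move: H2; rewrite /nrm H1 exprMn e1; lra.
  by apply: eq_row3; rewrite /fibre_param !row3E ?addr0 //; field.
move=> [p [p1 p2] <-]; rewrite /fibre_circle /= /nrm /fibre_param !row3E p2 addr0; split=> //.
have -> : (Num.sqrt 2 * p 0 1 - e) ^+ 2 = 2 * p 0 1 ^+ 2 - 2 * e * Num.sqrt 2 * p 0 1 + 1.
  transitivity (Num.sqrt 2 ^+ 2 * p 0 1 ^+ 2 - 2 * e * Num.sqrt 2 * p 0 1 + e ^+ 2); first by ring.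
  by rewrite s2 e1.
by rewrite exprMn e1; lra.
Qed.

Lemma hopf_fibre_link : link (@hopf_map R @^-1` [set 0]).
Proof.
exists 2%N, (fun i => fibre_circle ((-1) ^+ i)); split.
- move=> i; rewrite fibre_circleE; last exact: sqrr_sign.
  exact: embedded_circle_image (fibre_param_diffeo _) round_circle_embedded.
- suff H : fibre_circle 1 `&` fibre_circle (-1) = set0.
    by apply: ord2P; apply: ord2P => //= _; rewrite expr0 expr1 // setIC.
  apply/seteqP; split=> // x [[H1 H2] [H3 H4]].
  have x1 : x 0 1 = 0 by move: H1 H3; lra.
  have x2 : x 0 2%R = 0 by move: H2 H4; lra.
  by move: H1 H2; rewrite /nrm x1 x2 => ->; rewrite !mulr0 expr0n /= !addr0; lra.
- rewrite hopf_fibreE; apply/seteqP; split=> x.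
    by move=> [Hx|Hx]; [exists 0|exists 1] => //=; rewrite ?expr0 ?expr1.
  by move=> [i _]; move: i; apply: ord2P; rewrite ?expr0 ?expr1 => ?; [left|right].
Qed.

Lemma hopf_fibre_nonempty : @hopf_map R @^-1` [set 0] !=set0.
Proof.
rewrite hopf_fibreE fibre_circleE ?expr1n //.
exists (fibre_param 1 (row3 1 0 0)); left; exists (row3 1 0 0) => //.
by split; rewrite !row3E // expr1n expr0n addr0.
Qed.

End Fibre.

(** * The singular circle is unknotted *)

Section Isotopy.
Context {R : realType}.
Implicit Types (x p : 'rV[R]_3) (u v t : R).

Definition r8 : R := Num.sqrt 8.
(** On the round circle put v = [r8] * p_1, so that p_0^2 = (8 - v^2) / 8; then p_0 * [stretch v] is
    the first coordinate u of the singular curve. *)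
Definition stretch v : R := r8 * Num.sqrt (9 * v ^+ 2 + 5) / (2 * (5 * v ^+ 2 + 2)).
Definition root u : R := Num.sqrt (121 + 96 * u ^+ 2).
(** Chosen so that u * [shear u] = ([root u] - 11) / 8. On the singular curve the second coordinate
    is v (13 - [root u]) / 8, that is v / 4 minus v times this quantity. *)
Definition shear u : R := 12 * u / (root u + 11).

Lemma r8_gt0 : 0 < r8. Proof. by rewrite sqrtr_gt0. Qed.

Lemma r8_sq : r8 ^+ 2 = 8. Proof. by rewrite sqr_sqrtr. Qed.

Lemma stretch_den_gt0 v : 0 < 5 * v ^+ 2 + 2.
Proof. by have := sqr_ge0 v; lra. Qed.

Lemma stretch_num_gt0 v : 0 < 9 * v ^+ 2 + 5.
Proof. by have := sqr_ge0 v; lra. Qed.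

Lemma stretch_gt0 v : 0 < stretch v.
Proof.
have d0 := stretch_den_gt0 v; have n0 := stretch_num_gt0 v.
by rewrite /stretch divr_gt0 ?mulr_gt0 ?sqrtr_gt0.
Qed.

Lemma root_arg_gt0 u : 0 < 121 + 96 * u ^+ 2.
Proof. by have := sqr_ge0 u; lra. Qed.

Lemma root_ge11 u : 11 <= root u.
Proof.
have -> : 11 = Num.sqrt (11 ^+ 2) :> R by rewrite sqrtr_sqr ger0_norm.
by rewrite ler_wsqrtr //; have := sqr_ge0 u; lra.
Qed.

Lemma stretch_smooth (V : normedModType R) (z : V) (f : V -> R) :
  smooth_at z f -> smooth_at z (fun y => stretch (f y)).
Proof.
move=> sf; rewrite /stretch; smooth; first exact: stretch_num_gt0.
by rewrite mulf_neq0 // gt_eqF // stretch_den_gt0.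
Qed.

Lemma shear_smooth (V : normedModType R) (z : V) (f : V -> R) :
  smooth_at z f -> smooth_at z (fun y => shear (f y)).
Proof.
move=> sf; rewrite /shear /root; smooth; first exact: root_arg_gt0.
by rewrite gt_eqF // ltr_wpDl // sqrtr_ge0.
Qed.

(* A rescaling of the plane w = 0 followed by two shears, (x, v, w) |-> (x, v, w - x v) and then
   one of the second coordinate, so that the inverse is explicit at every time. *)
Definition twist t p : 'rV[R]_3 :=
  let v := (1 + t * (r8 - 1)) * p 0 1 in
  let x := p 0 0 * (1 + t * (stretch v - 1)) in
  let z := p 0 2%R - t * x * v in
  row3 x (v * (1 - t * (3 / 4)) + t * shear x * z) z.

Definition untwist t p : 'rV[R]_3 :=
  let x := p 0 0 in let z := p 0 2%R in
  let v := (p 0 1 - t * shear x * z) / (1 - t * (3 / 4)) in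
  row3 (x / (1 + t * (stretch v - 1))) (v / (1 + t * (r8 - 1))) (z + t * x * v).

Lemma convex_gt0 (t a : R) : 0 <= t <= 1 -> 0 < a -> 0 < 1 + t * (a - 1).
Proof.
move=> /andP[t0 t1] a0; have [->|tn0] := eqVneq t 0; first by rewrite mul0r addr0.
have : 0 < t * a by rewrite mulr_gt0 // lt_neqAle eq_sym tn0.
lra.
Qed.

Lemma twist_smooth (V : normedModType R) (z : V) (f : V -> R) (g : V -> 'rV[R]_3) :
  smooth_at z f -> smooth_at z g -> smooth_at z (fun y => twist (f y) (g y)).
Proof.
move=> sf sg; rewrite /twist.
have g0 := smooth_at_coord 0 sg; have g1 := smooth_at_coord 1 sg.
have g2 := smooth_at_coord 2%R sg.
have sv : smooth_at z (fun y => stretch ((1 + f y * (r8 - 1)) * g y 0 1)).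
  by apply: stretch_smooth; smooth.
have sx : smooth_at z (fun y => shear (g y 0 0 * (1 + f y * (stretch ((1 + f y * (r8 - 1)) * g y 0 1) - 1)))).
  by apply: shear_smooth; smooth.
by apply: smooth_at_row3; smooth.
Qed.

Lemma untwist_smooth t p : 0 <= t <= 1 -> smooth_at p (untwist t).
Proof.
move=> t01; have t34 : 1 - t * (3 / 4) != 0 by rewrite gt_eqF //; move: t01 => /andP[]; lra.
have sv : smooth_at p (fun p => (p 0 1 - t * shear (p 0 0) * p 0 2%R) / (1 - t * (3 / 4))).
  have s1 : smooth_at p (fun p : 'rV[R]_3 => shear (p 0 0)) by apply: shear_smooth; smooth.
  by smooth.
have ss := stretch_smooth sv.
rewrite /untwist; apply: smooth_at_row3; smooth.
by rewrite gt_eqF // convex_gt0 // stretch_gt0.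
Qed.

Lemma twistK t p : 0 <= t <= 1 -> untwist t (twist t p) = p.
Proof.
move=> t01; have t34 : 1 - t * (3 / 4) != 0 by rewrite gt_eqF //; move: t01 => /andP[]; lra.
have n8 : 1 + t * (r8 - 1) != 0 by rewrite gt_eqF // convex_gt0 // r8_gt0.
rewrite /untwist /twist !row3E addrK mulfK //.
set v := (1 + _) * p 0 1.
have ns : 1 + t * (stretch v - 1) != 0 by rewrite gt_eqF // convex_gt0 // stretch_gt0.
by apply: eq_row3; rewrite !row3E ?mulfK // ?subrK // /v mulrC mulKf.
Qed.

Lemma untwistK t p : 0 <= t <= 1 -> twist t (untwist t p) = p.
Proof.
move=> t01; have t34 : 1 - t * (3 / 4) != 0 by rewrite gt_eqF //; move: t01 => /andP[]; lra.
have n8 : 1 + t * (r8 - 1) != 0 by rewrite gt_eqF // convex_gt0 // r8_gt0.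
rewrite /untwist /twist !row3E.
set v := (p 0 1 - _) / _.
have ns : 1 + t * (stretch v - 1) != 0 by rewrite gt_eqF // convex_gt0 // stretch_gt0.
have -> : (1 + t * (r8 - 1)) * (v / (1 + t * (r8 - 1))) = v by rewrite mulrC divfK.
have -> : p 0 0 / (1 + t * (stretch v - 1)) * (1 + t * (stretch v - 1)) = p 0 0 by rewrite divfK.
by apply: eq_row3; rewrite !row3E ?addrK // /v divfK // subrK.
Qed.

Lemma twist_diffeo t : 0 <= t <= 1 -> diffeo_on setT setT (twist t).
Proof.
move=> t01; split=> //; [exact: openT|exact: openT|..].
  by apply: smooth_on_at => p _; apply: twist_smooth; [exact: smooth_at_cst|exact: smooth_at_id].
exists (untwist t); split=> //.
- by apply: smooth_on_at => p _; exact: untwist_smooth.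
- by move=> p _; exact: twistK.
- by move=> p _; exact: untwistK.
Qed.

Lemma twist_isotopic (A : set 'rV[R]_3) : ambient_isotopic A (twist 1 @` A).
Proof.
exists (fun z : R^o * 'rV[R]_3 => twist z.1 z.2); split => //.
- by apply: smooth_on_at => z _; apply: twist_smooth; [exact: smooth_at_fst|exact: smooth_at_snd].
- by move=> t; exact: twist_diffeo.
- move=> x; rewrite /twist !mul0r !addr0 !mul1r !subr0 !mulr1.
  by apply: eq_row3; rewrite !row3E.
Qed.

(** Along the curve 121 + 96 u^2 is the square of a rational function of v^2. This is what lets the
    shear depend on u alone. *)
Lemma root_on_fold u v : u ^+ 2 = (8 - v ^+ 2) * (9 * v ^+ 2 + 5) / (4 * (5 * v ^+ 2 + 2) ^+ 2) ->
  root u = (53 * v ^+ 2 + 38) / (5 * v ^+ 2 + 2).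
Proof.
move=> uE; have d0 := stretch_den_gt0 v; have d0' : 5 * v ^+ 2 + 2 != 0 by rewrite gt_eqF.
have -> : root u = Num.sqrt (((53 * v ^+ 2 + 38) / (5 * v ^+ 2 + 2)) ^+ 2).
  by rewrite /root uE; congr (Num.sqrt _); field.
rewrite sqrtr_sqr ger0_norm // divr_ge0 //; last exact: ltW.
by have := sqr_ge0 v; lra.
Qed.

(** The right side is the second coordinate of the singular curve. Its ratio to v is 1/4 at u = 0,
    where v^2 = 8, whence the factor 1 - 3/4 in [twist]; the shear supplies the rest. *)
Lemma shear_on_fold u v : u ^+ 2 = (8 - v ^+ 2) * (9 * v ^+ 2 + 5) / (4 * (5 * v ^+ 2 + 2) ^+ 2) ->
  v / 4 - shear u * (u * v) = 3 * v * (v ^+ 2 - 1) / (2 * (5 * v ^+ 2 + 2)).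
Proof.
move=> uE; have d0 : 5 * v ^+ 2 + 2 != 0 by rewrite gt_eqF // stretch_den_gt0.
have n0 : 9 * v ^+ 2 + 5 != 0 by rewrite gt_eqF // stretch_num_gt0.
rewrite /shear (root_on_fold uE).
have -> : (53 * v ^+ 2 + 38) / (5 * v ^+ 2 + 2) + 11 = 12 * (9 * v ^+ 2 + 5) / (5 * v ^+ 2 + 2) by field.
have -> : 12 * u / (12 * (9 * v ^+ 2 + 5) / (5 * v ^+ 2 + 2)) * (u * v) =
    u ^+ 2 * v * (5 * v ^+ 2 + 2) / (9 * v ^+ 2 + 5) by field; rewrite n0 d0.
by rewrite uE; field; rewrite n0 d0.
Qed.

Lemma twist1E p : twist 1 p =
  row3 (p 0 0 * stretch (r8 * p 0 1))
    (r8 * p 0 1 / 4 + shear (p 0 0 * stretch (r8 * p 0 1)) *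
      (p 0 2%R - p 0 0 * stretch (r8 * p 0 1) * (r8 * p 0 1)))
    (p 0 2%R - p 0 0 * stretch (r8 * p 0 1) * (r8 * p 0 1)).
Proof.
rewrite /twist !mul1r; have E (a : R) : 1 + (a - 1) = a by ring.
rewrite !E; apply: eq_row3; rewrite !row3E //.
by congr (_ + _); field.
Qed.

Lemma stretch_sq v : stretch v ^+ 2 = 8 * (9 * v ^+ 2 + 5) / (4 * (5 * v ^+ 2 + 2) ^+ 2).
Proof.
have d0 : 5 * v ^+ 2 + 2 != 0 by rewrite gt_eqF // stretch_den_gt0.
rewrite /stretch !exprMn r8_sq sqr_sqrtr ?ltW ?stretch_num_gt0 //.
by rewrite exprVn exprMn; field.
Qed.

Lemma round_circle_twist x : (twist 1 @` @round_circle R) x <->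
  exists v, [/\ x 0 0 ^+ 2 = (8 - v ^+ 2) * (9 * v ^+ 2 + 5) / (4 * (5 * v ^+ 2 + 2) ^+ 2),
    x 0 1 = 3 * v * (v ^+ 2 - 1) / (2 * (5 * v ^+ 2 + 2)) & x 0 2%R = - (x 0 0 * v)].
Proof.
split=> [[p [p1 p2] <-]|[v [H0 H1 H2]]].
  exists (r8 * p 0 1); rewrite twist1E !row3E p2 sub0r.
  set v := r8 * p 0 1; set u := p 0 0 * _.
  have uE : u ^+ 2 = (8 - v ^+ 2) * (9 * v ^+ 2 + 5) / (4 * (5 * v ^+ 2 + 2) ^+ 2).
    rewrite /u exprMn stretch_sq -/v.
    have -> : p 0 0 ^+ 2 = (8 - v ^+ 2) / 8.
      rewrite /v exprMn r8_sq; lra.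
    have d0 : 5 * v ^+ 2 + 2 != 0 by rewrite gt_eqF // stretch_den_gt0.
    by field.
  by split => //; rewrite -(shear_on_fold uE) mulrN.
have s0 := stretch_gt0 v; have r0 := r8_gt0.
exists (row3 (x 0 0 / stretch v) (v / r8) 0).
  split; rewrite row3E // row3E expr_div_n stretch_sq H0 expr_div_n r8_sq.
  have d0 : 5 * v ^+ 2 + 2 != 0 by rewrite gt_eqF // stretch_den_gt0.
  have n0 : 9 * v ^+ 2 + 5 != 0 by rewrite gt_eqF // stretch_num_gt0.
  by field; rewrite d0 n0.
rewrite twist1E !row3E sub0r.
have -> : r8 * (v / r8) = v by rewrite mulrC divfK // gt_eqF.
rewrite divfK ?gt_eqF //; apply: eq_row3; rewrite !row3E //.
by rewrite H1 -(shear_on_fold H0) mulrN.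
Qed.

End Isotopy.

(** * Parametrization of the singular curve, and the disc that it bounds *)

Section Curve.
Context {R : realType}.
Implicit Types (x p : 'rV[R]_3).

(** Re (U conj V) = 0 means V = i v U with v real, so |U|^2 = 1 / (1 + v^2) and the fold equation
    determines a. The numerator of b^2 is 49 (1 + v^2) - 9 (v^2 - 1)^2 = (8 - v^2) (9 v^2 + 5). *)
Lemma fold_curveP x : on_clifford x /\ on_fold x <-> exists v : R,
  [/\ x 0 0 ^+ 2 = (8 - v ^+ 2) * (9 * v ^+ 2 + 5) / (4 * (5 * v ^+ 2 + 2) ^+ 2),
    x 0 1 = 3 * v * (v ^+ 2 - 1) / (2 * (5 * v ^+ 2 + 2)) & x 0 2%R = - (x 0 0 * v)].
Proof.
have n0 := nrm_neq0 x; have E := st_sphere x; split.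
  rewrite /on_clifford /on_fold /clif.
  have x0 : x 0 0 = st2 x * nrm x / 2 by rewrite /st2; field.
  have x1 : x 0 1 = st4 x * nrm x / 2 by rewrite /st4; field.
  have x2 : x 0 2%R = st3 x * nrm x / 2 by rewrite /st3; field.
  have nE : nrm x = 2 / (1 + st1 x) by rewrite /st1 subrKC invfM invrK mulrA divff // mul1r.
  move: E x0 x1 x2; rewrite nE; set a := st1 x; set b := st2 x; set c := st3 x; set d := st4 x.
  have a1 : 1 + a != 0 by rewrite /a /st1 subrKC mulf_neq0 // invr_neq0.
  move=> E x0 x1 x2 [h0 p0].
  (* For U = 0 the fold equation would read -3 = 0. *)
  have ab : a ^+ 2 + b ^+ 2 != 0.
    apply/eqP => ab; have a0 : a = 0 by have := sqr_ge0 a; have := sqr_ge0 b; nra.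
    by move: p0; rewrite -addrA; lra.
  pose v := (d * a - c * b) / (a ^+ 2 + b ^+ 2).
  have vE : v * (a ^+ 2 + b ^+ 2) = d * a - c * b by rewrite /v divfK.
  have dE : d = v * a.
    apply: (mulIf ab); rewrite [RHS]mulrAC vE.
    transitivity ((d * a - c * b) * a + b * (a * c + b * d)); first ring.
    by rewrite h0 mulr0 addr0.
  have cE : c = - v * b.
    apply: (mulIf ab); rewrite [RHS]mulrAC mulNr vE.
    transitivity (- (d * a - c * b) * b + a * (a * c + b * d)); first ring.
    by rewrite h0 mulr0 addr0.
  have v1 : 1 + v ^+ 2 != 0 by rewrite gt_eqF //; have := sqr_ge0 v; lra.
  have v5 : 5 * v ^+ 2 + 2 != 0 by rewrite gt_eqF // stretch_den_gt0.
  have abE : a ^+ 2 + b ^+ 2 = 1 / (1 + v ^+ 2).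
    apply: (mulIf v1); rewrite divfK // -[RHS]E dE cE; ring.
  have aE : a = 3 * (v ^+ 2 - 1) / (7 * (1 + v ^+ 2)).
    have : 7 * a + 3 * (1 - v ^+ 2) * (a ^+ 2 + b ^+ 2) = 0 by rewrite -[RHS]p0 dE cE; ring.
    rewrite abE => H; apply: (mulIf (_ : 7 != 0 :> R)) => //.
    apply/eqP; rewrite -subr_eq0; apply/eqP; rewrite -[RHS]H; field.
    by rewrite v1.
  have bE : b ^+ 2 = 1 / (1 + v ^+ 2) - a ^+ 2 by rewrite -abE; ring.
  have a1E : 1 + a = (10 * v ^+ 2 + 4) / (7 * (1 + v ^+ 2)) by rewrite aE; field.
  have v10 : 10 * v ^+ 2 + 4 != 0 by rewrite gt_eqF //; have := sqr_ge0 v; lra.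
  exists v; split.
  - rewrite x0 -mulrA exprMn bE a1E aE; field.
    by rewrite v1 v10 v5.
  - by rewrite x1 a1E dE aE; field; rewrite v1 v10 v5.
  - by rewrite x2 x0 cE; field; rewrite a1.
move=> [v [x0 x1 x2]].
have v1 : 1 + v ^+ 2 != 0 by rewrite gt_eqF //; have := sqr_ge0 v; lra.
have v5 : 5 * v ^+ 2 + 2 != 0 by rewrite gt_eqF // stretch_den_gt0.
have nE : nrm x = 7 * (1 + v ^+ 2) / (5 * v ^+ 2 + 2).
  by rewrite /nrm x2 sqrrN exprMn x0 x1; field.
rewrite /on_clifford /on_fold /clif /st1 /st2 /st3 /st4; split.
  by rewrite nE x1 x2; field; rewrite v1 v5.
have -> : (2 / nrm x - 1) ^+ 2 + (2 * x 0 0 / nrm x) ^+ 2 - (2 * x 0 2%R / nrm x) ^+ 2 -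
    (2 * x 0 1 / nrm x) ^+ 2 = (2 / nrm x - 1) ^+ 2 + 4 * x 0 0 ^+ 2 * (1 - v ^+ 2) / nrm x ^+ 2 -
    (2 * x 0 1 / nrm x) ^+ 2 by rewrite x2; field.
by rewrite x0 nE x1; field; rewrite v1 v5.
Qed.

Lemma hopf_map_singular_set : singular_set (@hopf_map R) = twist 1 @` @round_circle R.
Proof.
apply/seteqP; split=> x.
  by move=> /hopf_map_singular /fold_curveP H; apply/round_circle_twist.
by move=> /round_circle_twist /fold_curveP H; apply/hopf_map_singular.
Qed.

Lemma hopf_map_unknotted : unknotted_circle (singular_set (@hopf_map R)).
Proof.
rewrite hopf_map_singular_set; split; last exact: twist_isotopic.
apply: embedded_circle_image round_circle_embedded.
by apply: twist_diffeo; rewrite ler01 lexx.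
Qed.

(** A positive n would exceed 3/20 by the quadratic inequality, and the quartic is negative between
    3/20 and 1/4. *)
Lemma quartic_lt0 (n : R) : n <= 1 / 4 -> 0 <= 44 * n ^+ 2 + 13 * n - 3 ->
  64 * n ^+ 4 - 308 * n ^+ 3 + 349 * n ^+ 2 - 114 * n + 9 = 0 -> n <= 0.
Proof.
move=> n4 nq q0; rewrite leNgt; apply/negP => n0.
have n15 : 3 / 20 < n by nra.
nra.
Qed.

(* The strip |p_1| <= 1 of the plane p_2 = 0 contains the unit disc, so the image of a thin
   ellipsoid around that disc separates the singular circle from the fibre. *)
Lemma strip_disjoint_fibre p : p 0 2%R = 0 -> `|p 0 1| <= 1 -> hopf_map (twist 1 p) <> 0.
Proof.
move=> p2 p1 H0.
have : (@hopf_map R @^-1` [set 0]) (twist 1 p) by [].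
rewrite hopf_fibreE twist1E p2 sub0r.
set v := r8 * p 0 1; set u := p 0 0 * _ => H.
have v8 : v ^+ 2 <= 8.
  rewrite /v exprMn r8_sq -[leRHS]mulr1 ler_pM2l // -real_normK ?num_real //.
  by rewrite expr_le1.
(* The image point is (u, v n, - u v). *)
pose s : R := root u; pose n : R := (13 - s) / 8.
have s11 : 11 <= s by exact: root_ge11.
have sE : s ^+ 2 = 121 + 96 * u ^+ 2 by rewrite /s /root sqr_sqrtr // ltW // root_arg_gt0.
have yE : v / 4 + shear u * - (u * v) = v * n.
  have s11' : s + 11 != 0 by rewrite gt_eqF //; lra.
  rewrite /shear -/(root u) -/s /n.
  have -> : v / 4 + 12 * u / (s + 11) * - (u * v) = v / 4 - v * (96 * u ^+ 2) / (8 * (s + 11)) by field.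
  have -> : 96 * u ^+ 2 = s ^+ 2 - 121 by rewrite sE; ring.
  by field.
have [e [e2 [H1 H2]]] : exists e : R, e ^+ 2 = 1 /\ u = e * (v * n) /\
    1 - (u ^+ 2 + (v * n) ^+ 2 + (u * v) ^+ 2) = 2 * e * - (u * v).
  move: H; rewrite yE => -[[]|[]]; rewrite /nrm !row3E sqrrN => H1 H2.
    by exists 1; split; [rewrite expr1n|split => //; lra].
  by exists (-1); split; [rewrite sqrrN expr1n|split => //; lra].
have u2 : u ^+ 2 = v ^+ 2 * n ^+ 2 by rewrite H1 exprMn e2 mul1r exprMn.
have euv : e * (u * v) = v ^+ 2 * n.
  by rewrite H1; transitivity (e ^+ 2 * (v ^+ 2 * n)); [ring|rewrite e2 mul1r].
have un : 6 * (v ^+ 2 * n ^+ 2) = 3 - 13 * n + 4 * n ^+ 2.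
  have : s = 13 - 8 * n by rewrite /n; field.
  by move=> sn; move: sE; rewrite sn u2; nra.
(* The two bounds on n translate [root u] >= 11 and v^2 <= 8. *)
have n4 : n <= 1 / 4 by rewrite /n; lra.
have nq : 0 <= 44 * n ^+ 2 + 13 * n - 3 by have := sqr_ge0 n; nra.
set q := v ^+ 2 in u2 euv un v8.
have q1 : 1 + 2 * (q * n) - (q * n) ^+ 2 - 2 * (q * n ^+ 2) = 0.
  have E1 : (u * v) ^+ 2 = q * (q * n ^+ 2) by rewrite exprMn u2 mulrC.
  have E2 : (v * n) ^+ 2 = q * n ^+ 2 by rewrite exprMn.
  have E3 : 2 * e * - (u * v) = - (2 * (q * n)) by rewrite -euv; ring.
  by move: H2; rewrite E1 E2 E3 u2 => H2; nra.
(* Elimination of v^2 between the equation of the fibre and the one defining [root u]. *)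
have quart : 64 * n ^+ 4 - 308 * n ^+ 3 + 349 * n ^+ 2 - 114 * n + 9 = 0.
  have w : q * n ^+ 2 = (3 - 13 * n + 4 * n ^+ 2) / 6 by lra.
  have : n ^+ 2 * (1 + 2 * (q * n) - (q * n) ^+ 2 - 2 * (q * n ^+ 2)) = 0 by rewrite q1 mulr0.
  have -> : n ^+ 2 * (1 + 2 * (q * n) - (q * n) ^+ 2 - 2 * (q * n ^+ 2)) =
    n ^+ 2 + 2 * n * (q * n ^+ 2) - (q * n ^+ 2) ^+ 2 - 2 * n ^+ 2 * (q * n ^+ 2) by ring.
  by rewrite w => H3; apply: (mulIf (_ : (- 1 / 36) != 0 :> R)); rewrite ?mul0r -?[RHS]H3; [lra|field].
have nle := quartic_lt0 n4 nq quart.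
have n0 : n != 0 by apply/eqP => n0; move: un; rewrite n0; lra.
have nlt : n < 0 by rewrite lt_neqAle n0.
(* Every term of the quartic is positive for n < 0. *)
move: quart; nra.
Qed.

End Curve.

(** * A ball around the singular circle *)

Section Ball.
Context {R : realType}.
Implicit Types (p : 'rV[R]_3).

Definition flatten (h : R) p : 'rV[R]_3 := row3 (p 0 0) (p 0 1) (h * p 0 2%R).

Lemma flatten_diffeo h : h != 0 -> diffeo_on setT setT (flatten h).
Proof.
move=> h0; split=> //; [exact: openT|exact: openT|..].
  by apply: smooth_on_at => p _; apply: smooth_at_row3; smooth.
exists (flatten h^-1); split=> //.
- by apply: smooth_on_at => p _; apply: smooth_at_row3; smooth.
- by move=> p _; apply: eq_row3; rewrite !row3E // mulKf.
- by move=> p _; apply: eq_row3; rewrite !row3E // mulVKf.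
Qed.

Lemma closed_unit_ballP p : closed_unit_ball p -> forall j, `|p 0 j| <= 1.
Proof.
rewrite /closed_unit_ball /= => H j.
have : p 0 j ^+ 2 <= 1.
  apply: le_trans H; rewrite (bigD1 j) //= lerDl.
  by apply: sumr_ge0 => i _; exact: sqr_ge0.
by rewrite -real_normK ?num_real // expr_le1.
Qed.

(** For h = 0 the flattened cube lies in the strip, whose image misses the fibre. Compactness of the
    cube carries this over to small h. *)
Lemma thin_ball_disjoint_fibre : exists2 h : R, h != 0 &
  forall p, closed_unit_ball p -> hopf_map (twist 1 (flatten h p)) <> 0.
Proof.
pose K : set 'rV[R]_3 := [set v | forall i, `[(-1 : R), 1]%classic (v ord0 i)].
have cK : compact K :=
  @rV_compact R 3 (fun=> `[(-1 : R), 1]%classic) (fun=> @segment_compact R (-1) 1).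
pose f (z : 'rV[R]_3 * R^o) := hopf_map (twist 1 (flatten z.2 z.1)).
have sf z : smooth_at z f.
  apply: smooth_at_comp; last exact: hopf_map_smooth.
  apply: twist_smooth; first exact: smooth_at_cst.
  have s2 : smooth_at z (fun z : 'rV[R]_3 * R^o => z.2 : R) by exact: smooth_at_snd.
  have s1 := smooth_at_fst z.
  have s10 := smooth_at_coord 0 s1; have s11 := smooth_at_coord 1 s1.
  have s12 := smooth_at_coord 2%R s1.
  by apply: smooth_at_row3; smooth.
have H : \forall h \near (0 : R^o), K `<=` [set p | f (p, h) <> 0].
  have := (compact_near_coveringP K).1 cK R^o (nbhs (0 : R^o)) (fun h p => f (p, h) <> 0).
  apply => p Kp.
  have f0 : f (p, 0) <> 0.
    apply: strip_disjoint_fibre; rewrite !row3E ?mul0r //.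
    by have := Kp 1; rewrite /= in_itv /= ler_norml.
  have : \forall z \near (p, (0 : R^o)), 0 < `|f z|.
    apply: (@continuous_near _ _ _ _ (fun z => `|f z| : R) [set y | 0 < y]).
    - by apply: continuous_comp; [exact: smooth_at_continuous|exact: norm_continuous].
    - exact: open_gt.
    - by rewrite /= normr_gt0; apply/eqP.
  by apply: filterS => z; rewrite normr_gt0 => /eqP.
have [r /= r0 Hr] := (nbhs_ballP _ _).1 H.
exists (r / 2); first by rewrite gt_eqF // divr_gt0.
move=> p pB; apply: (Hr (r / 2)).
  rewrite -ball_normE /= sub0r normrN gtr0_norm ?divr_gt0 //.
  by rewrite ltr_pdivrMr // ltr_pMr // ltr1n.
by move=> i; rewrite /= in_itv /= -ler_norml; apply: closed_unit_ballP.
Qed.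

Lemma hopf_map_ball : exists B : set 'rV[R]_3,
  [/\ ball3 B, singular_set (@hopf_map R) `<=` B & B `&` @hopf_map R @^-1` [set 0] = set0].
Proof.
have [h h0 Hh] := thin_ball_disjoint_fibre.
have d1 : diffeo_on setT setT (twist (1 : R)) by apply: twist_diffeo; rewrite ler01 lexx.
have [_ _ s1 [k1 [t1 _ _ k1K t1K]]] := d1.
have [_ _ s2 [k2 [t2 _ _ k2K t2K]]] := flatten_diffeo h0.
exists ((fun p => twist 1 (flatten h p)) @` @closed_unit_ball R); split.
- exists setT, setT, (fun p => twist 1 (flatten h p)); split => //.
  split; [exact: openT|exact: openT|..].
    apply: smooth_on_at => p _; apply: smooth_at_comp; first by exists setT; split => //; exact: openT.
    by exists setT; split => //; exact: openT.
  exists (fun y => k2 (k1 y)); split => //.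
  - apply: smooth_on_at => p _; apply: smooth_at_comp; first by exists setT; split => //; exact: openT.
    by exists setT; split => //; exact: openT.
  - by move=> x _; rewrite k1K // k2K.
  - by move=> x _; rewrite t2K // t1K.
- rewrite hopf_map_singular_set => _ [p [p1 p2] <-]; exists p.
    by rewrite /closed_unit_ball /= sum_ord3 p2 expr0n addr0 p1.
  by congr twist; apply: eq_row3; rewrite !row3E // p2 mulr0.
- by apply/seteqP; split=> // x [[p pB <-] /Hh].
Qed.

End Ball.

(** * Coordinates near the Clifford torus *)

Section Chart.
Context {R : realType}.
Implicit Types (x q : 'rV[R]_3) (a b c s : R).

(* The cosine of arcsin a; the point (C, S) = (cos t, sin t) rotated by arcsin a is
   (cosr C S a, sinr C S a). *)
Definition co a : R := Num.sqrt (1 - a ^+ 2).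
Definition cosr c s a : R := c * co a - s * a.
Definition sinr c s a : R := s * co a + c * a.

Lemma co0 : co 0 = 1. Proof. by rewrite /co expr0n subr0 sqrtr1. Qed.
Lemma cosr0 c s : cosr c s 0 = c. Proof. by rewrite /cosr co0 mulr1 mulr0 subr0. Qed.
Lemma sinr0 c s : sinr c s 0 = s. Proof. by rewrite /sinr co0 mulr1 mulr0 addr0. Qed.

Lemma co_sq a : a ^+ 2 <= 1 -> co a ^+ 2 = 1 - a ^+ 2.
Proof. by move=> a1; rewrite sqr_sqrtr // subr_ge0. Qed.

Lemma rot_unit c s a : a ^+ 2 <= 1 -> c ^+ 2 + s ^+ 2 = 1 ->
  cosr c s a ^+ 2 + sinr c s a ^+ 2 = 1.
Proof.
move=> /co_sq a1 cs; rewrite /cosr /sinr.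
transitivity ((c ^+ 2 + s ^+ 2) * (co a ^+ 2 + a ^+ 2)); first ring.
by rewrite cs a1 mul1r subrK.
Qed.

Section Germ.
Variables (V : normedModType R) (z : V).

Lemma co_smooth (f : V -> R) : smooth_at z f -> f z = 0 -> smooth_at z (fun y => co (f y)).
Proof. by move=> sf f0; rewrite /co; smooth; rewrite f0 expr0n subr0. Qed.

Lemma cosr_smooth c s (f : V -> R) : smooth_at z f -> f z = 0 ->
  smooth_at z (fun y => cosr c s (f y)).
Proof. by move=> sf f0; have sc := co_smooth sf f0; rewrite /cosr; smooth. Qed.

Lemma sinr_smooth c s (f : V -> R) : smooth_at z f -> f z = 0 ->
  smooth_at z (fun y => sinr c s (f y)).
Proof. by move=> sf f0; have sc := co_smooth sf f0; rewrite /sinr; smooth. Qed.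

Lemma near_gt0 (f : V -> R) : smooth_at z f -> 0 < f z -> \forall y \near z, 0 < f y.
Proof.
by move=> sf; exact: continuous_near (smooth_at_continuous sf) (@open_gt _ 0).
Qed.

Lemma near_sq_le1 (f : V -> R) : smooth_at z f -> f z = 0 -> \forall y \near z, f y ^+ 2 <= 1.
Proof.
move=> sf f0; have : \forall y \near z, 0 < 1 - f y ^+ 2.
  by apply: near_gt0; [smooth|rewrite f0 expr0n subr0].
by apply: filterS => y; rewrite subr_gt0 => /ltW.
Qed.
End Germ.

(* The point of the sphere with U = C + iS times lK + ijs, and V = C + iS times jK + ils. *)
Definition sph1 C S K s l j : R := C * l * K - S * j * s.
Definition sph2 C S K s l j : R := S * l * K + C * j * s.
Definition sph3 C S K s l j : R := C * j * K - S * l * s.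
Definition sph4 C S K s l j : R := S * j * K + C * l * s.
Definition chart C S K s l j : 'rV[R]_3 :=
  row3 (sph2 C S K s l j / (1 + sph1 C S K s l j)) (sph4 C S K s l j / (1 + sph1 C S K s l j))
       (sph3 C S K s l j / (1 + sph1 C S K s l j)).
Definition radius C S K s l j : R := (l ^+ 2 - j ^+ 2) *
  (100 + 7 * (l ^+ 3 * C * s + j ^+ 3 * S * K) + 3 * (l ^+ 2 - j ^+ 2) * s * K).

Lemma st_chart C S K s l j : C ^+ 2 + S ^+ 2 = 1 -> K ^+ 2 + s ^+ 2 = 1 -> l ^+ 2 + j ^+ 2 = 1 ->
  1 + sph1 C S K s l j != 0 ->
  [/\ st1 (chart C S K s l j) = sph1 C S K s l j, st2 (chart C S K s l j) = sph2 C S K s l j,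
      st3 (chart C S K s l j) = sph3 C S K s l j & st4 (chart C S K s l j) = sph4 C S K s l j].
Proof.
move=> CS Ks lj n0.
have E : sph1 C S K s l j ^+ 2 + sph2 C S K s l j ^+ 2 + sph3 C S K s l j ^+ 2 +
    sph4 C S K s l j ^+ 2 = 1.
  transitivity ((C ^+ 2 + S ^+ 2) * (K ^+ 2 + s ^+ 2) * (l ^+ 2 + j ^+ 2)).
    by rewrite /sph1 /sph2 /sph3 /sph4; ring.
  by rewrite CS Ks lj !mulr1.
have nE : nrm (chart C S K s l j) = 2 / (1 + sph1 C S K s l j).
  rewrite /nrm /chart !row3E !expr_div_n.
  apply: (mulIf (expf_neq0 2 n0)).
  transitivity (1 + 2 * sph1 C S K s l j + (sph1 C S K s l j ^+ 2 + sph2 C S K s l j ^+ 2 +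
    sph3 C S K s l j ^+ 2 + sph4 C S K s l j ^+ 2)); first by field.
  by rewrite E; field.
rewrite /st1 /st2 /st3 /st4 nE /chart !row3E.
by split; field.
Qed.

(** Here U^2 - V^2 = (l^2 - j^2) (C + iS)^2 and Re (U conj V) = l j. So C + iS carries the argument
    of g, j measures the departure from the torus, and K + is moves along the circles of constant
    U^2 - V^2. *)
Lemma hopf_map_chart C S K s l j : C ^+ 2 + S ^+ 2 = 1 -> K ^+ 2 + s ^+ 2 = 1 ->
  l ^+ 2 + j ^+ 2 = 1 -> 1 + sph1 C S K s l j != 0 ->
  hopf_map (chart C S K s l j) =
  row2 (radius C S K s l j * (C ^+ 2 - S ^+ 2)) (radius C S K s l j * (2 * C * S)).
Proof.
move=> CS Ks lj n0; have [E1 E2 E3 E4] := st_chart CS Ks lj n0.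
rewrite /hopf_map E1 E2 E3 E4.
have hE : clif (sph1 C S K s l j) (sph2 C S K s l j) (sph3 C S K s l j) (sph4 C S K s l j) = l * j.
  transitivity (l * j * (C ^+ 2 + S ^+ 2) * (K ^+ 2 + s ^+ 2)).
    by rewrite /clif /sph1 /sph2 /sph3 /sph4; ring.
  by rewrite CS Ks !mulr1.
have wE : weight (sph1 C S K s l j) (sph2 C S K s l j) (sph3 C S K s l j) (sph4 C S K s l j) =
    100 + 7 * (l ^+ 3 * C * s + j ^+ 3 * S * K) + 3 * (l ^+ 2 - j ^+ 2) * s * K.
  rewrite /weight hE.
  (* The correction by [clif] removes the term linear in j. *)
  have -> : sph4 C S K s l j - l * j * sph2 C S K s l j = l ^+ 3 * C * s + j ^+ 3 * S * K.
    transitivity (S * j * K * (1 - l ^+ 2) + C * l * s * (1 - j ^+ 2)).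
      by rewrite /sph4 /sph2; ring.
    have -> : 1 - l ^+ 2 = j ^+ 2 by rewrite -lj; ring.
    have -> : 1 - j ^+ 2 = l ^+ 2 by rewrite -lj; ring.
    ring.
  have -> : sph1 C S K s l j * sph4 C S K s l j - sph2 C S K s l j * sph3 C S K s l j =
      (C ^+ 2 + S ^+ 2) * ((l ^+ 2 - j ^+ 2) * s * K).
    by rewrite /sph1 /sph2 /sph3 /sph4; ring.
  by rewrite CS; ring.
have reE : qre (sph1 C S K s l j) (sph2 C S K s l j) (sph3 C S K s l j) (sph4 C S K s l j) =
    (K ^+ 2 + s ^+ 2) * ((l ^+ 2 - j ^+ 2) * (C ^+ 2 - S ^+ 2)).
  by rewrite /qre /sph1 /sph2 /sph3 /sph4; ring.
have imE : qim (sph1 C S K s l j) (sph2 C S K s l j) (sph3 C S K s l j) (sph4 C S K s l j) =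
    (K ^+ 2 + s ^+ 2) * ((l ^+ 2 - j ^+ 2) * (2 * C * S)).
  by rewrite /qim /sph1 /sph2 /sph3 /sph4; ring.
by rewrite wE reE imE Ks; apply: eq_row2; rewrite !row2E /radius; ring.
Qed.

(** For orthonormal x and y the point [co t] x + t y runs along a great circle, t being the sine of
    the angle; the quotient is one coordinate of its stereographic projection. *)
Lemma derive_great_circle (V : normedModType R) (f : V -> R) (p v : V) (x1 xi y1 yi : R) :
  1 + x1 != 0 ->
  (\forall t \near (0 : R), f (t *: v + p) = (co t * xi + t * yi) / (1 + (co t * x1 + t * y1))) ->
  'D_v f p = (yi * (1 + x1) - xi * y1) / (1 + x1) ^+ 2.
Proof.
move=> n0 H.
have f0 : f p = xi / (1 + x1).
  by have := nbhs_singleton H; rewrite scale0r add0r co0 !mul0r !mul1r !addr0.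
have sid : smooth_at (0 : R^o) (fun t : R^o => t : R) by exact: smooth_at_id.
have sc : smooth_at (0 : R^o) (fun t : R^o => co t) by apply: (co_smooth sid).
have n1 : 1 + (co 0 * x1 + 0 * y1) != 0 by rewrite co0 mul0r mul1r addr0.
(* The difference quotient, made regular at t = 0 by 1 - [co t] = t^2 / (1 + [co t]). *)
pose k (t : R) := (yi * (1 + x1) - xi * y1 - xi * t / (1 + co t)) /
  ((1 + x1) * (1 + (co t * x1 + t * y1))).
have -> : (yi * (1 + x1) - xi * y1) / (1 + x1) ^+ 2 = k 0.
  by rewrite /k co0 mulr0 !mul0r mul1r addr0 subr0 expr2.
apply: derive_axis.
  apply: (@smooth_at_continuous _ R^o R^o); rewrite /k; smooth.
    by rewrite co0 gt_eqF.
  by rewrite mulf_neq0.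
have nn : \forall t \near (0 : R^o), 1 + (co t * x1 + t * y1) != 0.
  have sm : smooth_at (0 : R^o) (fun t : R^o => 1 + (co t * x1 + t * y1)) by smooth.
  exact: continuous_near (smooth_at_continuous sm) (@open_neq _ 0) n1.
near=> t.
have -> : f (t *: v + p) = (co t * xi + t * yi) / (1 + (co t * x1 + t * y1)) by near: t.
have nt : 1 + (co t * x1 + t * y1) != 0 by near: t; exact: nn.
have ct : co t ^+ 2 = 1 - t ^+ 2.
  by apply: co_sq; near: t; exact: near_sq_le1 sid _.
have c1 : 1 + co t != 0 by rewrite gt_eqF // ltr_pwDl // sqrtr_ge0.
rewrite f0 /k; apply/eqP; rewrite -subr_eq0; apply/eqP.
transitivity (xi * (co t ^+ 2 - (1 - t ^+ 2)) / ((1 + co t) * (1 + x1) * (1 + (co t * x1 + t * y1)))).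
  by field; rewrite nt n0 c1.
by rewrite ct subrr mulr0 mul0r.
Unshelve. all: by end_near. Qed.

End Chart.

Section LocalCoordinates.
Context {R : realType}.
Implicit Types (q : 'rV[R]_3).

Lemma axis3_0 (t : R) : t *: 'e_0 + 0 = row3 t 0 0.
Proof. by apply: eq_row3; rewrite row3E !mxE /= ?mulr1 ?mulr0 addr0. Qed.
Lemma axis3_1 (t : R) : t *: 'e_1 + 0 = row3 0 t 0.
Proof. by apply: eq_row3; rewrite row3E !mxE /= ?mulr1 ?mulr0 addr0. Qed.
Lemma axis3_2 (t : R) : t *: 'e_2%R + 0 = row3 0 0 t.
Proof. by apply: eq_row3; rewrite row3E !mxE /= ?mulr1 ?mulr0 addr0. Qed.
Lemma row3_000 : row3 0 0 0 = 0 :> 'rV[R]_3.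
Proof. by apply: eq_row3; rewrite row3E mxE. Qed.
Lemma row2_00 : row2 0 0 = 0 :> 'rV[R]_2.
Proof. by apply: eq_row2; rewrite row2E mxE. Qed.

Lemma jacobian_coord n m (f : 'rV[R]_n -> 'rV[R]_m) p i j : smooth_at p f ->
  'J f p i j = 'D_('e_i) (fun x => f x 0 j) p.
Proof.
move=> /smooth_at_differentiable df.
by rewrite jacobianE // derive_mx ?mxE //; exact: diff_derivable.
Qed.

Definition base_chart (C0 S0 K0 s0 : R) q : 'rV[R]_3 :=
  chart (cosr C0 S0 (q 0 0)) (sinr C0 S0 (q 0 0)) (cosr K0 s0 (q 0 1)) (sinr K0 s0 (q 0 1))
    (co (q 0 2%R)) (q 0 2%R).

Section Base.
Variables C0 S0 K0 s0 : R.
Hypotheses (CS : C0 ^+ 2 + S0 ^+ 2 = 1) (Ks : K0 ^+ 2 + s0 ^+ 2 = 1).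
Hypothesis n0 : 1 + C0 * K0 != 0.

Lemma base_chart_smooth : smooth_at 0 (base_chart C0 S0 K0 s0).
Proof.
have c0 : smooth_at 0 (fun q => q 0 0) by smooth.
have c1 : smooth_at 0 (fun q => q 0 1) by smooth.
have c2 : smooth_at 0 (fun q => q 0 2%R) by smooth.
have z j : (0 : 'rV[R]_3) 0 j = 0 by rewrite mxE.
have s1 := cosr_smooth C0 S0 c0 (z 0); have s2 := sinr_smooth C0 S0 c0 (z 0).
have s3 := cosr_smooth K0 s0 c1 (z 1); have s4 := sinr_smooth K0 s0 c1 (z 1).
have s5 := co_smooth c2 (z 2%R).
have d0 : 1 + sph1 (cosr C0 S0 ((0 : 'rV[R]_3) 0 0)) (sinr C0 S0 ((0 : 'rV[R]_3) 0 0))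
    (cosr K0 s0 ((0 : 'rV[R]_3) 0 1)) (sinr K0 s0 ((0 : 'rV[R]_3) 0 1))
    (co ((0 : 'rV[R]_3) 0 2%R)) ((0 : 'rV[R]_3) 0 2%R) != 0.
  by rewrite !z !cosr0 !sinr0 co0 /sph1 mulr0 mul0r subr0 mulr1.
by apply: smooth_at_row3; rewrite /sph2 /sph3 /sph4 /sph1; smooth.
Qed.

Lemma base_chart_derive (i : 'I_3) (a : R -> 'rV[R]_3) (x y : 'I_3 -> R) (y1 : R) :
  (forall t, t *: 'e_i + 0 = a t) ->
  (forall t j, base_chart C0 S0 K0 s0 (a t) 0 j =
    (co t * x j + t * y j) / (1 + (co t * (C0 * K0) + t * y1))) ->
  forall j, 'J (base_chart C0 S0 K0 s0) 0 i j =
    (y j * (1 + C0 * K0) - x j * y1) / (1 + C0 * K0) ^+ 2.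
Proof.
move=> aE H j; rewrite jacobian_coord; last exact: base_chart_smooth.
by apply: derive_great_circle => //; near=> t; rewrite aE H.
Unshelve. all: by end_near. Qed.

Definition trip (u v w : R) (j : 'I_3) : R := row3 u v w 0 j.

(** The coordinate axes go to great circles with orthonormal velocities in R^4, and [W1] to [W4] are
    the coordinates of a combination of these. If the projection kills it, it lies on the projecting
    line, so tangency makes it zero and orthonormality then gives v = 0. *)
Lemma base_chart_local_diffeo : local_diffeo 0 (base_chart C0 S0 K0 s0).
Proof.
apply: inverse_function; first exact: base_chart_smooth.
pose X := trip (S0 * K0) (C0 * s0) (- S0 * s0).
rewrite -row_free_unit; apply: inj_row_free => v vJ.
have E j : v 0 0 * 'J (base_chart C0 S0 K0 s0) 0 0 j + v 0 1 * 'J (base_chart C0 S0 K0 s0) 0 1 j +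
    v 0 2%R * 'J (base_chart C0 S0 K0 s0) 0 2%R j = 0.
  by have := congr1 (fun M : 'rV[R]_3 => M 0 j) vJ; rewrite mxE sum_ord3 [RHS]mxE.
have H0 j : 'J (base_chart C0 S0 K0 s0) 0 0 j =
    ((trip (C0 * K0) (- S0 * s0) (- C0 * s0)) j * (1 + C0 * K0) - X j * (- S0 * K0)) / (1 + C0 * K0) ^+ 2.
  apply: (@base_chart_derive 0 (fun t => row3 t 0 0) X (trip (C0 * K0) (- S0 * s0) (- C0 * s0)) (- S0 * K0) axis3_0) => t.
  by apply: ord3P; rewrite /base_chart /chart !row3E /X /trip !row3E
    /sph1 /sph2 /sph3 /sph4 /cosr /sinr co0 ?mulr0 ?mulr1 ?subr0 ?addr0; congr (_ / (1 + _)); ring.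
have H1 j : 'J (base_chart C0 S0 K0 s0) 0 1 j =
    ((trip (- S0 * s0) (C0 * K0) (- S0 * K0)) j * (1 + C0 * K0) - X j * (- C0 * s0)) / (1 + C0 * K0) ^+ 2.
  apply: (@base_chart_derive 1 (fun t => row3 0 t 0) X (trip (- S0 * s0) (C0 * K0) (- S0 * K0)) (- C0 * s0) axis3_1) => t.
  by apply: ord3P; rewrite /base_chart /chart !row3E /X /trip !row3E
    /sph1 /sph2 /sph3 /sph4 /cosr /sinr co0 ?mulr0 ?mulr1 ?subr0 ?addr0; congr (_ / (1 + _)); ring.
have H2 j : 'J (base_chart C0 S0 K0 s0) 0 2%R j =
    ((trip (C0 * s0) (S0 * K0) (C0 * K0)) j * (1 + C0 * K0) - X j * (- S0 * s0)) / (1 + C0 * K0) ^+ 2.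
  apply: (@base_chart_derive 2%R (fun t => row3 0 0 t) X (trip (C0 * s0) (S0 * K0) (C0 * K0)) (- S0 * s0) axis3_2) => t.
  by apply: ord3P; rewrite /base_chart /chart !row3E /X /trip !row3E
    /sph1 /sph2 /sph3 /sph4 /cosr /sinr co0 ?mulr0 ?mulr1 ?subr0 ?addr0; congr (_ / (1 + _)); ring.
pose W1 := v 0 0 * (- S0 * K0) + v 0 1 * (- C0 * s0) + v 0 2%R * (- S0 * s0).
pose W2 := v 0 0 * (C0 * K0) + v 0 1 * (- S0 * s0) + v 0 2%R * (C0 * s0).
pose W4 := v 0 0 * (- S0 * s0) + v 0 1 * (C0 * K0) + v 0 2%R * (S0 * K0).
pose W3 := v 0 0 * (- C0 * s0) + v 0 1 * (- S0 * K0) + v 0 2%R * (C0 * K0).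
have nn : (1 + C0 * K0) ^+ 2 != 0 by rewrite expf_neq0.
have E2 : W2 * (1 + C0 * K0) = S0 * K0 * W1.
  have := E 0; rewrite H0 H1 H2 /X /trip !row3E => EE.
  apply/eqP; rewrite -subr_eq0; apply/eqP; apply: (mulIf (invr_neq0 nn)); rewrite mul0r -[RHS]EE.
  by rewrite /W1 /W2; ring.
have E4 : W4 * (1 + C0 * K0) = C0 * s0 * W1.
  have := E 1; rewrite H0 H1 H2 /X /trip !row3E => EE.
  apply/eqP; rewrite -subr_eq0; apply/eqP; apply: (mulIf (invr_neq0 nn)); rewrite mul0r -[RHS]EE.
  by rewrite /W1 /W4; ring.
have E3 : W3 * (1 + C0 * K0) = - S0 * s0 * W1.
  have := E 2%R; rewrite H0 H1 H2 /X /trip !row3E => EE.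
  apply/eqP; rewrite -subr_eq0; apply/eqP; apply: (mulIf (invr_neq0 nn)); rewrite mul0r -[RHS]EE.
  by rewrite /W1 /W3; ring.
have T : C0 * K0 * W1 + S0 * K0 * W2 - S0 * s0 * W3 + C0 * s0 * W4 = 0.
  by rewrite /W1 /W2 /W3 /W4; ring.
have E1 : W1 = 0.
  apply: (mulIf n0); rewrite mul0r.
  transitivity ((1 + C0 * K0) * (C0 * K0 * W1 + S0 * K0 * W2 - S0 * s0 * W3 + C0 * s0 * W4)
    + W1 * (1 - (C0 ^+ 2 + S0 ^+ 2) * (K0 ^+ 2 + s0 ^+ 2))
    - S0 * K0 * (W2 * (1 + C0 * K0) - S0 * K0 * W1) + S0 * s0 * (W3 * (1 + C0 * K0) + S0 * s0 * W1)
    - C0 * s0 * (W4 * (1 + C0 * K0) - C0 * s0 * W1)); first ring.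
  by rewrite T CS Ks E2 E3 E4; ring.
have F2 : W2 = 0 by apply: (mulIf n0); rewrite E2 E1 mulr0 mul0r.
have F3 : W3 = 0 by apply: (mulIf n0); rewrite E3 E1 mulr0 mul0r.
have F4 : W4 = 0 by apply: (mulIf n0); rewrite E4 E1 mulr0 mul0r.
apply: eq_row3; rewrite mxE.
- transitivity (- S0 * K0 * W1 + C0 * K0 * W2 - C0 * s0 * W3 - S0 * s0 * W4).
    transitivity (v 0 0 * (C0 ^+ 2 + S0 ^+ 2) * (K0 ^+ 2 + s0 ^+ 2)); first by rewrite CS Ks !mulr1.
    by rewrite /W1 /W2 /W3 /W4; ring.
  by rewrite E1 F2 F3 F4; ring.
- transitivity (- C0 * s0 * W1 - S0 * s0 * W2 - S0 * K0 * W3 + C0 * K0 * W4).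
    transitivity (v 0 1 * (C0 ^+ 2 + S0 ^+ 2) * (K0 ^+ 2 + s0 ^+ 2)); first by rewrite CS Ks !mulr1.
    by rewrite /W1 /W2 /W3 /W4; ring.
  by rewrite E1 F2 F3 F4; ring.
- transitivity (- S0 * s0 * W1 + C0 * s0 * W2 + C0 * K0 * W3 + S0 * K0 * W4).
    transitivity (v 0 2%R * (C0 ^+ 2 + S0 ^+ 2) * (K0 ^+ 2 + s0 ^+ 2)); first by rewrite CS Ks !mulr1.
    by rewrite /W1 /W2 /W3 /W4; ring.
  by rewrite E1 F2 F3 F4; ring.
Qed.

End Base.

End LocalCoordinates.

(** * Local diffeomorphisms with triangular Jacobian, and polar coordinates *)

Section TriangularMaps.
Context {R : realType}.
Implicit Types (q : 'rV[R]_3).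

Lemma derive_coord n (p v : 'rV[R]_n) j : 'D_v (fun x : 'rV[R]_n => x 0 j) p = v 0 j.
Proof.
have dI : derivable (fun y : 'rV[R]_n => y) p v by exact: derivable_id.
by have := derive_mx dI; rewrite derive_id => /(congr1 (fun M : 'rV[R]_n => M 0 j)); rewrite !mxE => <-.
Qed.

Lemma local_diffeo_replace n (i : 'I_n) (b : 'rV[R]_n -> R) (p : 'rV[R]_n) :
  smooth_at p b -> 'D_('e_i) b p != 0 ->
  local_diffeo p (fun x => \row_j (if j == i then b x else x 0 j)).
Proof.
move=> sb b0; set f := fun x => _.
have fi : (fun x => f x 0 i) = b by apply/funext => x; rewrite mxE eqxx.
have fj j : j != i -> (fun x => f x 0 j) = (fun x => x 0 j).
  by move=> ji; apply/funext => x; rewrite mxE (negPf ji).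
have sf : smooth_at p f.
  apply: smooth_at_row => j; have [->|ji] := eqVneq j i; first by rewrite fi.
  by rewrite fj //; exact: (smooth_at_coord j (smooth_at_id _)).
apply: inverse_function => //; rewrite -row_free_unit; apply: inj_row_free => v vJ.
have E j : \sum_k v 0 k * 'D_('e_k) (fun x => f x 0 j) p = 0.
  transitivity ((v *m 'J f p) 0 j); last by rewrite vJ mxE.
  by rewrite mxE; apply: eq_bigr => k _; rewrite jacobian_coord.
have vj j : j != i -> v 0 j = 0.
  move=> ji; have := E j; rewrite fj // (bigD1 j) //= derive_coord mxE !eqxx mulr1 big1 ?addr0 //.
  by move=> k kj; rewrite derive_coord mxE eqxx eq_sym (negPf kj) mulr0.
apply/rowP => j; rewrite [RHS]mxE; have [->|/vj//] := eqVneq j i.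
have := E i; rewrite fi (bigD1 i) //= big1 ?addr0.
  by move=> /eqP; rewrite mulf_eq0 (negPf b0) orbF => /eqP.
by move=> k /vj ->; rewrite mul0r.
Qed.

Lemma local_diffeo_replace3 (b : 'rV[R]_3 -> R) (k : R -> R) :
  smooth_at 0 b -> smooth_at (0 : R^o) (k : R^o -> R) -> k 0 != 0 ->
  (\forall t \near (0 : R), b (row3 0 t 0) = b 0 + t * k t) ->
  local_diffeo 0 (fun q => row3 (q 0 0) (b q) (q 0 2%R)).
Proof.
move=> sb sk k0 H.
rewrite (_ : (fun q => _) = (fun x => \row_j (if j == 1 then b x else x 0 j))).
  apply: local_diffeo_replace => //.
  rewrite (derive_axis (c := k)) //; first exact: (@smooth_at_continuous _ R^o R^o).
  by apply: filterS H => t; rewrite axis3_1.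
by apply/funext => q; apply: eq_row3; rewrite row3E mxE.
Qed.

Lemma local_diffeo_replace2 (b : 'rV[R]_2 -> R) (k : R -> R) :
  smooth_at 0 b -> smooth_at (0 : R^o) (k : R^o -> R) -> k 0 != 0 ->
  (\forall t \near (0 : R), b (row2 0 t) = b 0 + t * k t) ->
  local_diffeo 0 (fun u : 'rV[R]_2 => row2 (u 0 0) (b u)).
Proof.
move=> sb sk k0 H.
rewrite (_ : (fun u => _) = (fun x => \row_j (if j == 1 then b x else x 0 j))).
  apply: local_diffeo_replace => //.
  rewrite (derive_axis (c := k)) //; first exact: (@smooth_at_continuous _ R^o R^o).
  apply: filterS H => t <-; congr b.
  by apply: eq_row2; rewrite row2E !mxE /= ?mulr1 ?mulr0 addr0.
by apply/funext => u; apply: eq_row2; rewrite row2E mxE.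
Qed.

Lemma local_diffeo_triangular3 (f : 'rV[R]_3 -> 'rV[R]_3) (k0 k1 k2 : R -> R) :
  smooth_at 0 f ->
  smooth_at (0 : R^o) (k0 : R^o -> R) -> smooth_at (0 : R^o) (k1 : R^o -> R) ->
  smooth_at (0 : R^o) (k2 : R^o -> R) -> k0 0 != 0 -> k1 0 != 0 -> k2 0 != 0 ->
  (\forall t \near (0 : R), f (row3 t 0 0) = row3 (f 0 0 0 + t * k0 t) (f 0 0 1) (f 0 0 2%R)) ->
  (\forall t \near (0 : R), f (row3 0 t 0) 0 1 = f 0 0 1 + t * k1 t /\
    f (row3 0 t 0) 0 2%R = f 0 0 2%R) ->
  (\forall t \near (0 : R), f (row3 0 0 t) 0 2%R = f 0 0 2%R + t * k2 t) ->
  local_diffeo 0 f.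
Proof.
move=> sf sk0 sk1 sk2 k00 k10 k20 H0 H1 H2.
have c0 : {for 0, continuous k0} by exact: (@smooth_at_continuous _ R^o R^o).
have c1 : {for 0, continuous k1} by exact: (@smooth_at_continuous _ R^o R^o).
have c2 : {for 0, continuous k2} by exact: (@smooth_at_continuous _ R^o R^o).
have cz : {for (0 : R), continuous (fun _ : R => 0 : R)} by exact: cst_continuous.
have D01 : 'D_('e_0) (fun x => f x 0 1) 0 = 0.
  by apply: (derive_axis cz); apply: filterS H0 => t; rewrite axis3_0 mulr0 addr0 => ->; rewrite row3E.
have D02 : 'D_('e_0) (fun x => f x 0 2%R) 0 = 0.
  by apply: (derive_axis cz); apply: filterS H0 => t; rewrite axis3_0 mulr0 addr0 => ->; rewrite row3E.
have D12 : 'D_('e_1) (fun x => f x 0 2%R) 0 = 0.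
  by apply: (derive_axis cz); apply: filterS H1 => t; rewrite axis3_1 mulr0 addr0 => -[].
have D00 : 'D_('e_0) (fun x => f x 0 0) 0 = k0 0.
  by apply: (derive_axis c0); apply: filterS H0 => t; rewrite axis3_0 => ->; rewrite row3E.
have D11 : 'D_('e_1) (fun x => f x 0 1) 0 = k1 0.
  by apply: (derive_axis c1); apply: filterS H1 => t; rewrite axis3_1 => -[].
have D22 : 'D_('e_2%R) (fun x => f x 0 2%R) 0 = k2 0.
  by apply: (derive_axis c2); apply: filterS H2 => t; rewrite axis3_2.
apply: inverse_function => //; apply: jacobian_unit_trig.
- exact: smooth_at_differentiable.
- by apply: ord3P; apply: ord3P.
- by apply: ord3P; rewrite ?D00 ?D11 ?D22.
Qed.

Lemma local_diffeo_triangular2 (f : 'rV[R]_2 -> 'rV[R]_2) (k0 k1 : R -> R) :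
  smooth_at 0 f ->
  smooth_at (0 : R^o) (k0 : R^o -> R) -> smooth_at (0 : R^o) (k1 : R^o -> R) ->
  k0 0 != 0 -> k1 0 != 0 ->
  (\forall t \near (0 : R), f (row2 t 0) = row2 (f 0 0 0 + t * k0 t) (f 0 0 1)) ->
  (\forall t \near (0 : R), f (row2 0 t) 0 1 = f 0 0 1 + t * k1 t) ->
  local_diffeo 0 f.
Proof.
move=> sf sk0 sk1 k00 k10 H0 H1.
have c0 : {for 0, continuous k0} by exact: (@smooth_at_continuous _ R^o R^o).
have c1 : {for 0, continuous k1} by exact: (@smooth_at_continuous _ R^o R^o).
have cz : {for (0 : R), continuous (fun _ : R => 0 : R)} by exact: cst_continuous.
have A0 t : t *: 'e_0 + 0 = row2 t 0 :> 'rV[R]_2.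
  by apply: eq_row2; rewrite row2E !mxE /= ?mulr1 ?mulr0 addr0.
have A1 t : t *: 'e_1 + 0 = row2 0 t :> 'rV[R]_2.
  by apply: eq_row2; rewrite row2E !mxE /= ?mulr1 ?mulr0 addr0.
have D01 : 'D_('e_0) (fun x => f x 0 1) 0 = 0.
  by apply: (derive_axis cz); apply: filterS H0 => t; rewrite A0 mulr0 addr0 => ->; rewrite row2E.
have D00 : 'D_('e_0) (fun x => f x 0 0) 0 = k0 0.
  by apply: (derive_axis c0); apply: filterS H0 => t; rewrite A0 => ->; rewrite row2E.
have D11 : 'D_('e_1) (fun x => f x 0 1) 0 = k1 0.
  by apply: (derive_axis c1); apply: filterS H1 => t; rewrite A1.
apply: inverse_function => //; apply: jacobian_unit_trig.
- exact: smooth_at_differentiable.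
- by apply: ord2P; apply: ord2P.
- by apply: ord2P; rewrite ?D00 ?D11.
Qed.

(** Polar coordinates with doubled angle: u_1 times the square of C0 + i S0 turned by arcsin u_0. *)
Definition polar (C0 S0 : R) (u : 'rV[R]_2) : 'rV[R]_2 :=
  row2 (u 0 1 * (cosr C0 S0 (u 0 0) ^+ 2 - sinr C0 S0 (u 0 0) ^+ 2))
       (u 0 1 * (2 * cosr C0 S0 (u 0 0) * sinr C0 S0 (u 0 0))).

Lemma polar_local_diffeo C0 S0 (r0 : R) : C0 ^+ 2 + S0 ^+ 2 = 1 -> r0 != 0 ->
  local_diffeo (row2 0 r0) (polar C0 S0).
Proof.
move=> CS rn0; set p := row2 0 r0.
have p0 : p 0 0 = 0 by rewrite row2E.
have c0 : smooth_at p (fun q : 'rV[R]_2 => q 0 0) by smooth.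
have c1 : smooth_at p (fun q : 'rV[R]_2 => q 0 1) by smooth.
have s1 := cosr_smooth C0 S0 c0 p0; have s2 := sinr_smooth C0 S0 c0 p0.
have sp : smooth_at p (polar C0 S0) by apply: smooth_at_row2; smooth.
pose c2 := C0 ^+ 2 - S0 ^+ 2; pose d2 := 2 * C0 * S0.
have A0 t : t *: 'e_0 + p = row2 t r0 :> 'rV[R]_2.
  by apply: eq_row2; rewrite row2E !mxE /= ?mulr1 ?mulr0 ?addr0 ?add0r.
have A1 t : t *: 'e_1 + p = row2 0 (r0 + t) :> 'rV[R]_2.
  by apply: eq_row2; rewrite row2E !mxE /= ?mulr1 ?mulr0 ?addr0 // addrC.
have sid : smooth_at (0 : R^o) (fun t : R^o => t : R) by exact: smooth_at_id.
have sco : smooth_at (0 : R^o) (fun t : R^o => co t) by apply: (co_smooth sid).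
have nco : \forall t \near (0 : R), co t ^+ 2 = 1 - t ^+ 2.
  by apply: filterS (near_sq_le1 sid erefl) => t; exact: co_sq.
have J00 : 'D_('e_0) (fun x => polar C0 S0 x 0 0) p = - (2 * r0 * d2).
  rewrite (derive_axis (c := fun t => r0 * (- (2 * t * c2) - 2 * d2 * co t))).
  - by rewrite co0 mulr0 mul0r; ring.
  - by apply: (@smooth_at_continuous _ R^o R^o); smooth.
  apply: filterS nco => t ct; rewrite A0 /polar !row2E /cosr /sinr co0.
  apply/eqP; rewrite -subr_eq0; apply/eqP.
  transitivity (r0 * c2 * (co t ^+ 2 - (1 - t ^+ 2))); first by rewrite /c2 /d2; ring.
  by rewrite ct subrr mulr0.
have J01 : 'D_('e_0) (fun x => polar C0 S0 x 0 1) p = 2 * r0 * c2.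
  rewrite (derive_axis (c := fun t => r0 * (- (2 * t * d2) + 2 * c2 * co t))).
  - by rewrite co0 mulr0 mul0r; ring.
  - by apply: (@smooth_at_continuous _ R^o R^o); smooth.
  apply: filterS nco => t ct; rewrite A0 /polar !row2E /cosr /sinr co0.
  apply/eqP; rewrite -subr_eq0; apply/eqP.
  transitivity (r0 * d2 * (co t ^+ 2 - (1 - t ^+ 2))); first by rewrite /c2 /d2; ring.
  by rewrite ct subrr mulr0.
have J10 : 'D_('e_1) (fun x => polar C0 S0 x 0 0) p = c2.
  rewrite (derive_axis (c := fun=> c2)) //; first exact: cst_continuous.
  by near=> t; rewrite A1 /polar !row2E cosr0 sinr0 /c2; ring.
have J11 : 'D_('e_1) (fun x => polar C0 S0 x 0 1) p = d2.
  rewrite (derive_axis (c := fun=> d2)) //; first exact: cst_continuous.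
  by near=> t; rewrite A1 /polar !row2E cosr0 sinr0 /d2; ring.
have cd : c2 ^+ 2 + d2 ^+ 2 = 1.
  transitivity ((C0 ^+ 2 + S0 ^+ 2) ^+ 2); last by rewrite CS expr1n.
  by rewrite /c2 /d2; ring.
apply: inverse_function => //; rewrite -row_free_unit; apply: inj_row_free => v vJ.
have E j : v 0 0 * 'J (polar C0 S0) p 0 j + v 0 1 * 'J (polar C0 S0) p 1 j = 0.
  by have := congr1 (fun M : 'rV[R]_2 => M 0 j) vJ; rewrite mxE sum_ord2 [RHS]mxE.
have := E 0; have := E 1; rewrite !jacobian_coord // J00 J01 J10 J11 => H1 H0.
apply: eq_row2; rewrite [RHS]mxE.
  have r2 : 2 * r0 != 0 by rewrite mulf_neq0.
  apply: (mulIf r2); rewrite mul0r.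
  transitivity (c2 * (v 0 0 * (2 * r0 * c2) + v 0 1 * d2) -
    d2 * (v 0 0 * - (2 * r0 * d2) + v 0 1 * c2)); last by rewrite H0 H1; ring.
  by rewrite -[LHS]mulr1 -cd; ring.
transitivity (d2 * (v 0 0 * (2 * r0 * c2) + v 0 1 * d2) +
    c2 * (v 0 0 * - (2 * r0 * d2) + v 0 1 * c2)); last by rewrite H0 H1; ring.
by rewrite -[LHS]mulr1 -cd; ring.
Unshelve. all: by end_near. Qed.

Lemma polar_target C0 S0 (rho : 'rV[R]_2 -> R) (k : R -> R) : C0 ^+ 2 + S0 ^+ 2 = 1 ->
  smooth_at 0 rho -> rho 0 != 0 -> smooth_at (0 : R^o) (k : R^o -> R) -> k 0 != 0 ->
  (\forall t \near (0 : R), rho (row2 0 t) = rho 0 + t * k t) ->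
  local_diffeo 0 (fun u : 'rV[R]_2 => polar C0 S0 (row2 (u 0 0) (rho u))).
Proof.
move=> CS sr r0 sk k0 H.
apply: (@local_diffeo_comp _ _ _ (fun u : 'rV[R]_2 => row2 (u 0 0) (rho u))).
  exact: local_diffeo_replace2 H.
by rewrite mxE; exact: polar_local_diffeo.
Qed.

End TriangularMaps.

(** * Fold points *)

Section Radius.
Context {R : realType}.
Implicit Types (C S K s l j : R).

(* radius = 100 + s (7 C + 3 K) - j^2 bump: the Clifford torus j = 0 is a nondegenerate
   maximum of the radius in the normal direction. *)
Definition bump C S K s l j : R :=
  2 * (100 + 7 * (l ^+ 3 * C * s + j ^+ 3 * S * K) + 3 * (l ^+ 2 - j ^+ 2) * s * K)
  + 7 * C * s * (1 + l + l ^+ 2) / (1 + l) - 7 * j * S * K + 6 * s * K.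

Lemma radiusE C S K s l j : l ^+ 2 + j ^+ 2 = 1 -> 0 <= l ->
  radius C S K s l j = 100 + s * (7 * C + 3 * K) - j ^+ 2 * bump C S K s l j.
Proof.
move=> lj l0; have l1 : 1 + l != 0 by rewrite gt_eqF // ltr_pwDl.
have -> : j ^+ 2 * bump C S K s l j = j ^+ 2 * (2 * (100 + 7 * (l ^+ 3 * C * s + j ^+ 3 * S * K) +
    3 * (l ^+ 2 - j ^+ 2) * s * K) - 7 * j * S * K + 6 * s * K) +
    7 * C * s * (j ^+ 2 * (1 + l + l ^+ 2) / (1 + l)) by rewrite /bump; ring.
(* The factor 1 - l of 1 - l^3 is j^2 / (1 + l), which exhibits the divisibility by j^2. *)
have -> : j ^+ 2 * (1 + l + l ^+ 2) / (1 + l) = 1 - l ^+ 3.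
  have -> : j ^+ 2 = (1 - l) * (1 + l) by rewrite (_ : j ^+ 2 = 1 - l ^+ 2); [ring|rewrite -lj; ring].
  by field.
have l2 : l ^+ 2 = 1 - j ^+ 2 by rewrite -lj; ring.
by rewrite /radius l2; ring.
Qed.

Lemma bump_gt0 C S K s : C ^+ 2 + S ^+ 2 = 1 -> K ^+ 2 + s ^+ 2 = 1 -> 0 < bump C S K s 1 0.
Proof.
move=> CS Ks.
have H (u v : R) : -1 <= u <= 1 -> -1 <= v <= 1 -> -1 <= u * v <= 1 by move=> /andP[? ?] /andP[? ?]; apply/andP; split; nra.
have C1 : -1 <= C <= 1 by have := sqr_ge0 S; nra.
have K1 : -1 <= K <= 1 by have := sqr_ge0 s; nra.
have s1 : -1 <= s <= 1 by have := sqr_ge0 K; nra.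
have /andP[Cs1 Cs2] := H _ _ C1 s1; have /andP[sK1 sK2] := H _ _ s1 K1.
have -> : bump C S K s 1 0 = 200 + 49 / 2 * (C * s) + 12 * (s * K) by rewrite /bump; field.
lra.
Qed.

End Radius.

Section Fold.
Context {R : realType}.
Implicit Types (q : 'rV[R]_3).
Variables (C0 S0 K0 s0 : R) (sb : bool).
Let sg : R := (-1) ^+ sb.
Hypotheses (CS : C0 ^+ 2 + S0 ^+ 2 = 1) (Ks : K0 ^+ 2 + s0 ^+ 2 = 1) (K0_gt0 : 0 < K0).
Hypotheses (crit : 6 * K0 ^+ 2 + 7 * C0 * K0 - 3 = 0) (n0 : 1 + C0 * K0 != 0).
Hypothesis sg_s0 : 0 < sg * s0.

Let sg2 : sg * sg = 1. Proof. by rewrite -expr2 sqrr_sign. Qed.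

(* (Kc, sc) is the critical point of s (7 C + 3 K) on the circle K^2 + s^2 = 1, for fixed C. *)
Definition Kc (C : R) : R := (- (7 * C) + Num.sqrt (49 * C ^+ 2 + 72)) / 12.
Definition sc (C : R) : R := sg * Num.sqrt (1 - Kc C ^+ 2).

Lemma Kc_arg_gt0 (C : R) : 0 < 49 * C ^+ 2 + 72.
Proof. by have := sqr_ge0 C; lra. Qed.

Lemma Kc_crit (C : R) : 6 * Kc C ^+ 2 + 7 * C * Kc C - 3 = 0.
Proof.
have E : Num.sqrt (49 * C ^+ 2 + 72) ^+ 2 = 49 * C ^+ 2 + 72 by rewrite sqr_sqrtr // ltW // Kc_arg_gt0.
rewrite /Kc; set r := Num.sqrt _ in E *.
transitivity ((r ^+ 2 - (49 * C ^+ 2 + 72)) / 24); first by field.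
by rewrite E subrr mul0r.
Qed.

Lemma Kc_gt0 (C : R) : 0 < Kc C.
Proof.
have : `|7 * C| < Num.sqrt (49 * C ^+ 2 + 72).
  rewrite -sqrtr_sqr ltr_sqrt ?Kc_arg_gt0 //; have := sqr_ge0 C; lra.
by rewrite ltr_norml /Kc => /andP[_ H]; lra.
Qed.

(** The roots of the quadratic have product -1/2, so the root other than K0 is negative. *)
Lemma Kc0 : Kc C0 = K0.
Proof.
have H : (Kc C0 - K0) * (6 * Kc C0 + 3 / K0) = 0.
  have E : 7 * C0 = (3 - 6 * K0 ^+ 2) / K0.
    by apply: (mulIf (lt0r_neq0 K0_gt0)); rewrite divfK ?lt0r_neq0 //; apply/eqP; rewrite -subr_eq0; apply/eqP; rewrite -[RHS]crit; ring.
  have K0' := lt0r_neq0 K0_gt0.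
  rewrite -[RHS](Kc_crit C0) E; field.
  by rewrite K0'.
move: H => /eqP; rewrite mulf_eq0 subr_eq0 => /orP[/eqP //|].
have h1 := Kc_gt0 C0; have h2 : 0 < K0^-1 by rewrite invr_gt0.
by rewrite gt_eqF // addr_gt0 // mulr_gt0.
Qed.

Lemma s0_neq0 : s0 != 0.
Proof. by apply/eqP => s00; move: sg_s0; rewrite s00 mulr0 ltxx. Qed.

Lemma sc_arg0 : 1 - Kc C0 ^+ 2 = s0 ^+ 2.
Proof. by rewrite Kc0 -Ks; ring. Qed.

Lemma sc0 : sc C0 = s0.
Proof.
rewrite /sc sc_arg0 sqrtr_sqr.
have -> : `|s0| = sg * s0.
  rewrite -(gtr0_norm sg_s0) normrM /sg normrX normrN1 expr1n mul1r //.
by rewrite mulrA sg2 mul1r.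
Qed.

(* In these coordinates (K, s) is (Kc, sc) rotated by twice the arcsine of q 0 1, which turns the
   height difference into q 0 1 ^+ 2 times a nonvanishing function. *)
Definition fC q := cosr C0 S0 (q 0 0).
Definition fS q := sinr C0 S0 (q 0 0).
Definition fK q := Kc (fC q) * (1 - 2 * q 0 1 ^+ 2) - sc (fC q) * (2 * q 0 1 * co (q 0 1)).
Definition fs q := sc (fC q) * (1 - 2 * q 0 1 ^+ 2) + Kc (fC q) * (2 * q 0 1 * co (q 0 1)).
Definition fl q := co (q 0 2%R).
Definition fA q := sg * 6 * (2 * q 0 1 * co (q 0 1) * (2 * Kc (fC q) ^+ 2 - 1) +
  sc (fC q) * ((Kc (fC q))^-1 - 2 * Kc (fC q) + 4 * co (q 0 1) ^+ 2 * Kc (fC q))).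
Definition fB q := bump (fC q) (fS q) (fK q) (fs q) (fl q) (q 0 2%R).
Definition fE q := chart (fC q) (fS q) (fK q) (fs q) (fl q) (q 0 2%R).
Definition fPhi q := row3 (q 0 0) (q 0 1 * Num.sqrt (fA q)) (q 0 2%R * Num.sqrt (fB q)).
Definition frho (u : 'rV[R]_2) := let C := cosr C0 S0 (u 0 0) in
  100 + sc C * (7 * C + 3 * Kc C) - sg * u 0 1.

Lemma z3 j : (0 : 'rV[R]_3) 0 j = 0. Proof. by rewrite mxE. Qed.

Lemma fC0 : fC 0 = C0. Proof. by rewrite /fC z3 cosr0. Qed.
Lemma fS0 : fS 0 = S0. Proof. by rewrite /fS z3 sinr0. Qed.
Lemma fl0 : fl 0 = 1. Proof. by rewrite /fl z3 co0. Qed.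
Lemma fK0 : fK 0 = K0.
Proof. by rewrite /fK fC0 z3 Kc0 expr0n /= !mulr0 mul0r mulr0 !subr0 mulr1. Qed.
Lemma fs0 : fs 0 = s0.
Proof. by rewrite /fs fC0 z3 sc0 expr0n /= !mulr0 mul0r mulr0 subr0 addr0 mulr1. Qed.

Lemma Kc_smooth (V : normedModType R) (z : V) (f : V -> R) :
  smooth_at z f -> smooth_at z (fun y => Kc (f y)).
Proof. by move=> sf; rewrite /Kc; smooth; exact: Kc_arg_gt0. Qed.

Lemma sc_smooth (V : normedModType R) (z : V) (f : V -> R) :
  smooth_at z f -> f z = C0 -> smooth_at z (fun y => sc (f y)).
Proof.
move=> sf fz; have sK := Kc_smooth sf; rewrite /sc; smooth.
by rewrite fz sc_arg0 exprn_even_gt0 // s0_neq0.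
Qed.

Lemma fold_smooth : [/\ smooth_at 0 fC, smooth_at 0 fS, smooth_at 0 fK, smooth_at 0 fs & smooth_at 0 fl]
  /\ [/\ smooth_at 0 fA, smooth_at 0 fB & smooth_at 0 (fun q => sc (fC q))].
Proof.
have c0 : smooth_at 0 (fun q => q 0 0) by smooth.
have c1 : smooth_at 0 (fun q => q 0 1) by smooth.
have c2 : smooth_at 0 (fun q => q 0 2%R) by smooth.
have sC : smooth_at 0 fC := cosr_smooth C0 S0 c0 (z3 0).
have sS : smooth_at 0 fS := sinr_smooth C0 S0 c0 (z3 0).
have sl : smooth_at 0 fl := co_smooth c2 (z3 2%R).
have so := co_smooth c1 (z3 1).
have sKc := Kc_smooth sC; have ssc := sc_smooth sC fC0.
have sK : smooth_at 0 fK by rewrite /fK; smooth.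
have ss : smooth_at 0 fs by rewrite /fs; smooth.
split; split=> //.
- by rewrite /fA; smooth; rewrite gt_eqF // Kc_gt0.
- by rewrite /fB /bump; smooth; rewrite fl0.
Qed.

(** The second derivative of s (7 C + 3 K) along the circle is - s (7 C + 12 K), which equals - 3 s
    (1 / K + 2 K) at a critical point. It is nonzero for s0 != 0, and [sg] normalizes its sign. *)
Lemma fA0_gt0 : 0 < fA 0.
Proof.
rewrite /fA fC0 z3 Kc0 sc0 co0 !mulr0 !mul0r add0r expr1n mulr1.
have -> : sg * 6 * (s0 * (K0^-1 - 2 * K0 + 4 * K0)) = sg * s0 * (6 * (K0^-1 + 2 * K0)) by ring.
by rewrite mulr_gt0 // mulr_gt0 // addr_gt0 ?invr_gt0 ?mulr_gt0.
Qed.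

Lemma fB0_gt0 : 0 < fB 0.
Proof. by rewrite /fB fC0 fS0 fK0 fs0 fl0 z3 bump_gt0. Qed.

(** n is the sine of half the rotation angle, whose cosine and sine are therefore 1 - 2 n^2 and 2 n
    o. Criticality of [Kc C] removes the linear term in n. *)
Lemma fold_height (C n o : R) : o ^+ 2 = 1 - n ^+ 2 -> Kc C ^+ 2 + sc C ^+ 2 = 1 ->
  (sc C * (1 - 2 * n ^+ 2) + Kc C * (2 * n * o)) *
    (7 * C + 3 * (Kc C * (1 - 2 * n ^+ 2) - sc C * (2 * n * o))) =
  sc C * (7 * C + 3 * Kc C) - 6 * n ^+ 2 * (2 * n * o * (2 * Kc C ^+ 2 - 1) +
  sc C * ((Kc C)^-1 - 2 * Kc C + 4 * o ^+ 2 * Kc C)).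
Proof.
move=> on Kcs; have K' := lt0r_neq0 (Kc_gt0 C).
have E : 7 * C = (3 - 6 * Kc C ^+ 2) / Kc C.
  by apply: (mulIf K'); rewrite divfK //; apply/eqP; rewrite -subr_eq0; apply/eqP; rewrite -[RHS](Kc_crit C); ring.
rewrite E; move: Kcs K'; set K := Kc C; set s := sc C => Kcs K'.
apply/eqP; rewrite -subr_eq0; apply/eqP.
transitivity (12 * s * K * n ^+ 2 * (o ^+ 2 - (1 - n ^+ 2)) -
  6 * n * o * (1 - 2 * n ^+ 2) * (K ^+ 2 + s ^+ 2 - 1)); first by field.
by rewrite on Kcs !subrr !mulr0 subrr.
Qed.

Lemma sph1_0 : sph1 (fC 0) (fS 0) (fK 0) (fs 0) (fl 0) ((0 : 'rV[R]_3) 0 2%R) = C0 * K0.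
Proof. by rewrite /sph1 fC0 fK0 fl0 z3 mulr1 mulr0 mul0r subr0. Qed.

Lemma fold_near : \forall q \near (0 : 'rV[R]_3),
  [/\ fC q ^+ 2 + fS q ^+ 2 = 1, Kc (fC q) ^+ 2 + sc (fC q) ^+ 2 = 1,
      co (q 0 1) ^+ 2 = 1 - q 0 1 ^+ 2 & fl q ^+ 2 + q 0 2%R ^+ 2 = 1] /\
  [/\ 0 < fA q, 0 < fB q, 1 + sph1 (fC q) (fS q) (fK q) (fs q) (fl q) (q 0 2%R) != 0 &
      0 < fK q * K0 + fs q * s0].
Proof.
have c0 : smooth_at 0 (fun q => q 0 0) by smooth.
have c1 : smooth_at 0 (fun q => q 0 1) by smooth.
have c2 : smooth_at 0 (fun q => q 0 2%R) by smooth.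
have [[sC sS sK ss sl] [sA sB ssc]] := fold_smooth.
have sKc := Kc_smooth sC.
have n1 := near_sq_le1 c0 (z3 0); have n2 := near_sq_le1 c1 (z3 1).
have n3 := near_sq_le1 c2 (z3 2%R).
have n4 : \forall q \near (0 : 'rV[R]_3), 0 < 1 - Kc (fC q) ^+ 2.
  apply: near_gt0; first by smooth.
  by rewrite fC0 sc_arg0 exprn_even_gt0 // s0_neq0.
have n5 := near_gt0 sA fA0_gt0; have n6 := near_gt0 sB fB0_gt0.
have n7 : \forall q \near (0 : 'rV[R]_3), 1 + sph1 (fC q) (fS q) (fK q) (fs q) (fl q) (q 0 2%R) != 0.
  have s7 : smooth_at 0 (fun q => 1 + sph1 (fC q) (fS q) (fK q) (fs q) (fl q) (q 0 2%R)).
    by rewrite /sph1; smooth.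
  apply: continuous_near (smooth_at_continuous s7) (@open_neq _ 0) _.
  by rewrite /= sph1_0.
have n8 : \forall q \near (0 : 'rV[R]_3), 0 < fK q * K0 + fs q * s0.
  apply: near_gt0; first by smooth.
  by rewrite fK0 fs0 -!expr2 Ks.
near=> q; split; split.
- by apply: rot_unit => //; near: q.
- have H : 0 < 1 - Kc (fC q) ^+ 2 by near: q.
  have -> : sc (fC q) ^+ 2 = sg * sg * Num.sqrt (1 - Kc (fC q) ^+ 2) ^+ 2 by rewrite /sc; ring.
  by rewrite sqr_sqrtr ?ltW // sg2 mul1r subrKC.
- by apply: co_sq; near: q.
- by rewrite /fl co_sq ?subrK //; near: q.
- by near: q.
- by near: q.
- by near: q.
- by near: q.
Unshelve. all: by end_near. Qed.

Lemma fold_unit q : Kc (fC q) ^+ 2 + sc (fC q) ^+ 2 = 1 -> co (q 0 1) ^+ 2 = 1 - q 0 1 ^+ 2 ->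
  fK q ^+ 2 + fs q ^+ 2 = 1.
Proof.
move=> Kcs on.
transitivity ((Kc (fC q) ^+ 2 + sc (fC q) ^+ 2) *
  ((1 - 2 * q 0 1 ^+ 2) ^+ 2 + 4 * q 0 1 ^+ 2 * co (q 0 1) ^+ 2)); first by rewrite /fK /fs; ring.
by rewrite Kcs on; ring.
Qed.

(** [b] is the sine of the angle from (K0, s0) to ([fK], [fs]), so [fE] is [base_chart] with its
    second coordinate replaced by [b]. *)
Lemma fE_local_diffeo : local_diffeo 0 fE.
Proof.
pose b q := fs q * K0 - fK q * s0.
have [[sC sS sK ss sl] [sA sB ssc]] := fold_smooth.
have sb' : smooth_at 0 b by rewrite /b; smooth.
have b0 : b 0 = 0 by rewrite /b fs0 fK0 mulrC subrr.
have sid : smooth_at (0 : R^o) (fun t : R^o => t : R) by exact: smooth_at_id.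
have sco : smooth_at (0 : R^o) (fun t : R^o => co t) by apply: (co_smooth sid).
have dPi : local_diffeo 0 (fun q => row3 (q 0 0) (b q) (q 0 2%R)).
  apply: (@local_diffeo_replace3 _ _ (fun t => 2 * co t)) => //.
  - by smooth.
  - by rewrite co0 mulr1.
  near=> t; rewrite b0 add0r /b /fK /fs /fC !row3E cosr0 Kc0 sc0.
  transitivity (t * (2 * co t) * (K0 ^+ 2 + s0 ^+ 2)); first by ring.
  by rewrite Ks mulr1.
have dE : local_diffeo 0 (fun q => base_chart C0 S0 K0 s0 (row3 (q 0 0) (b q) (q 0 2%R))).
  apply: (@local_diffeo_comp _ _ _ (fun q => row3 (q 0 0) (b q) (q 0 2%R))) => //.
  by rewrite !z3 b0 row3_000; exact: base_chart_local_diffeo.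
apply: local_diffeo_near_eq dE; apply: filterS fold_near => q [[CSq Kcs on lj] [_ _ _ pos]].
have Ksq := fold_unit Kcs on.
rewrite /base_chart /fE !row3E -/(fC q) -/(fS q) -/(fl q).
(* Positivity of the scalar product selects the branch of the cosine. *)
have cb : co (b q) = fK q * K0 + fs q * s0.
  rewrite /co (_ : 1 - b q ^+ 2 = (fK q * K0 + fs q * s0) ^+ 2); last first.
    transitivity ((fK q ^+ 2 + fs q ^+ 2) * (K0 ^+ 2 + s0 ^+ 2) - b q ^+ 2); first by rewrite Ks Ksq mulr1.
    by rewrite /b; ring.
  by rewrite sqrtr_sqr gtr0_norm.
congr chart.
  rewrite /cosr cb; transitivity (fK q * (K0 ^+ 2 + s0 ^+ 2)); first by rewrite /b; ring.
  by rewrite Ks mulr1.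
rewrite /sinr cb; transitivity (fs q * (K0 ^+ 2 + s0 ^+ 2)); first by rewrite /b; ring.
by rewrite Ks mulr1.
Unshelve. all: by end_near. Qed.

Lemma fPhi_local_diffeo : local_diffeo 0 fPhi.
Proof.
have [[sC sS sK ss sl] [sA sB ssc]] := fold_smooth.
have A0 := fA0_gt0; have B0 := fB0_gt0.
have sid : smooth_at (0 : R^o) (fun t : R^o => t : R) by exact: smooth_at_id.
have sPhi : smooth_at 0 fPhi by apply: smooth_at_row3; smooth.
have line (i : 'I_3) : smooth_at (0 : R^o) (fun t : R^o => t *: ('e_i : 'rV[R]_3)).
  apply: smooth_at_row => j.
  have -> : (fun t : R^o => (t *: ('e_i : 'rV[R]_3)) 0 j) = (fun t : R^o => t * ('e_i : 'rV[R]_3) 0 j).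
    by apply/funext => t; rewrite mxE.
  by smooth.
have comp (i : 'I_3) (f : 'rV[R]_3 -> R) : smooth_at 0 f -> 0 < f 0 ->
    smooth_at (0 : R^o) (fun t : R^o => Num.sqrt (f (t *: 'e_i))) /\ 0 < Num.sqrt (f (0 *: 'e_i)).
  move=> sf f0; rewrite scale0r sqrtr_gt0; split=> //.
  have sc1 : smooth_at (0 : R^o) (fun t : R^o => f (t *: 'e_i)).
    have srow : smooth_at 0 (fun q => row2 (f q) 0) by apply: smooth_at_row2; smooth.
    have := @smooth_at_comp _ _ _ _ (0 : R^o) (fun t => t *: ('e_i : 'rV[R]_3)) (fun q => row2 (f q) 0) (line i).
    rewrite scale0r => /(_ srow) /(smooth_at_coord 0).
    by under eq_fun do rewrite row2E.
  by apply: smooth_at_sqrt => //; rewrite scale0r.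
have [sk1 k1] := comp 1 _ sA A0; have [sk2 k2] := comp 2%R _ sB B0.
have e1 t : row3 0 t 0 = t *: 'e_1 :> 'rV[R]_3 by rewrite -axis3_1 addr0.
have e2 t : row3 0 0 t = t *: 'e_2%R :> 'rV[R]_3 by rewrite -axis3_2 addr0.
apply: (@local_diffeo_triangular3 _ _ (fun=> 1) (fun t => Num.sqrt (fA (t *: 'e_1)))
  (fun t => Num.sqrt (fB (t *: 'e_2%R)))) => //.
- exact: smooth_at_cst.
- by rewrite gt_eqF.
- by rewrite gt_eqF.
- near=> t; rewrite /fPhi !row3E !z3 !mul0r mulr1 add0r //.
- by near=> t; rewrite /fPhi !row3E !z3 !mul0r add0r -e1.
- by near=> t; rewrite /fPhi !row3E !z3 !mul0r add0r -e2.
Unshelve. all: by end_near. Qed.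

Lemma fold_target : local_diffeo 0 (fun u : 'rV[R]_2 => polar C0 S0 (row2 (u 0 0) (frho u))).
Proof.
have z2 j : (0 : 'rV[R]_2) 0 j = 0 by rewrite mxE.
have c0 : smooth_at 0 (fun u : 'rV[R]_2 => u 0 0) by smooth.
have sC := cosr_smooth C0 S0 c0 (z2 0).
have sKc := Kc_smooth sC.
have ssc : smooth_at 0 (fun u : 'rV[R]_2 => sc (cosr C0 S0 (u 0 0))).
  by apply: sc_smooth; rewrite // z2 cosr0.
apply: (@polar_target _ _ _ _ (fun=> - sg)) => //.
- by rewrite /frho; smooth.
- rewrite /frho !z2 cosr0 sc0 Kc0 mulr0 subr0.
  have bd (x y u v : R) : x ^+ 2 + u ^+ 2 = 1 -> y ^+ 2 + v ^+ 2 = 1 -> -1 <= x * y.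
    move=> xu yv; rewrite -subr_ge0.
    have -> : x * y - -1 = ((x + y) ^+ 2 + u ^+ 2 + v ^+ 2) / 2.
      transitivity (((x ^+ 2 + u ^+ 2) + (y ^+ 2 + v ^+ 2) + 2 * (x * y)) / 2).
        by rewrite xu yv; field.
      by field.
    by rewrite divr_ge0 // !addr_ge0 ?sqr_ge0.
  have H1 : -1 <= s0 * C0 by apply: (bd _ _ K0 S0) => //; rewrite addrC.
  have H2 : -1 <= s0 * K0 by apply: (bd _ _ K0 s0) => //; rewrite addrC.
  have -> : 100 + s0 * (7 * C0 + 3 * K0) = 100 + 7 * (s0 * C0) + 3 * (s0 * K0) by ring.
  by rewrite gt_eqF //; lra.
- exact: smooth_at_cst.
- by rewrite oppr_eq0 signr_eq0.
- by near=> t; rewrite /frho !row2E !z2 mulr0 subr0 mulrN [t * _]mulrC.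
Unshelve. all: by end_near. Qed.

(** The radius has a maximum across the torus; along the circle it has a maximum if s0 > 0 and a
    minimum if s0 < 0. This makes the fold definite or indefinite, as recorded by [sb]. *)
Lemma fold_normal_form : locally_given_by (fold_model sb) (@hopf_map R) (chart C0 S0 K0 s0 1 0).
Proof.
have -> : chart C0 S0 K0 s0 1 0 = fE 0 by rewrite /fE fC0 fS0 fK0 fs0 fl0 z3.
have Phi0 : fPhi 0 = 0 by rewrite /fPhi !z3 !mul0r row3_000.
have sPhi := local_diffeo_smooth fPhi_local_diffeo.
have cPhi j := smooth_at_coord j sPhi.
apply: (@locally_given_by_param _ _ _ fE fPhi (fun q => fold_model sb (fPhi q)) _ (fun u => u)
  fE_local_diffeo fPhi_local_diffeo Phi0 fold_target) => //=.
- exists setT, setT; split=> //; split; [exact: openT|exact: openT|..].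
    by apply: smooth_on_at => x _; exact: smooth_at_id.
  by exists id; split=> // k; apply: smooth_on_at => x _; exact: smooth_at_id.
- apply: smooth_at_continuous; rewrite /fold_model.
  have c0 := cPhi 0; have c1 := cPhi 1; have c2 := cPhi 2%R.
  by apply: smooth_at_row2; smooth.
- by rewrite Phi0 /fold_model !z3 expr0n mulr0 addr0 row2_00.
- apply: filterS fold_near => q [[CSq Kcs on lj] [A0 B0 d0 _]].
  have Ksq := fold_unit Kcs on.
  rewrite /fE (hopf_map_chart CSq Ksq lj d0) radiusE //; last exact: sqrtr_ge0.
  rewrite /fold_model /polar !row2E /fPhi !row3E -/(fC q) -/(fS q).
  have -> : 100 + fs q * (7 * fC q + 3 * fK q) -
      q 0 2%R ^+ 2 * bump (fC q) (fS q) (fK q) (fs q) (fl q) (q 0 2%R) =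
      frho (row2 (q 0 0) ((q 0 1 * Num.sqrt (fA q)) ^+ 2 + (-1) ^+ sb * (q 0 2%R * Num.sqrt (fB q)) ^+ 2)).
    rewrite /frho !row2E -/(fC q) [fs q]/fs [fK q in LHS]/fK (fold_height on Kcs).
    rewrite ![(_ * Num.sqrt _) ^+ 2]exprMn (sqr_sqrtr (ltW A0)) (sqr_sqrtr (ltW B0)) -/sg.
    rewrite -/(fB q) [fA q in RHS]/fA; move: (fB q) => B.
    set X := (X in q 0 1 ^+ 2 * (sg * 6 * X)).
    transitivity (100 + sc (fC q) * (7 * fC q + 3 * Kc (fC q)) -
      (sg * sg) * (6 * q 0 1 ^+ 2 * X + q 0 2%R ^+ 2 * B)); last by ring.
    by rewrite sg2 /X; ring.
  by [].
- exact: filterE.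
Qed.

End Fold.

(** * Cusp points *)

Section CuspFunctions.
Context {R : realType}.
Implicit Types (C s w z t : R).

(* For u = arcsin s the angle om = arcsin (cusp_om C s z) is chosen so that the heights of the
   angles psi = u - om and chi = u + om, of sines cusp_psi and cusp_chi, differ by 2 cos(om) z^2. This
   exchanges the height at psi for a function of the single new coordinate cusp_chi. *)
Definition cusp_om C s z : R := (7 * C * s - z ^+ 2) / (3 * (1 - 2 * s ^+ 2)).
Definition cusp_psi C s z : R := s * co (cusp_om C s z) - co s * cusp_om C s z.
Definition cusp_chi C s z : R := s * co (cusp_om C s z) + co s * cusp_om C s z.

(* With w = sin chi fixed, z^2 is a cubic polynomial in tan u; completing the cube gives
   Y^3 + cusp_x Y - z'^2 = cusp_c for Y = cusp_G - tan u. *)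
Definition cusp_al C w : R := 3 * co w - 7 * C.
Definition cusp_G C w : R := w / cusp_al C w.
Definition cusp_A C w : R := (7 * C + 3 * co w) / cusp_al C w.
Definition cusp_x C w : R := - (3 * cusp_G C w ^+ 2 + cusp_A C w).
Definition cusp_c C w : R := 3 * cusp_G C w - cusp_A C w * cusp_G C w - 2 * cusp_G C w ^+ 3.

Lemma cusp_om0 C : cusp_om C 0 0 = 0.
Proof. by rewrite /cusp_om mulr0 expr0n subr0 mul0r. Qed.
Lemma cusp_psi0 C : cusp_psi C 0 0 = 0.
Proof. by rewrite /cusp_psi cusp_om0 mul0r mulr0 subr0. Qed.
Lemma cusp_chi0 C : cusp_chi C 0 0 = 0.
Proof. by rewrite /cusp_chi cusp_om0 mul0r mulr0 addr0. Qed.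

Section Germ.
Variables (V : normedModType R) (p : V) (c s z w : V -> R).
Hypotheses (sc : smooth_at p c) (ss : smooth_at p s) (sz : smooth_at p z) (sw : smooth_at p w).
Hypotheses (s0 : s p = 0) (z0 : z p = 0) (w0 : w p = 0) (c0 : 3 - 7 * c p != 0).

Lemma cusp_om_smooth : smooth_at p (fun y => cusp_om (c y) (s y) (z y)).
Proof. by rewrite /cusp_om; smooth; rewrite s0 expr0n mulr0 subr0 mulr1 pnatr_eq0. Qed.

Let om0 : cusp_om (c p) (s p) (z p) = 0. Proof. by rewrite s0 z0 cusp_om0. Qed.
Let som := cusp_om_smooth.
Let sco := co_smooth ss s0.
Let scom := co_smooth som om0.

Lemma cusp_psi_smooth : smooth_at p (fun y => cusp_psi (c y) (s y) (z y)).
Proof. by have H1 := som; have H2 := sco; have H3 := scom; rewrite /cusp_psi; smooth. Qed.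
Lemma cusp_chi_smooth : smooth_at p (fun y => cusp_chi (c y) (s y) (z y)).
Proof. by have H1 := som; have H2 := sco; have H3 := scom; rewrite /cusp_chi; smooth. Qed.
Lemma cusp_al_smooth : smooth_at p (fun y => cusp_al (c y) (w y)).
Proof. by have H := co_smooth sw w0; rewrite /cusp_al; smooth. Qed.

Let al_neq0 : cusp_al (c p) (w p) != 0. Proof. by rewrite /cusp_al w0 co0 mulr1. Qed.

Lemma cusp_G_smooth : smooth_at p (fun y => cusp_G (c y) (w y)).
Proof. by have H := cusp_al_smooth; rewrite /cusp_G; smooth. Qed.
Lemma cusp_A_smooth : smooth_at p (fun y => cusp_A (c y) (w y)).
Proof. by have H := cusp_al_smooth; have H1 := co_smooth sw w0; rewrite /cusp_A; smooth. Qed.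
Lemma cusp_x_smooth : smooth_at p (fun y => cusp_x (c y) (w y)).
Proof. by have H := cusp_G_smooth; have H1 := cusp_A_smooth; rewrite /cusp_x; smooth. Qed.
Lemma cusp_c_smooth : smooth_at p (fun y => cusp_c (c y) (w y)).
Proof. by have H := cusp_G_smooth; have H1 := cusp_A_smooth; rewrite /cusp_c; smooth. Qed.

End Germ.

(** The difference of the two heights is 2 cos om (7 C sin u - 3 cos (2 u) sin om), and [cusp_om]
    makes the bracket equal to z^2. The sign conditions identify [co] of the two sines with the
    cosines of u - om and u + om. *)
Lemma cusp_height C s z : 1 - 2 * s ^+ 2 != 0 -> co s ^+ 2 = 1 - s ^+ 2 ->
  co (cusp_om C s z) ^+ 2 = 1 - cusp_om C s z ^+ 2 ->
  0 <= co s * co (cusp_om C s z) + s * cusp_om C s z ->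
  0 <= co s * co (cusp_om C s z) - s * cusp_om C s z ->
  [/\ co (cusp_psi C s z) ^+ 2 = 1 - cusp_psi C s z ^+ 2,
      co (cusp_chi C s z) = co s * co (cusp_om C s z) - s * cusp_om C s z &
  cusp_psi C s z * (7 * C + 3 * co (cusp_psi C s z)) - 2 * co (cusp_om C s z) * z ^+ 2 =
  cusp_chi C s z * (3 * co (cusp_chi C s z) - 7 * C)].
Proof.
move=> d0 su sw p0 p1.
have sgn (e : R) : e ^+ 2 = 1 ->
    1 - (s * co (cusp_om C s z) - e * (co s * cusp_om C s z)) ^+ 2 =
    (co s * co (cusp_om C s z) + e * (s * cusp_om C s z)) ^+ 2.
  move=> e1; apply/eqP; rewrite -subr_eq0; apply/eqP.
  transitivity (1 - (s ^+ 2 + co s ^+ 2) * (co (cusp_om C s z) ^+ 2 + e ^+ 2 * cusp_om C s z ^+ 2)).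
    by ring.
  by rewrite e1 su sw; ring.
have Ep : co (cusp_psi C s z) = co s * co (cusp_om C s z) + s * cusp_om C s z.
  have := sgn 1 (expr1n _ _); rewrite !mul1r -/(cusp_psi C s z) => E; rewrite {1}/co E.
  by rewrite sqrtr_sqr ger0_norm.
have Ec : co (cusp_chi C s z) = co s * co (cusp_om C s z) - s * cusp_om C s z.
  have /sgn : (-1) ^+ 2 = 1 :> R by rewrite sqrrN expr1n.
  rewrite !mulN1r opprK -/(cusp_chi C s z) => E; rewrite {1}/co E.
  by rewrite sqrtr_sqr ger0_norm.
have Eo : 3 * (1 - 2 * s ^+ 2) * cusp_om C s z = 7 * C * s - z ^+ 2.
  by rewrite /cusp_om mulrC divfK // mulf_neq0.
split=> //.
  by have := sgn 1 (expr1n _ _); rewrite !mul1r -/(cusp_psi C s z) => ->; rewrite Ep.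
rewrite Ep Ec /cusp_psi /cusp_chi.
move: Eo su sw; set o := cusp_om C s z; set c := co s; set d := co o => Eo su sw.
apply/eqP; rewrite -subr_eq0; apply/eqP.
transitivity (2 * d * (7 * C * s - z ^+ 2 - 3 * (c ^+ 2 - s ^+ 2) * o)); first by ring.
by rewrite -Eo su; ring.
Qed.

(** With om = chi - u, the equation defining [cusp_om] is homogeneous of degree 3 in sin u and cos u
    up to z^2; division by cos^3 u leaves a cubic in tan u, and [cusp_G] is the shift that removes
    its quadratic term. *)
Lemma cusp_cubic C s z : co s != 0 -> 1 - 2 * s ^+ 2 != 0 -> co s ^+ 2 = 1 - s ^+ 2 ->
  co (cusp_om C s z) ^+ 2 = 1 - cusp_om C s z ^+ 2 ->
  co (cusp_chi C s z) = co s * co (cusp_om C s z) - s * cusp_om C s z ->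
  cusp_al C (cusp_chi C s z) != 0 ->
  (cusp_G C (cusp_chi C s z) - s / co s) ^+ 3 +
    cusp_x C (cusp_chi C s z) * (cusp_G C (cusp_chi C s z) - s / co s) -
    z ^+ 2 / (cusp_al C (cusp_chi C s z) * co s ^+ 3) = cusp_c C (cusp_chi C s z).
Proof.
move=> c0 d0 su sw Ec a0.
have Ew : cusp_om C s z = cusp_chi C s z * co s - co (cusp_chi C s z) * s.
  transitivity (cusp_om C s z * (co s ^+ 2 + s ^+ 2)); first by rewrite su subrK mulr1.
  by rewrite Ec /cusp_chi; ring.
have Eo : 3 * (1 - 2 * s ^+ 2) * cusp_om C s z = 7 * C * s - z ^+ 2.
  by rewrite /cusp_om mulrC divfK // mulf_neq0.
have Ez : z ^+ 2 = 7 * C * s * (co s ^+ 2 + s ^+ 2) -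
    3 * (co s ^+ 2 - s ^+ 2) * (cusp_chi C s z * co s - co (cusp_chi C s z) * s).
  by rewrite -Ew su subrK mulr1 (_ : 1 - s ^+ 2 - s ^+ 2 = 1 - 2 * s ^+ 2) ?Eo; ring.
rewrite Ez; rewrite /cusp_c /cusp_x /cusp_A /cusp_G; move: a0.
rewrite /cusp_al; set X := cusp_chi C s z; set k := co X; set c := co s in c0 *.
by move=> a0; field; rewrite c0 a0.
Qed.

End CuspFunctions.

Section Cusp.
Context {R : realType}.
Implicit Types (q p : 'rV[R]_3).
Variables C0 S0 : R.
Hypotheses (CS : C0 ^+ 2 + S0 ^+ 2 = 1) (C7 : 7 * C0 = -3).

Let tC q := cosr C0 S0 (q 0 0).
Let tom q := cusp_om (tC q) (q 0 1) (q 0 2%R).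
Let tpsi q := cusp_psi (tC q) (q 0 1) (q 0 2%R).
Let tchi q := cusp_chi (tC q) (q 0 1) (q 0 2%R).
Let tal q := cusp_al (tC q) (tchi q).
Let tPi q := row3 (q 0 0) (tpsi q) (q 0 2%R * Num.sqrt (2 * co (tom q))).
Let tB q := bump (tC q) (sinr C0 S0 (q 0 0)) (cosr 1 0 (q 0 1)) (sinr 1 0 (q 0 1))
  (co (q 0 2%R)) (q 0 2%R).
Let tLam q := row3 (q 0 0) (q 0 1) (q 0 2%R * Num.sqrt (tB q)).
Let te q := row2 (q 0 0) (tchi q).
Let trho (u : 'rV[R]_2) := 100 + u 0 1 * (3 * co (u 0 1) - 7 * cosr C0 S0 (u 0 0)).
Let tPsi (u : 'rV[R]_2) :=
  row2 (cusp_x (cosr C0 S0 (u 0 0)) (u 0 1)) (cusp_c (cosr C0 S0 (u 0 0)) (u 0 1)).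
Let tPhi q := row3 (cusp_x (tC q) (tchi q)) (cusp_G (tC q) (tchi q) - q 0 1 / co (q 0 1))
  (q 0 2%R / Num.sqrt (tal q * co (q 0 1) ^+ 3)).

Let z3 j : (0 : 'rV[R]_3) 0 j = 0. Proof. by rewrite mxE. Qed.
Let z2 j : (0 : 'rV[R]_2) 0 j = 0. Proof. by rewrite mxE. Qed.
Let tC0 : tC 0 = C0. Proof. by rewrite /tC z3 cosr0. Qed.
Let tom0 : tom 0 = 0. Proof. by rewrite /tom !z3 cusp_om0. Qed.
Let tpsi0 : tpsi 0 = 0. Proof. by rewrite /tpsi !z3 cusp_psi0. Qed.
Let tchi0 : tchi 0 = 0. Proof. by rewrite /tchi !z3 cusp_chi0. Qed.
Let tal0 : tal 0 = 6. Proof. by rewrite /tal tC0 tchi0 /cusp_al co0 C7; ring. Qed.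
Let tB0_gt0 : 0 < tB 0.
Proof. by rewrite /tB tC0 !z3 !sinr0 cosr0 co0; apply: bump_gt0 => //; rewrite expr1n expr0n addr0. Qed.
Let S0_neq0 : S0 != 0.
Proof.
apply/eqP => S00; have : (7 * C0) ^+ 2 = 49 by rewrite exprMn -[C0 ^+ 2]addr0 -[X in _ + X](expr0n R 2) -S00 CS; ring.
by rewrite C7 => /eqP; rewrite -subr_eq0 => /eqP ?; lra.
Qed.

Let C67 : 3 - 7 * C0 != 0. Proof. by rewrite C7 opprK -natrD pnatr_eq0. Qed.

Let coord_smooth (j : 'I_3) : smooth_at 0 (fun q => q 0 j).
Proof. by smooth. Qed.

Let tC_smooth : smooth_at 0 tC := cosr_smooth C0 S0 (coord_smooth 0) (z3 0).
Let tom_smooth : smooth_at 0 tom := cusp_om_smooth tC_smooth (coord_smooth 1) (coord_smooth 2%R) (z3 1).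
Let tpsi_smooth : smooth_at 0 tpsi :=
  cusp_psi_smooth tC_smooth (coord_smooth 1) (coord_smooth 2%R) (z3 1) (z3 2%R).
Let tchi_smooth : smooth_at 0 tchi :=
  cusp_chi_smooth tC_smooth (coord_smooth 1) (coord_smooth 2%R) (z3 1) (z3 2%R).
Let tal_smooth : smooth_at 0 tal := cusp_al_smooth tC_smooth tchi_smooth tchi0.
Let tx_smooth : smooth_at 0 (fun q => cusp_x (tC q) (tchi q)).
Proof. by apply: cusp_x_smooth; rewrite ?tC0. Qed.
Let tG_smooth : smooth_at 0 (fun q => cusp_G (tC q) (tchi q)).
Proof. by apply: cusp_G_smooth; rewrite ?tC0. Qed.
Let co1_smooth : smooth_at 0 (fun q => co (q 0 1)) := co_smooth (coord_smooth 1) (z3 1).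
Let coom_smooth : smooth_at 0 (fun q => co (tom q)) := co_smooth tom_smooth tom0.

Let sid : smooth_at (0 : R^o) (fun t : R^o => t : R). Proof. exact: smooth_at_id. Qed.
Let sco : smooth_at (0 : R^o) (fun t : R^o => co t). Proof. exact: (co_smooth sid). Qed.

Let om_axis1 (t : R) : cusp_om C0 t 0 = - (t / (1 - 2 * t ^+ 2)).
Proof.
rewrite /cusp_om C7 expr0n subr0 invfM.
by move: (1 - _)^-1 => d; field.
Qed.
Let om_axis2 (C t : R) : cusp_om C 0 t = - (t ^+ 2 / 3).
Proof. by rewrite /cusp_om mulr0 expr0n mulr0 subr0 mulr1 sub0r mulNr. Qed.

(** As 7 C0 = -3, om has slope -1 in s at the base point. So psi has slope 2 and can serve as a
    coordinate, while chi has slope 0, which is the singularity. *)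
Let tPi_local_diffeo : local_diffeo 0 tPi.
Proof.
have Pi0 : tPi 0 = 0 by rewrite /tPi !z3 tpsi0 mul0r row3_000.
have sq : 0 < 2 * co (tom 0) by rewrite tom0 co0 mulr1.
have som : smooth_at (0 : R^o) (fun t : R^o => co (- (t / (1 - 2 * t ^+ 2)))).
  by apply: co_smooth; [smooth; rewrite expr0n mulr0 subr0|rewrite mul0r oppr0].
have som2 : smooth_at (0 : R^o) (fun t : R^o => co (- (t ^+ 2 / 3))).
  by apply: co_smooth; [smooth; rewrite pnatr_eq0|rewrite expr0n mul0r oppr0].
apply: (@local_diffeo_triangular3 _ _ (fun=> 1)
  (fun t => co (- (t / (1 - 2 * t ^+ 2))) + co t / (1 - 2 * t ^+ 2))
  (fun t => Num.sqrt (2 * co (- (t ^+ 2 / 3))))); rewrite ?Pi0 ?z3 //.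
- by apply: smooth_at_row3; smooth.
- exact: smooth_at_cst.
- by smooth; rewrite expr0n mulr0 subr0.
- by smooth; rewrite expr0n mul0r oppr0 co0 mulr1.
- by rewrite expr0n mulr0 subr0 mul0r oppr0 co0 divr1.
- by rewrite expr0n mul0r oppr0 co0 mulr1 gt_eqF // sqrtr_gt0.
- by apply: filterE => t; rewrite /tPi /tpsi !row3E cusp_psi0 mul0r mulr1 add0r.
- apply: filterE => t; rewrite /tPi /tpsi /tC !row3E mul0r cosr0; split=> //.
  by rewrite /cusp_psi om_axis1; ring.
- by apply: filterE => t; rewrite /tPi /tom /tC !row3E om_axis2 add0r.
Qed.

Let tLam_local_diffeo : local_diffeo 0 tLam.
Proof.
have sC := cosr_smooth C0 S0 (coord_smooth 0) (z3 0).
have sS := sinr_smooth C0 S0 (coord_smooth 0) (z3 0).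
have sK := cosr_smooth 1 0 (coord_smooth 1) (z3 1).
have ss := sinr_smooth 1 0 (coord_smooth 1) (z3 1).
have sl := co_smooth (coord_smooth 2%R) (z3 2%R).
have l1 : 1 + co ((0 : 'rV[R]_3) 0 2%R) != 0 by rewrite z3 co0.
have sB : smooth_at 0 tB by rewrite /tB /bump; smooth.
have l0 : 1 + co 0 != 0 :> R by rewrite co0.
have Lam0 : tLam 0 = 0 by rewrite /tLam !z3 mul0r row3_000.
have b0 : 0 < bump C0 S0 1 0 (co 0) 0.
  by rewrite co0; apply: bump_gt0 => //; rewrite expr1n expr0n addr0.
apply: (@local_diffeo_triangular3 _ _ (fun=> 1) (fun=> 1)
  (fun t => Num.sqrt (bump C0 S0 1 0 (co t) t))); rewrite ?Lam0 ?z3 //.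
- by apply: smooth_at_row3; smooth.
- exact: smooth_at_cst.
- exact: smooth_at_cst.
- have sb : smooth_at (0 : R^o) (fun t : R^o => bump C0 S0 1 0 (co t) t) by rewrite /bump; smooth.
  by smooth.
- by rewrite gt_eqF // sqrtr_gt0.
- by apply: filterE => t; rewrite /tLam !row3E mul0r mulr1 add0r.
- by apply: filterE => t; rewrite /tLam !row3E mul0r mulr1 add0r.
- by apply: filterE => t; rewrite /tLam /tB /tC !row3E !cosr0 !sinr0 add0r.
Qed.

(** Along q_0 the coefficient [cusp_x] varies to first order because 7 C + 3 has derivative -7 S0,
    which is nonzero; along q_1 the entry -1 comes from tan u, since chi is stationary. *)
Let tPhi_local_diffeo : local_diffeo 0 tPhi.
Proof.
have Phi0 : tPhi 0 = 0.
  rewrite /tPhi tC0 tchi0 !z3 !mul0r /cusp_x /cusp_A /cusp_G C7 co0 mul0r expr0n mulr0 add0r subr0.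
  by rewrite mulr1 addNr mul0r oppr0 row3_000.
have al1 : cusp_al C0 0 = 6 by rewrite /cusp_al C7 co0; ring.
have c30 : 0 < tal 0 * co ((0 : 'rV[R]_3) 0 1) ^+ 3 by rewrite tal0 z3 co0 expr1n mulr1.
have sC : smooth_at (0 : R^o) (fun t : R^o => cosr C0 S0 t) by exact: (cosr_smooth _ _ sid).
have s0 : smooth_at (0 : R^o) (fun t : R^o => cusp_chi C0 t 0).
  by apply: cusp_chi_smooth => //; exact: smooth_at_cst.
have so : smooth_at (0 : R^o) (fun t : R^o => co (cusp_om C0 t 0)).
  apply: co_smooth; last exact: cusp_om0.
  by apply: cusp_om_smooth => //; exact: smooth_at_cst.
have sal : smooth_at (0 : R^o) (fun t : R^o => cusp_al C0 (cusp_chi C0 t 0)).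
  by apply: cusp_al_smooth => //; [exact: smooth_at_cst|exact: cusp_chi0].
have sal2 : smooth_at (0 : R^o) (fun t : R^o => cusp_al C0 (cusp_chi C0 0 t)).
  apply: cusp_al_smooth; [exact: smooth_at_cst| |exact: cusp_chi0].
  by apply: cusp_chi_smooth => //; exact: smooth_at_cst.
have a0 : cusp_al C0 (cusp_chi C0 0 0) != 0 by rewrite cusp_chi0 al1 pnatr_eq0.
have d0 : 1 - 2 * 0 ^+ 2 != 0 :> R by rewrite expr0n mulr0 subr0.
have o0 : co 0 != 0 :> R by rewrite co0.
have o1 : 1 + co 0 != 0 :> R by rewrite co0.
have c37 : 3 - 7 * cosr C0 S0 0 != 0 by rewrite cosr0.
have a1 : 0 < cusp_al C0 (cusp_chi C0 0 0) by rewrite cusp_chi0 al1.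
apply: (@local_diffeo_triangular3 _ _ (fun t => - ((3 * t / (1 + co t) - 7 * S0) / (3 - 7 * cosr C0 S0 t)))
  (fun t => (co (cusp_om C0 t 0) - co t / (1 - 2 * t ^+ 2)) / cusp_al C0 (cusp_chi C0 t 0) - (co t)^-1)
  (fun t => (Num.sqrt (cusp_al C0 (cusp_chi C0 0 t)))^-1)); rewrite ?Phi0 ?z3 //.
- apply: smooth_at_row3; smooth.
  + by rewrite z3 co0.
  + by rewrite gt_eqF // sqrtr_gt0.
- by smooth.
- by smooth.
- by smooth; rewrite gt_eqF // sqrtr_gt0.
- rewrite oppr_eq0 cosr0 co0 mulr0 mul0r sub0r mulf_neq0 //; first by rewrite oppr_eq0 mulf_neq0 ?pnatr_eq0.
  by rewrite invr_eq0.
- by rewrite cusp_om0 !co0 expr0n mulr0 subr0 divr1 subrr mul0r sub0r oppr_eq0 invr1 oner_neq0.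
- by rewrite invr_eq0 gt_eqF // sqrtr_gt0.
- have n1 := near_sq_le1 sid erefl.
  apply: filterS n1 => t /co_sq ct; rewrite /tPhi /tchi /tC !row3E cusp_chi0 !mul0r.
  rewrite /cusp_x /cusp_G /cusp_A !mul0r expr0n mulr0 subr0 !add0r /cusp_al co0 mulr1; congr row3.
  have c1 : 1 + co t != 0 by rewrite gt_eqF // ltr_pwDl // sqrtr_ge0.
  rewrite mulrN mulrA; congr (- (_ / _)).
  transitivity (t * (3 * t / (1 + co t) - 7 * S0) + (7 * C0 + 3) * co t +
     3 * (1 - t ^+ 2 - co t ^+ 2) / (1 + co t)); last by rewrite ct C7 addNr subrr mulr0 mul0r mul0r !addr0.
  by rewrite /cosr; field.
- apply: filterE => t; rewrite /tPhi /tchi /tC !row3E mul0r cosr0 add0r; split=> //.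
  rewrite /cusp_G; move: (cusp_al _ _) => al.
  by rewrite /cusp_chi om_axis1; ring.
- by apply: filterE => t; rewrite /tPhi /tal /tchi /tC !row3E co0 expr1n mulr1 cosr0 add0r.
Qed.

Let tPsi_local_diffeo : local_diffeo 0 tPsi.
Proof.
have al1 : cusp_al C0 0 = 6 by rewrite /cusp_al C7 co0; ring.
have A1 : cusp_A C0 0 = 0 by rewrite /cusp_A C7 co0 mulr1 addNr mul0r.
have Psi0 : tPsi 0 = 0.
  rewrite /tPsi !z2 cosr0 /cusp_x /cusp_c A1 /cusp_G !mul0r !expr0n !mulr0 addr0 !subr0 oppr0.
  by rewrite row2_00.
have c0 : smooth_at 0 (fun u : 'rV[R]_2 => u 0 0) by smooth.
have c1 : smooth_at 0 (fun u : 'rV[R]_2 => u 0 1) by smooth.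
have sC := cosr_smooth C0 S0 c0 (z2 0).
have c37' : 3 - 7 * cosr C0 S0 ((0 : 'rV[R]_2) 0 0) != 0 by rewrite z2 cosr0.
have sx : smooth_at 0 (fun u : 'rV[R]_2 => cusp_x (cosr C0 S0 (u 0 0)) (u 0 1)).
  by apply: cusp_x_smooth.
have scc : smooth_at 0 (fun u : 'rV[R]_2 => cusp_c (cosr C0 S0 (u 0 0)) (u 0 1)).
  by apply: cusp_c_smooth.
have sC' : smooth_at (0 : R^o) (fun t : R^o => cosr C0 S0 t) by exact: (cosr_smooth _ _ sid).
have scst : smooth_at (0 : R^o) (fun t : R^o => C0) by exact: smooth_at_cst.
have sal : smooth_at (0 : R^o) (fun t : R^o => cusp_al C0 t) by exact: cusp_al_smooth.
have sG : smooth_at (0 : R^o) (fun t : R^o => cusp_G C0 t) by exact: cusp_G_smooth.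
have sA : smooth_at (0 : R^o) (fun t : R^o => cusp_A C0 t) by exact: cusp_A_smooth.
have o1 : 1 + co 0 != 0 :> R by rewrite co0.
have c37 : 3 - 7 * cosr C0 S0 0 != 0 by rewrite cosr0.
have a0 : cusp_al C0 0 != 0 by rewrite al1 pnatr_eq0.
apply: (@local_diffeo_triangular2 _ _ (fun t => - ((3 * t / (1 + co t) - 7 * S0) / (3 - 7 * cosr C0 S0 t)))
  (fun t => (3 - cusp_A C0 t - 2 * cusp_G C0 t ^+ 2) / cusp_al C0 t)); rewrite ?Psi0 ?z2 //.
- by apply: smooth_at_row2.
- by smooth.
- by smooth.
- rewrite oppr_eq0 cosr0 co0 mulr0 mul0r sub0r mulf_neq0 //; first by rewrite oppr_eq0 mulf_neq0 ?pnatr_eq0.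
  by rewrite invr_eq0.
- rewrite A1 /cusp_G mul0r expr0n mulr0 !subr0 mulf_neq0 ?pnatr_eq0 //; by rewrite invr_eq0.
- have n1 := near_sq_le1 sid erefl.
  apply: filterS n1 => t /co_sq ct; rewrite /tPsi !row2E.
  rewrite /cusp_x /cusp_c /cusp_G /cusp_A !mul0r !expr0n !mulr0 !subr0 !add0r /cusp_al co0 mulr1; congr row2.
  have c1' : 1 + co t != 0 by rewrite gt_eqF // ltr_pwDl // sqrtr_ge0.
  rewrite mulrN mulrA; congr (- (_ / _)).
  transitivity (t * (3 * t / (1 + co t) - 7 * S0) + (7 * C0 + 3) * co t +
     3 * (1 - t ^+ 2 - co t ^+ 2) / (1 + co t)); last by rewrite ct C7 addNr subrr mulr0 mul0r mul0r !addr0.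
  by rewrite /cosr; field.
- apply: filterE => t; rewrite /tPsi !row2E cosr0 add0r /cusp_c.
  by move: (cusp_A _ _) => A; rewrite /cusp_G; ring.
Qed.

(** The height as a function of sin chi has derivative 3 - 7 C0 = 6 at 0, so sin chi is a legitimate
    target coordinate. *)
Let trho_local_diffeo : local_diffeo 0 (fun u : 'rV[R]_2 => polar C0 S0 (row2 (u 0 0) (trho u))).
Proof.
have c0 : smooth_at 0 (fun u : 'rV[R]_2 => u 0 0) by smooth.
have c1 : smooth_at 0 (fun u : 'rV[R]_2 => u 0 1) by smooth.
have sC := cosr_smooth C0 S0 c0 (z2 0).
have s1 := co_smooth c1 (z2 1).
apply: (@polar_target _ _ _ _ (fun t => 3 * co t - 7 * C0)) => //.
- by rewrite /trho; smooth.
- by rewrite /trho !z2 mul0r addr0 pnatr_eq0.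
- by smooth; exact: smooth_at_cst.
- by rewrite co0 mulr1.
- by apply: filterE => t; rewrite /trho !row2E !z2 mul0r addr0 cosr0.
Qed.

Let base_near : \forall p \near (0 : 'rV[R]_3),
  hopf_map (base_chart C0 S0 1 0 p) = polar C0 S0 (row2 (p 0 0)
    (100 + p 0 1 * (7 * tC p + 3 * co (p 0 1)) - p 0 2%R ^+ 2 * tB p)) /\ 0 < tB p.
Proof.
have sC := cosr_smooth C0 S0 (coord_smooth 0) (z3 0).
have sS := sinr_smooth C0 S0 (coord_smooth 0) (z3 0).
have sK := cosr_smooth 1 0 (coord_smooth 1) (z3 1).
have ss := sinr_smooth 1 0 (coord_smooth 1) (z3 1).
have sl := co_smooth (coord_smooth 2%R) (z3 2%R).
have l1 : 1 + co ((0 : 'rV[R]_3) 0 2%R) != 0 by rewrite z3 co0.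
have sB : smooth_at 0 tB by rewrite /tB /bump; smooth.
pose f (p : 'rV[R]_3) := 1 + sph1 (tC p) (sinr C0 S0 (p 0 0)) (cosr 1 0 (p 0 1))
  (sinr 1 0 (p 0 1)) (co (p 0 2%R)) (p 0 2%R).
have sf : smooth_at 0 f by rewrite /f /sph1; smooth.
have n1 : \forall p \near (0 : 'rV[R]_3), f p != 0.
  apply: continuous_near (smooth_at_continuous sf) (@open_neq _ 0) _.
  rewrite /= /f /sph1 tC0 !z3 !cosr0 !sinr0 co0 !mulr1 mulr0 subr0.
  by apply/eqP => ?; have := C7; lra.
have u0 := near_sq_le1 (coord_smooth 0) (z3 0).
have u1 := near_sq_le1 (coord_smooth 1) (z3 1).
have u2 := near_sq_le1 (coord_smooth 2%R) (z3 2%R).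
have nB := near_gt0 sB tB0_gt0.
near=> p; split; last by near: p.
have Ks : (1 : R) ^+ 2 + 0 ^+ 2 = 1 by rewrite expr1n expr0n addr0.
have lj : co (p 0 2%R) ^+ 2 + p 0 2%R ^+ 2 = 1 by rewrite co_sq ?subrK //; near: p.
rewrite /base_chart hopf_map_chart //.
- rewrite radiusE //; last exact: sqrtr_ge0.
  rewrite /polar !row2E -/(tC p) -/(tB p).
  have -> : cosr 1 0 (p 0 1) = co (p 0 1) by rewrite /cosr mul1r mul0r subr0.
  have -> : sinr 1 0 (p 0 1) = p 0 1 by rewrite /sinr mul1r mul0r add0r.
  by [].
- by apply: rot_unit => //; near: p.
- by apply: rot_unit => //; near: p.
- by near: p.
Unshelve. all: by end_near. Qed.

Let cusp_near : \forall q \near (0 : 'rV[R]_3),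
  [/\ co ((q : 'rV[R]_3) 0 1) ^+ 2 = 1 - q 0 1 ^+ 2, co (tom q) ^+ 2 = 1 - tom q ^+ 2,
    0 <= co (q 0 1) * co (tom q) + q 0 1 * tom q & 0 <= co (q 0 1) * co (tom q) - q 0 1 * tom q] /\
  [/\ 1 - 2 * q 0 1 ^+ 2 != 0, co (q 0 1) != 0, 0 < tal q * co (q 0 1) ^+ 3, tal q != 0 &
    0 < 2 * co (tom q)].
Proof.
have c1 := coord_smooth 1.
have n1 := near_sq_le1 c1 (z3 1). have n2 := near_sq_le1 tom_smooth tom0.
have n3 : \forall q \near (0 : 'rV[R]_3), 0 < co ((q : 'rV[R]_3) 0 1) * co (tom q) + q 0 1 * tom q.
  by apply: near_gt0; [smooth|rewrite z3 tom0 co0 mul0r mulr1 addr0].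
have n4 : \forall q \near (0 : 'rV[R]_3), 0 < co ((q : 'rV[R]_3) 0 1) * co (tom q) - q 0 1 * tom q.
  by apply: near_gt0; [smooth|rewrite z3 tom0 co0 mul0r mulr1 subr0].
have n5 : \forall q \near (0 : 'rV[R]_3), 0 < 1 - 2 * (q : 'rV[R]_3) 0 1 ^+ 2.
  by apply: near_gt0; [smooth|rewrite z3 expr0n mulr0 subr0].
have n6 : \forall q \near (0 : 'rV[R]_3), 0 < co ((q : 'rV[R]_3) 0 1).
  by apply: near_gt0; [smooth|rewrite z3 co0].
have n7 : \forall q \near (0 : 'rV[R]_3), 0 < tal q by apply: near_gt0; rewrite ?tal0.
have n8 : \forall q \near (0 : 'rV[R]_3), 0 < 2 * co (tom q).
  by apply: near_gt0; [smooth|rewrite tom0 co0 mulr1].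
near=> q; split; split.
- by apply: co_sq; near: q.
- by apply: co_sq; near: q.
- by apply: ltW; near: q.
- by apply: ltW; near: q.
- by rewrite gt_eqF //; near: q.
- by rewrite gt_eqF //; near: q.
- by rewrite mulr_gt0 ?exprn_gt0 //; near: q.
- by rewrite gt_eqF //; near: q.
- by near: q.
Unshelve. all: by end_near. Qed.

(** [tLam] absorbs the factor [tB] of the normal direction, and [tPi] prescribes psi and z sqrt (2
    cos om) for the resulting coordinates. The height then depends on q_0 and chi alone, so g
    factors through [te]; [tPhi] and [tPsi] are read off from the two sides of the depressed
    cubic. *)
Lemma cusp_normal_form : locally_given_by (@cusp_model R) (@hopf_map R) (chart C0 S0 1 0 1 0).
Proof.
have [h [dh]] := local_diffeo_inv tLam_local_diffeo.
have Lam0 : tLam 0 = 0 by rewrite /tLam !z3 mul0r row3_000.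
rewrite Lam0 => h0 _ hK.
have Pi0 : tPi 0 = 0 by rewrite /tPi !z3 tpsi0 mul0r row3_000.
have Ks : (1 : R) ^+ 2 + 0 ^+ 2 = 1 by rewrite expr1n expr0n addr0.
have n0 : 1 + C0 * 1 != 0 by apply/eqP => ?; have := C7; lra.
have dhPi : local_diffeo 0 (fun q => h (tPi q)).
  by apply: local_diffeo_comp; rewrite ?Pi0 // -Lam0.
have hPi0 : h (tPi 0) = 0 by rewrite Pi0.
have dE : local_diffeo 0 (fun q => base_chart C0 S0 1 0 (h (tPi q))).
  by apply: (local_diffeo_comp dhPi); rewrite hPi0; exact: base_chart_local_diffeo.
have -> : chart C0 S0 1 0 1 0 = base_chart C0 S0 1 0 (h (tPi 0)).
  by rewrite hPi0 /base_chart !z3 !cosr0 !sinr0 co0.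
have chPi : {for 0, continuous (fun q => h (tPi q))}.
  exact/smooth_at_continuous/local_diffeo_smooth.
have cPi : {for 0, continuous tPi}.
  exact/smooth_at_continuous/local_diffeo_smooth.
have Phi0 : tPhi 0 = 0.
  rewrite /tPhi tC0 tchi0 !z3 !mul0r /cusp_x /cusp_A /cusp_G C7 co0 mul0r expr0n mulr0 add0r subr0.
  by rewrite mulr1 addNr mul0r oppr0 row3_000.
have Psi0 : tPsi 0 = 0.
  rewrite /tPsi !z2 cosr0 /cusp_x /cusp_c /cusp_A /cusp_G C7 co0 mulr1 addNr !mul0r !expr0n !mulr0.
  by rewrite addr0 !subr0 oppr0 row2_00.
have e0 : te 0 = 0 by rewrite /te z3 tchi0 row2_00.
apply: (@locally_given_by_param _ _ _ _ tPhi te _ tPsi dE tPhi_local_diffeo Phi0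
  trho_local_diffeo tPsi_local_diffeo Psi0 _ e0).
- by apply: smooth_at_continuous; apply: smooth_at_row2.
- have b1 : \forall q \near (0 : 'rV[R]_3), hopf_map (base_chart C0 S0 1 0 (h (tPi q))) =
      polar C0 S0 (row2 (h (tPi q) 0 0) (100 + h (tPi q) 0 1 * (7 * tC (h (tPi q)) +
      3 * co (h (tPi q) 0 1)) - h (tPi q) 0 2%R ^+ 2 * tB (h (tPi q)))) /\ 0 < tB (h (tPi q)).
    by apply: (chPi [set p | hopf_map (base_chart C0 S0 1 0 p) = polar C0 S0 (row2 (p 0 0)
      (100 + p 0 1 * (7 * tC p + 3 * co (p 0 1)) - p 0 2%R ^+ 2 * tB p)) /\ 0 < tB p]); rewrite hPi0.
  have b2 : \forall q \near (0 : 'rV[R]_3), tLam (h (tPi q)) = tPi q.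
    by apply: (cPi [set p | tLam (h p) = p]); rewrite Pi0.
  apply: filterS3 b1 b2 cusp_near => q [-> B0] LE [[su sw p0 p1] [d0 c0 al3 al0 om0]].
  have E j : tLam (h (tPi q)) 0 j = tPi q 0 j by rewrite LE.
  have := E 0; have := E 1; have := E 2%R; rewrite /tLam !row3E => E2 E1 E0.
  have E2' : h (tPi q) 0 2%R ^+ 2 * tB (h (tPi q)) = 2 * co (tom q) * q 0 2%R ^+ 2.
    have := congr1 (fun x => x ^+ 2) E2; rewrite ![(_ * Num.sqrt _) ^+ 2]exprMn.
    by rewrite (sqr_sqrtr (ltW B0)) (sqr_sqrtr (ltW om0)) => ->; rewrite mulrC.
  have [_ _ H] := cusp_height d0 su sw p0 p1.
  rewrite E2' E0 E1 /te !row2E; congr (polar _ _ (row2 _ _)).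
  by rewrite /trho !row2E -/(tC q) -H {1}/tC E0 -/(tC q) !addrA.
- apply: filterS cusp_near => q [[su sw p0 p1] [d0 c0 al3 al0 om0]].
  have [_ Ec _] := cusp_height d0 su sw p0 p1.
  rewrite /tPsi /te /tPhi /cusp_model !row2E !row3E -/(tC q); congr row2.
  rewrite [(_ / Num.sqrt _) ^+ 2]exprMn exprVn (sqr_sqrtr (ltW al3)).
  by rewrite -(cusp_cubic c0 d0 su sw Ec al0).
Qed.

End Cusp.

(** * Normal forms at all singular points *)

Section NormalForms.
Context {R : realType}.
Implicit Types (x : 'rV[R]_3).

(** K = |U| is positive by the fold equation, C + iS = U / K, and Re (U conj V) = 0 makes V a real
    multiple s of i (C + iS). Taking K positive settles the common sign of the four numbers. *)
Lemma singular_chart x : singular_set (@hopf_map R) x -> exists C S K s : R,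
  [/\ C ^+ 2 + S ^+ 2 = 1, K ^+ 2 + s ^+ 2 = 1, 0 < K, 6 * K ^+ 2 + 7 * C * K - 3 = 0 &
    1 + C * K != 0] /\ x = chart C S K s 1 0.
Proof.
move=> /hopf_map_singular[]; rewrite /on_clifford /on_fold /clif.
have nx := nrm_neq0 x; have := st_sphere x.
have a1 : 1 + st1 x = 2 / nrm x by rewrite /st1 subrKC.
have x0 : st2 x / (1 + st1 x) = x 0 0 by rewrite a1 /st2; field.
have x1 : st4 x / (1 + st1 x) = x 0 1 by rewrite a1 /st4; field.
have x2 : st3 x / (1 + st1 x) = x 0 2%R by rewrite a1 /st3; field.
have {nx}a1 : 1 + st1 x != 0 by rewrite a1 mulf_neq0 ?pnatr_eq0 // invr_eq0.
move: a1 x0 x1 x2; move: (st1 x) (st2 x) (st3 x) (st4 x) => a b c d a1 x0 x1 x2 sph clf fld.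
have ab : 0 < a ^+ 2 + b ^+ 2.
  rewrite lt_def addr_ge0 ?sqr_ge0 // andbT; apply/eqP => ab.
  have : a = 0 by apply/eqP; rewrite -sqrf_eq0 eq_le sqr_ge0 andbT; have := sqr_ge0 b; lra.
  by move=> a0; move: fld ab sph; rewrite a0 expr0n; lra.
pose K := Num.sqrt (a ^+ 2 + b ^+ 2).
have K2 : K ^+ 2 = a ^+ 2 + b ^+ 2 by rewrite sqr_sqrtr // ltW.
have Kgt0 : 0 < K by rewrite sqrtr_gt0.
have K0 : K != 0 by rewrite gt_eqF.
have s2 : (a * d - b * c) ^+ 2 = K ^+ 2 * (c ^+ 2 + d ^+ 2).
  transitivity (K ^+ 2 * (c ^+ 2 + d ^+ 2) - (a * c + b * d) ^+ 2); first by rewrite K2; ring.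
  by rewrite clf expr0n subr0.
have Ka : a / K * K = a by rewrite divfK.
have Ed : a / K * ((a * d - b * c) / K) = d.
  transitivity (((a ^+ 2 + b ^+ 2) * d - b * (a * c + b * d)) / K ^+ 2); first by field.
  by rewrite clf -K2 mulr0 subr0 mulrC mulKf // sqrf_eq0.
have Ec : b / K * ((a * d - b * c) / K) = - c.
  transitivity (- ((a ^+ 2 + b ^+ 2) * c - a * (a * c + b * d)) / K ^+ 2); first by field.
  by rewrite clf -K2 mulr0 subr0 mulNr mulrC mulKf // sqrf_eq0.
exists (a / K), (b / K), K, ((a * d - b * c) / K); split; first split=> //.
- by rewrite !expr_div_n -mulrDl -K2 divff // sqrf_eq0.
- by rewrite expr_div_n s2 mulrC mulKf ?sqrf_eq0 // K2 -sph; ring.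
- by rewrite -mulrA Ka K2; lra.
- by rewrite Ka.
apply: eq_row3; rewrite /chart row3E /sph1 /sph2 /sph3 /sph4 !(mulr1, mulr0, mul0r, subr0, addr0, add0r, sub0r).
- by rewrite Ka divfK.
- by rewrite Ka Ed.
- by rewrite Ka Ec opprK.
Qed.

(** For s = 0 the equations leave K = 1 and C = -3/7, the cusps; otherwise the sign of s decides the
    type of fold. *)
Lemma hopf_map_excellent : excellent (@hopf_map R).
Proof.
split; first by apply: smooth_on_at => x _; exact: hopf_map_smooth.
move=> x /singular_chart[C [S [K [s [[CS Ks K0 crit n0] ->]]]]].
have [s0|s0] := eqVneq s 0.
  right; have K1 : K = 1.
    apply/eqP; rewrite -(eqrXn2 _ _ _ (n := 2%N)) ?ler01 ?(ltW K0) // expr1n.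
    by apply/eqP; rewrite -Ks s0 expr0n addr0.
  move: crit; rewrite K1 s0 expr1n !mulr1 => crit.
  by apply: cusp_normal_form => //; lra.
left; exists (s < 0); apply: fold_normal_form => //.
case: (ltrP s 0) => [sl|sg]; first by rewrite expr1 mulN1r oppr_gt0.
by rewrite expr0 mul1r lt_def s0.
Qed.

End NormalForms.

Lemma component_sub (R : realType) (A C : set 'rV[R]_3) : component_of A C -> C `<=` A.
Proof. by move=> [x Ax ->]; exact: connected_component_sub. Qed.

Theorem mainTheorem5 (R : realType) :
  exists (g : 'rV[R]_3 -> 'rV[R]_2) (y : 'rV[R]_2),
    [/\ excellent g,
        regular_value g y,
        link (g @^-1` [set y]) /\ g @^-1` [set y] !=set0,
        (forall K C : set 'rV[R]_3,
           component_of (g @^-1` [set y]) K ->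
           component_of (singular_set g) C ->
           ~ linked_by K C) &
        unknotted_circle (singular_set g) /\
        exists B : set 'rV[R]_3,
          [/\ ball3 B,
              singular_set g `<=` B &
              B `&` g @^-1` [set y] = set0]].
Proof.
have [B [Bb SB BL]] := @hopf_map_ball R.
exists (@hopf_map R), 0; split.
- exact: hopf_map_excellent.
- exact: hopf_map_regular0.
- by split; [exact: hopf_fibre_link|exact: hopf_fibre_nonempty].
- move=> K C /component_sub KL /component_sub CS; apply; exists B; split=> //.
    exact: subset_trans SB.
  by rewrite -subset0 -BL; exact: setIS.
- by split; [exact: hopf_map_unknotted|exists B].
Qed.
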